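(* Let $\Omega_1\subset\mathbb{R}^{d_1}$ and $\Omega_2\subset\mathbb{R}^{d_2}$ be domains, equipped with Lebesgue measure, let $p\ge 1$ and let $l\geq 1$ be an integer, and suppose that $pl>d_2$, or $p=1$ and $l=d_2$. Then every function in the Sobolev space $W_p^l(\Omega_1\times\Omega_2)$ is virtually continuous as a function of the two variables $x\in\Omega_1$, $y\in\Omega_2$. Moreover, for every compact subset $K\subset\Omega_2$ the embedding (by restriction to $\Omega_1\times K$) of $W_p^l(\Omega_1\times\Omega_2)$ into $VC^1(\Omega_1,K)$ is continuous.
   Context: $W_p^l(\Omega)$ is the usual Sobolev space of functions whose generalized derivatives up to order $l$ are summable with power $p$, with its usual norm. All functions are real-valued and measurable functions are identified when they coincide almost everywhere. Let $(X,\mu)$, $(Y,\nu)$ be the given measure spaces. A semimetric $\rho$ on $X$ is admissible if it is measurable as a function of two variables on $(X\times X,\mu\times\mu)$ and there is a subset $X_0\subset X$ of full measure such that $(X_0,\rho)$ is separable; admissibility on a measurable subset is understood with respect to the restricted measure. For semimetrics $\rho_X,\rho_Y$, $\rho_X\times\rho_Y$ denotes any semimetric defining the product topology, e.g. $\rho_X(x_1,x_2)+\rho_Y(y_1,y_2)$. A measurable function $f(\cdot,\cdot)$ on $X\times Y$ is virtually continuous if for any $\varepsilon>0$ there exist measurable sets $X'\subset X$, $Y'\subset Y$, with $\mu(X\setminus X')\le\varepsilon$, $\nu(Y\setminus Y')\le\varepsilon$, and admissible semimetrics $\rho_X,\rho_Y$ on $X',Y'$ respectively such that $f$ coincides almost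 everywhere on $X'\times Y'$ with a function that is continuous on $(X'\times Y',\rho_X\times\rho_Y)$. For a measurable function $f$ on $X\times Y$ put $$\|f\|_{VC^1}=\inf\Big\{\int_X|a(x)|\,d\mu(x)+\int_Y|b(y)|\,d\nu(y)\ :\ |f(x,y)|\le a(x)+b(y)\ \text{a.e.}\Big\}\in[0,\infty],$$ the infimum being over measurable functions $a$ on $X$ and $b$ on $Y$. $VC^1(X,Y)$ is the space of virtually continuous functions $f$ on $X\times Y$ with $\|f\|_{VC^1}<\infty$, with this norm. Here $X=\Omega_1$ and $Y=\Omega_2$ or $Y=K$, all with Lebesgue measure. *)

(* Defs.v *)
From HB Require Import structures.
From mathcomp Require Import all_boot all_order all_algebra.
From mathcomp Require Import all_classical all_reals all_analysis.

Set Implicit Arguments.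
Unset Strict Implicit.
Unset Printing Implicit Defensive.

Import Order.TTheory GRing.Theory Num.Theory.
Import numFieldNormedType.Exports.

Local Open Scope classical_set_scope.
Local Open Scope ring_scope.

Definition measure_rV_display : measure_display.
Proof. exact: default_measure_display. Qed.

(* ['rV[R]_d1 * 'rV[R]_d2] plays the role of R^(d1 + d2) throughout. *)

Section rV_measurable.
Context {R : realType}.
Variable n : nat.

Let coors : 'I_n -> 'rV[R]_n -> R := fun i x => x ord0 i.

Let rV_set0 : g_sigma_preimage coors set0.
Proof. exact: sigma_algebra0. Qed.

Let rV_setC A : g_sigma_preimage coors A -> g_sigma_preimage coors (~` A).
Proof. exact: sigma_algebraC. Qed.

Let rV_bigcup (F : _^nat) : (forall i, g_sigma_preimage coors (F i)) ->
  g_sigma_preimage coors (\bigcup_i (F i)).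
Proof. exact: sigma_algebra_bigcup. Qed.

(* The sigma-algebra generated by the coordinates, i.e., the Borel sets. *)
HB.instance Definition _ := @isMeasurable.Build measure_rV_display
  'rV[R]_n (g_sigma_preimage coors) rV_set0 rV_setC rV_bigcup.

End rV_measurable.

Section lebesgue_rV.
Context {R : realType}.

Lemma measurable_coord n (i : 'I_n) :
  measurable_fun [set: 'rV[R]_n] (fun x : 'rV[R]_n => x ord0 i).
Proof.
move=> _ Y mY; rewrite setTI; apply: sub_sigma_algebra => /=.
rewrite -bigcup_seq/=; exists i => /=; first by rewrite mem_index_enum.
by exists Y => //; rewrite setTI.
Qed.

Lemma measurable_fun_rVP d (T : measurableType d) n (f : T -> 'rV[R]_n) :
  (forall i, measurable_fun [set: T] (fun t => f t ord0 i)) ->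
  measurable_fun [set: T] f.
Proof.
move=> mf _ A mA.
have : preimage_set_system [set: T] f measurable (setT `&` f @^-1` A).
  by exists A.
rewrite /measurable/= -g_sigma_preimage_comp.
apply: smallest_sub; first exact: sigma_algebra_measurable.
rewrite -bigcup_seq/=; apply: bigcup_sub => i _ B [C mC <-].
exact: mf.
Qed.

Definition rV_cons n (p : measurableTypeR R * 'rV[R]_n) : 'rV[R]_n.+1 :=
  \row_i (if unlift ord0 i is Some j then p.2 ord0 j else p.1).

Definition rV_uncons n (x : 'rV[R]_n.+1) : measurableTypeR R * 'rV[R]_n :=
  (x ord0 ord0, \row_j x ord0 (lift ord0 j)).

Lemma rV_consK n : cancel (@rV_cons n) (@rV_uncons n).
Proof.
move=> [a x]; rewrite /rV_uncons /rV_cons mxE unlift_none; congr (_, _).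
by apply/rowP => j; rewrite !mxE liftK.
Qed.

Lemma measurable_rV_cons n : measurable_fun setT (@rV_cons n).
Proof.
apply: measurable_fun_rVP => i; rewrite /rV_cons.
under eq_fun do rewrite mxE.
case: unliftP => [j _|_]; last exact: measurable_fst.
exact: (measurableT_comp (measurable_coord j) measurable_snd).
Qed.

Lemma measurable_rV_uncons n : measurable_fun setT (@rV_uncons n).
Proof.
apply/measurable_fun_pairP; split.
  exact: measurable_coord.
apply: measurable_fun_rVP => i; rewrite /rV_uncons/=.
by under eq_fun do rewrite mxE; exact: measurable_coord.
Qed.

HB.instance Definition _ n :=
  isMeasurableFun.Build _ _ _ _ (@rV_cons n) (@measurable_rV_cons n).

Section lebesgue_rVS.
Variables (n : nat) (m : {sigma_finite_measure set 'rV[R]_n -> \bar R}).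

Definition lebesgue_rVS : set 'rV[R]_n.+1 -> \bar R :=
  pushforward (lebesgue_measure \x m)%E (@rV_cons n).

Let lebesgue_rVS0 : lebesgue_rVS set0 = 0%E.
Proof. exact: measure0. Qed.

Let lebesgue_rVS_ge0 A : (0 <= lebesgue_rVS A)%E.
Proof. exact: measure_ge0. Qed.

Let lebesgue_rVS_semi_sigma_additive : semi_sigma_additive lebesgue_rVS.
Proof. exact: measure_semi_sigma_additive. Qed.

HB.instance Definition _ := isMeasure.Build _ _ _ lebesgue_rVS
  lebesgue_rVS0 lebesgue_rVS_ge0 lebesgue_rVS_semi_sigma_additive.

Let lebesgue_rVS_sigma_finite : sigma_finite setT lebesgue_rVS.
Proof.
have /sigma_finiteP[F [FT ndF Foo]] := sigma_finiteT (@lebesgue_measure R).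
have /sigma_finiteP[G [GT ndG Goo]] := sigma_finiteT m.
exists (fun k => @rV_uncons n @^-1` (F k `*` G k)).
  rewrite -preimage_bigcup (_ : \bigcup_k (F k `*` G k) = setT) ?preimage_setT//.
  apply/seteqP; split => // -[x y] _.
  have : [set: _] x by []. rewrite FT => -[k _ Fkx].
  have : [set: _] y by []. rewrite GT => -[k' _ Gky].
  exists (maxn k k') => //; split => /=.
    by move: x Fkx; exact/subsetPset/ndF/leq_maxl.
  by move: y Gky; exact/subsetPset/ndG/leq_maxr.
move=> k; have [mF Fkoo] := Foo k; have [mG Gkoo] := Goo k; split.
  rewrite -[X in measurable X]setTI; apply: measurable_rV_uncons => //.
  exact: measurableX.
rewrite /lebesgue_rVS /pushforward -comp_preimage.
rewrite (_ : @rV_uncons n \o @rV_cons n = id); last exact/funext/rV_consK.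
by rewrite product_measure1E// lte_mul_pinfty// ge0_fin_numE.
Qed.

HB.instance Definition _ := Measure_isSigmaFinite.Build _ _ _ lebesgue_rVS
  lebesgue_rVS_sigma_finite.

End lebesgue_rVS.

(* On the one-point space ['rV[R]_0], the unit mass. *)
Fixpoint lebesgue_rV n : {sigma_finite_measure set 'rV[R]_n -> \bar R} :=
  if n is n'.+1 then lebesgue_rVS (lebesgue_rV n') else \d_(0 : 'rV[R]_0).

Lemma lebesgue_rV_box n (A : 'I_n -> set (measurableTypeR R)) :
  (forall i, measurable (A i)) ->
  lebesgue_rV n [set x | forall i, A i (x ord0 i)] =
  (\prod_(i < n) lebesgue_measure (A i))%E.
Proof.
elim: n A => [|n IH] A mA.
  by rewrite big_ord0 /= diracE mem_set// => -[].
rewrite big_ord_recl /= /lebesgue_rVS /pushforward.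
pose B := [set x : 'rV[R]_n | forall i, A (lift ord0 i) (x ord0 i)].
rewrite (_ : _ @^-1` _ = A ord0 `*` B); last first.
  apply/seteqP; split => [[a x] /= H|[a x] /= [Aa Bx] i].
    split => [|i]; first by have := H ord0; rewrite mxE unlift_none.
    by have := H (lift ord0 i); rewrite mxE liftK.
  by rewrite mxE; case: unliftP => [j|] ->.
rewrite product_measure1E//.
  congr *%E; exact: (IH (fun i => A (lift ord0 i)) (fun i => mA _)).
have -> : B = \bigcap_(i in [set: 'I_n])
    ((fun x : 'rV[R]_n => x ord0 i) @^-1` A (lift ord0 i)).
  by apply/seteqP; split => x /= Bx i; [move=> _|]; exact: Bx.
apply: fin_bigcap_measurable => [|i _]; first exact: finite_finset.
rewrite -[X in measurable X]setTI.
exact: (measurable_coord i measurableT (mA (lift ord0 i))).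
Qed.

End lebesgue_rV.

Section measurability.
Context d (T : measurableType d) (R : realType).

(* Measurability with respect to the [mu]-completion of the ambient
   sigma-algebra.  Integrals need no change for such functions: [integral] is
   defined through suprema over measurable simple functions, which do not see
   modifications on null sets. *)
Definition ae_measurable (mu : set T -> \bar R) (D : set T) (f : T -> R) :=
  exists2 g : T -> R, measurable_fun D g &
    {ae mu, forall x, D x -> f x = g x}.

End measurability.

Section virtual_continuity.
Context d (T : measurableType d) (R : realType).
Variable mu : {sigma_finite_measure set T -> \bar R}.
Implicit Types (A : set T) (rho : T -> T -> R).

Definition semimetric A rho :=
  [/\ forall x, A x -> rho x x = 0,
      forall x y, A x -> A y -> 0 <= rho x y,
      forall x y, A x -> A y -> rho x y = rho y x &
      forall x y z, A x -> A y -> A z -> rho x z <= rho x y + rho y z].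

Definition separable_for A rho := exists C : set T,
  [/\ countable C, C `<=` A &
      forall x, A x -> forall e, 0 < e -> exists2 c, C c & rho x c < e].

Definition admissible A rho :=
  [/\ semimetric A rho,
      ae_measurable (mu \x mu)%E (A `*` A) (fun z => rho z.1 z.2) &
      exists A0, [/\ A0 `<=` A, mu.-negligible (A `\` A0) & separable_for A0 rho]].

End virtual_continuity.

Section VC.
Context dX dY (TX : measurableType dX) (TY : measurableType dY) (R : realType).
Variables (mu : {sigma_finite_measure set TX -> \bar R})
          (nu : {sigma_finite_measure set TY -> \bar R}).
Implicit Types (X : set TX) (Y : set TY) (f : TX * TY -> R).

Definition continuous_semimetrics X Y
    (rhoX : TX -> TX -> R) (rhoY : TY -> TY -> R) f :=
  forall x y, X x -> Y y -> forall e, 0 < e -> exists2 r, 0 < r &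
    forall x' y', X x' -> Y y' -> rhoX x x' + rhoY y y' < r ->
      `|f (x', y') - f (x, y)| < e.

(* [X] and [Y] are meant to be measurable, with the restrictions of [mu] and
   [nu].  Taking [X'] and [Y'] in the sigma-algebra itself rather than in its
   completion is harmless: every set of the completion contains one of the
   former of the same measure, and all the conditions pass to smaller sets. *)
Definition virtually_continuous X Y f :=
  ae_measurable (mu \x nu)%E (X `*` Y) f /\
  forall e, 0 < e -> exists X' Y',
    [/\ measurable X' /\ X' `<=` X, measurable Y' /\ Y' `<=` Y,
        (mu (X `\` X') <= e%:E)%E, (nu (Y `\` Y') <= e%:E)%E &
        exists rhoX rhoY g,
          [/\ admissible mu X' rhoX, admissible nu Y' rhoY,
              {ae (mu \x nu)%E, forall z, (X' `*` Y') z -> f z = g z} &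
              continuous_semimetrics X' Y' rhoX rhoY g]].

Definition VC1_norm X Y f : \bar R :=
  ereal_inf [set r | exists a b,
    [/\ ae_measurable mu X a, ae_measurable nu Y b,
        {ae (mu \x nu)%E, forall z, (X `*` Y) z -> `|f z| <= a z.1 + b z.2} &
        r = (\int[mu]_(x in X) `|a x|%:E + \int[nu]_(y in Y) `|b y|%:E)%E]].

Definition VC1 X Y f :=
  virtually_continuous X Y f /\ (VC1_norm X Y f < +oo)%E.

End VC.

Section sobolev.
Context {R : realType} {d1 d2 : nat}.

Local Notation E := ('rV[R]_d1 * 'rV[R]_d2)%type.
Local Notation coord := ('I_d1 + 'I_d2)%type.
Local Notation mu := (lebesgue_rV d1 \x lebesgue_rV d2)%E.
Implicit Types (Omega : set E) (f g phi : E -> R) (alpha : coord -> nat).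

Definition basis_vec (i : coord) : E :=
  match i with
  | inl j => (delta_mx ord0 j, 0)
  | inr j => (0, delta_mx ord0 j)
  end.

Definition partials (s : seq coord) phi : E -> R :=
  foldr (fun i (g : E -> R) => 'D_(basis_vec i) g) phi s.

Definition multi_partial alpha phi : E -> R :=
  partials (flatten [seq nseq (alpha i) i | i : coord]) phi.

Definition multi_order alpha := (\sum_i alpha i)%N.

Definition smooth phi := forall s : seq coord,
  continuous (partials s phi) /\
  forall z i, derivable (partials s phi) z (basis_vec i).

Definition test_function Omega phi :=
  [/\ smooth phi, compact (closure [set z | phi z != 0]) &
      closure [set z | phi z != 0] `<=` Omega].

Definition locally_summable Omega f :=
  ae_measurable mu Omega f /\
  forall K, compact K -> K `<=` Omega -> (\int[mu]_(z in K) `|f z|%:E < +oo)%E.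

Definition is_weak_partial Omega alpha f g :=
  locally_summable Omega g /\
  forall phi, test_function Omega phi ->
    \int[mu]_(z in Omega) (f z * multi_partial alpha phi z) =
    (-1) ^+ multi_order alpha * \int[mu]_(z in Omega) (g z * phi z).

(* Any two weak partials agree almost everywhere on an open [Omega], so this
   choice of a representative does not affect [sobolev_norm]. *)
Definition weak_partial Omega alpha f : E -> R :=
  xget (cst 0) [set g | is_weak_partial Omega alpha f g].

Definition sobolev (p : R) (l : nat) Omega f :=
  locally_summable Omega f /\
  forall alpha, (multi_order alpha <= l)%N -> exists2 g,
    is_weak_partial Omega alpha f g &
    (\int[mu]_(z in Omega) (`|g z| `^ p)%:E < +oo)%E.

(* The multi-indices of order at most [l], whose components are at most [l]. *)
Definition sobolev_norm (p : R) (l : nat) Omega f : \bar R :=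
  ((\sum_(a : {ffun coord -> 'I_l.+1} | (multi_order (fun i => a i) <= l)%N)
    \int[mu]_(z in Omega)
      (`|weak_partial Omega (fun i => a i) f z| `^ p)%:E) `^ p^-1)%E.

End sobolev.

Definition is_domain (T : topologicalType) (A : set T) :=
  [/\ A !=set0, open A & connected A].

(* Main.v *)
Require Import Defs.
From mathcomp Require Import all_boot all_order all_algebra.
From mathcomp Require Import all_classical all_reals all_analysis.
From mathcomp Require Import measurable_realfun.
From mathcomp Require Import ring lra.
Set Implicit Arguments.
Unset Strict Implicit.
Unset Printing Implicit Defensive.
Import Order.TTheory GRing.Theory Num.Theory.
Import numFieldNormedType.Exports.
Local Open Scope classical_set_scope.
Local Open Scope ring_scope.

(** The proof follows a function f slice by slice. For almost every x the slice
    u |-> f(x, u) has weak derivatives v_i of order l in each coordinate with finite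
    p-energy, and the relation between p, l and d = d2 is the one under which such a
    slice has a continuous representative, controlled by the energy
    int |f(x, u)|^p du + sum_i int |v_i(x, u)|^p du. The energy is integrable in x, and
    the whole theorem comes from making this control quantitative.

    Mollify the slice: f_k(x, y) is the integral of f(x, u) kap_k(y, u), where kap_k is
    the product over the coordinates of eta_k(y_j - u_j), and eta_k is a mollifier of
    width 2^-k. It is built so that eta_k - eta_{k+1} is the derivative of order l of a
    function zeta_k with compact support and size 2^(-k(l - 1)). Telescoping the product
    one coordinate at a time then yields
      f_k - f_{k+1} = sum_i int v_i(x, u) Z_{k,i}(y, u) du,   |Z_{k,i}| <= C 2^(kd - kl),
    where Z_{k,i} is supported in a cube of size 2^-k near y. Only the pure derivatives
    of order l enter. By definition of weak derivatives this holds after averaging in x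
    against cut-offs; by the du Bois-Reymond lemma ([box_null_ae]) it holds for almost
    every x at each rational y ([rem_ae], [good_section_ae]), and continuity in y extends
    the resulting estimates to all y ([rational_closure]).

    The key estimate is [pot_sum]: for every tau > 0 there is a constant Lam such that,
    for all nonnegative w, all y and all n <= m,
      sum_{n <= k < m} 2^(kd - kl) int_{cube_k(y)} w <= tau + Lam int w^p.
    If pl > d, cut w at the height lam 2^(kd/p) in generation k and sum a geometric series;
    if p = 1 and l = d, use that a point lies in at most three of the cubes. The variant
    [pot_tail] shows that late generations only see the part of w above a given height.

    Consequently f_k(x, .) converges on almost every slice; the limit is f almost
    everywhere, because the integral of f_k(x, .) over a box tends to that of f(x, .)
    ([smoothed_limit_ae], [limit_repr_ae]).

    Embedding: comparing f with f_{n+1} for a fixed n depending on K gives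
    |f(x, y)| <= tau + Lam energy(x) on Omega1 x K ([slice_bound]). This is a majorant
    a(x) + b(y) with constant b, whence
    VC1_norm <= Lam (Sobolev energy) + tau |K| ([VC1_norm_le]). For the difference of two
    functions one chooses tau first and the Sobolev neighbourhood next.

    Virtual continuity: by Chebyshev's inequality the convergence f_k -> f is uniform in x,
    and locally uniform in y, off a set of x of small measure ([uniform_rate]). The
    functions x |-> f_k(x, q) for rational q, together with x |-> int |f(x, u)|^p du, form a
    countable family of measurable functions, which generates an admissible semimetric
    ([admissible_seq_dist]). Every f_k is continuous for this semimetric and the Euclidean
    topology in y, hence so is the limit ([weak_data_virtually_continuous]). *)

(** * Smooth functions of one real variable *)

Section smooth1.
Local Open Scope classical_set_scope.
Context {R : realType}.
Implicit Types (f g : R -> R).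

Definition derives f g := forall t : R, is_derive t (1 : R) f (g t).

(** Smoothness is expressed by the existence of a chain of derivatives: closure under
    the algebraic operations then follows by induction, without computing any
    higher derivative in closed form. *)
Fixpoint ndiff n f : Prop :=
  if n is m.+1 then exists2 g, derives f g & ndiff m g else True.

Definition smooth1 f := forall n, ndiff n f.

Lemma derivesE f g : derives f g -> f^`() = g.
Proof. by move=> fg; apply/funext => t; rewrite derive1E; apply: derive_val. Qed.

Lemma ndiffS n f : ndiff n.+1 f -> ndiff n f.
Proof.
elim: n f => // n IH f [g fg ng]; exists g => //; exact: IH.
Qed.

Lemma smooth1_derives f : smooth1 f -> derives f f^`() /\ smooth1 f^`().
Proof.
move=> sf; split; first by have [g fg _] := sf 1%N; rewrite (derivesE fg).
by move=> n; have [g fg ng] := sf n.+1; rewrite (derivesE fg).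
Qed.

Lemma smooth1_derive1n n f : smooth1 f -> smooth1 f^`(n).
Proof.
by elim: n => // n IH sf; rewrite derive1nS; case: (smooth1_derives (IH sf)).
Qed.

Lemma smooth1_derives1n n f : smooth1 f -> derives f^`(n) f^`(n.+1).
Proof.
by move=> sf; rewrite derive1nS; case: (smooth1_derives (smooth1_derive1n n sf)).
Qed.

Lemma derives_continuous f g : derives f g -> continuous f.
Proof.
move=> fg t; apply: differentiable_continuous; apply/derivable1_diffP.
exact: (@ex_derive _ _ _ _ _ _ _ (fg t)).
Qed.

Lemma smooth1_continuous f : smooth1 f -> continuous f.
Proof. by case/smooth1_derives => /derives_continuous. Qed.

Lemma ndiff_cst n (c : R) : ndiff n (fun=> c).
Proof.
elim: n c => // n IH c; exists (fun=> 0) => // t.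
exact: is_derive_cst.
Qed.

Lemma ndiff_id n : ndiff n (fun t : R => t).
Proof.
case: n => // n; exists (fun=> 1); last exact: ndiff_cst.
by move=> t; exact: is_derive_id.
Qed.

Lemma ndiffD n f g : ndiff n f -> ndiff n g -> ndiff n (fun t => f t + g t).
Proof.
elim: n f g => // n IH f g [f' ff' nf'] [g' gg' ng'].
exists (fun t => f' t + g' t); last exact: IH.
by move=> t; have := ff' t; have := gg' t; move=> ? ?; apply: is_deriveD.
Qed.

Lemma ndiffM n f g : ndiff n f -> ndiff n g -> ndiff n (fun t => f t * g t).
Proof.
elim: n f g => // n IH f g nf ng.
have [f' ff' nf'] := nf; have [g' gg' ng'] := ng.
exists (fun t => f t * g' t + g t * f' t).
  by move=> t; have := ff' t; have := gg' t; move=> ? ?; apply: is_deriveM.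
by apply: ndiffD; apply: IH => //; exact: ndiffS.
Qed.

Lemma derives_aff f g a b :
  derives f g -> derives (fun t => f (a * t + b)) (fun t => a * g (a * t + b)).
Proof.
move=> fg t; have := fg (a * t + b) => ?.
rewrite [a * g _]mulrC.
apply: (@is_derive1_comp _ f (fun t => a * t + b)).
have H := is_deriveD (is_deriveZ a (is_derive_id t 1)) (is_derive_cst b t 1).
have E : a *: 1 + 0 = a by rewrite /GRing.scale/= mulr1 addr0.
exact: (is_derive_eq H E).
Qed.

Lemma ndiff_aff n f a b : ndiff n f -> ndiff n (fun t => f (a * t + b)).
Proof.
elim: n f => // n IH f [g fg ng].
exists (fun t => a * g (a * t + b)); first exact: derives_aff.
by apply: ndiffM; [exact: ndiff_cst|exact: IH].
Qed.

Lemma derive1n_aff n f a b : smooth1 f ->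
  (fun t => f (a * t + b))^`(n) = (fun t => a ^+ n * f^`(n)%classic (a * t + b)).
Proof.
move=> sf; elim: n => [|n IH]; first by apply/funext => t; rewrite mul1r.
rewrite derive1nS IH; apply: derivesE => t.
have := derives_aff a b (smooth1_derives1n n sf) t => ?.
rewrite exprSr -mulrA.
exact: (is_derive_eq (is_deriveZ _ _ )).
Qed.

Lemma ndiffV n f : (forall t, f t != 0) -> ndiff n f ->
  ndiff n (fun t => (f t)^-1).
Proof.
move=> f0; elim: n => // n IH nf; have [g fg ng] := nf.
exists (fun t => -1 * ((f t)^-1 * (f t)^-1 * g t)).
  move=> t; have := fg t => ?.
  apply: (is_derive_eq (is_deriveV (f0 t) _)).
  by rewrite /GRing.scale/= mulN1r mulNr expr2 invfM.
have IH' := IH (ndiffS nf).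
apply: ndiffM; first exact: ndiff_cst.
by apply: ndiffM => //; exact: ndiffM.
Qed.

Lemma smooth1D f g : smooth1 f -> smooth1 g -> smooth1 (fun t => f t + g t).
Proof. by move=> sf sg n; exact: ndiffD. Qed.

Lemma smooth1M f g : smooth1 f -> smooth1 g -> smooth1 (fun t => f t * g t).
Proof. by move=> sf sg n; exact: ndiffM. Qed.

Lemma smooth1_cst c : smooth1 (fun=> c).
Proof. by move=> n; exact: ndiff_cst. Qed.

Lemma smooth1_aff f a b : smooth1 f -> smooth1 (fun t => f (a * t + b)).
Proof. by move=> sf n; exact: ndiff_aff. Qed.

Lemma smooth1B f g : smooth1 f -> smooth1 g -> smooth1 (fun t => f t - g t).
Proof.
move=> sf sg; rewrite (_ : (fun _ => _) = (fun t => f t + (fun=> -1) t * g t)).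
  by apply: smooth1D => //; apply: smooth1M => //; exact: smooth1_cst.
by apply/funext => t; rewrite mulN1r.
Qed.

Lemma derive1nB n f g : smooth1 f -> smooth1 g ->
  (fun t => f t - g t)^`(n) = (fun t => f^`(n)%classic t - g^`(n)%classic t).
Proof.
move=> sf sg; elim: n => [//|n IH].
rewrite derive1nS IH; apply: derivesE => t.
have := smooth1_derives1n n sf t; have := smooth1_derives1n n sg t => ? ?.
exact: is_deriveB.
Qed.

Lemma smooth1X k : smooth1 (fun t : R => t ^+ k).
Proof.
elim: k => [|k IH].
  by rewrite (_ : (fun _ => _) = fun=> 1)//; exact: smooth1_cst.
rewrite (_ : (fun _ => _) = (fun t => t * t ^+ k)); last first.
  by apply/funext => t; rewrite exprS.
by apply: smooth1M => // n; exact: ndiff_id.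
Qed.

Lemma near_eq_derive1n n f g (a : R) : (\forall x \near a, f x = g x) ->
  \forall x \near a, f^`(n) x = g^`(n) x.
Proof.
move=> fg; elim: n => // n IH; rewrite !derive1nS.
have := near_join IH; apply: filterS => t.
by rewrite !derive1E => /near_eq_derive; exact.
Qed.

(** The functions t^-n exp(-1/t), extended by 0 to t <= 0. The family is closed under
    differentiation up to linear combinations, which is why all of them are smooth
    at 0. *)
Definition flatexp n (t : R) := if t <= 0 then 0 else t^-1 ^+ n * expR (- t^-1).

Lemma is_derive_quad f (C : R) : f 0 = 0 -> (forall t, `|f t| <= C * t ^+ 2) ->
  is_derive (0 : R) (1 : R) f 0.
Proof.
move=> f0 fC.
have H : h^-1 *: ((f \o shift 0) (h *: (1 : R)) - f 0) @[h --> 0^'] --> (0 : R).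
  apply/cvgr0Pnorm_lt => e e0.
  have C1 : 0 < `|C| + 1 by rewrite ltr_wpDl.
  near=> h.
  have h0 : h != 0 by near: h; exact: nbhs_dnbhs_neq.
  rewrite /= /GRing.scale/= f0 subr0 addr0 mulr1 normrM normfV.
  rewrite mulrC ltr_pdivrMr ?normr_gt0//.
  apply: le_lt_trans (fC h) _.
  rewrite -real_normK ?num_real// expr2 mulrA ltr_pM2r ?normr_gt0//.
  apply: (@le_lt_trans _ _ ((`|C| + 1) * `|h|)).
    by rewrite ler_wpM2r// (le_trans (ler_norm _))// lerDl.
  rewrite mulrC -ltr_pdivlMr//.
  near: h; apply: dnbhs0_lt; exact: divr_gt0.
apply: DeriveDef; first by apply/cvg_ex; exists 0.
exact: cvg_lim H.
Unshelve. all: by end_near. Qed.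

Lemma exp_decay n (s : R) : 0 <= s -> s ^+ n * expR (- s) <= n`!%:R.
Proof.
move=> s0; rewrite expRN ler_pdivrMr ?expR_gt0//.
case: n => [|n].
  by rewrite expr0 fact0 mul1r -expR0 ler_expR.
rewrite -ler_pdivrMl ?ltr0n ?fact_gt0// mulrC.
by apply: le_trans (expR_ge1Dxn n s0); rewrite lerDr.
Qed.

Lemma derives_flatexp n :
  derives (flatexp n) (fun t => - n%:R * flatexp n.+1 t + flatexp n.+2 t).
Proof.
move=> t; have [t0|t0|->] := ltgtP t 0.
- apply: (@near_eq_is_derive _ _ _ (fun=> 0 : R)).
    near=> u; rewrite /flatexp ifT//; apply/ltW; near: u; exact: lt_nbhsl.
  by rewrite /flatexp (ltW t0) mulr0 add0r; exact: is_derive_cst.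
- apply: (@near_eq_is_derive _ _ _ (fun u : R => (u^-1 ^+ n * expR (- u^-1) : R))).
    near=> u; rewrite /flatexp leNgt ifF//; apply/negbTE/negPn; near: u.
    exact: lt_nbhsr.
  have tn0 : t != 0 by rewrite gt_eqF.
  have dV : is_derive t (1:R) (fun u : R => u^-1) (- t ^- 2).
    apply: is_derive_eq; first exact: (is_deriveV (f := id)).
    by rewrite /GRing.scale/= mulr1.
  have dX : is_derive t (1:R) (fun u : R => u^-1 ^+ n)
      (n%:R * t^-1 ^+ n.-1 * - t ^- 2).
    have H := is_deriveX n dV; rewrite exprfctE in H.
    exact: (is_derive_eq H).
  have dE : is_derive t (1:R) (fun u : R => expR (- u^-1))
      (expR (- t^-1) * t ^- 2).
    apply: (@is_derive1_comp _ expR (fun u : R => - u^-1)).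
    by apply: is_derive_eq; rewrite opprK.
  apply: (is_derive_eq (is_deriveM dX dE)).
  rewrite /flatexp leNgt t0/= /GRing.scale/=.
  rewrite -[t ^- 2]exprVn !exprS.
  case: n dX => [|n] _ /=; first by rewrite expr0; ring.
  by rewrite !exprS; ring.
- rewrite {2 3}/flatexp lexx mulr0 addr0.
  apply: (@is_derive_quad _ n.+2`!%:R); first by rewrite /flatexp lexx.
  move=> u; rewrite /flatexp; case: ifPn => u0.
    by rewrite normr0 mulr_ge0// sqr_ge0.
  rewrite -ltNge in u0.
  rewrite ger0_norm; last by rewrite mulr_ge0 ?expR_ge0// exprn_ge0// invr_ge0 ltW.
  rewrite -ler_pdivrMr ?exprn_gt0//.
  apply: le_trans (exp_decay n.+2 (s := u^-1) _); last by rewrite invr_ge0 ltW.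
  by rewrite !exprS expr0 !invfM invr1; rewrite le_eqVlt; apply/orP; left; apply/eqP; ring.
Unshelve. all: by end_near. Qed.

Lemma smooth1_flatexp n : smooth1 (flatexp n).
Proof.
move=> k; elim: k n => // k IH n.
eexists; first exact: derives_flatexp.
by apply: ndiffD => //; apply: ndiffM => //; exact: ndiff_cst.
Qed.

Lemma flatexp_ge0 t : 0 <= flatexp 0 t.
Proof. by rewrite /flatexp; case: ifP => // _; rewrite mul1r expR_ge0. Qed.

Lemma flatexp_gt0 t : 0 < t -> 0 < flatexp 0 t.
Proof. by move=> t0; rewrite /flatexp leNgt t0/= mul1r expR_gt0. Qed.

(** The standard smooth step, rising from 0 to 1 on the segment [1, 2]. *)
Definition step t :=
  flatexp 0 (t - 1) / (flatexp 0 (t - 1) + flatexp 0 (2 - t)).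

Let step_den t : 0 < flatexp 0 (t - 1) + flatexp 0 (2 - t).
Proof.
have [t1|t1] := ltP 1 t.
  by rewrite ltr_pwDl ?flatexp_ge0// flatexp_gt0// subr_gt0.
by rewrite ltr_wpDl ?flatexp_ge0// flatexp_gt0// subr_gt0; lra.
Qed.

Lemma smooth1_step : smooth1 step.
Proof.
have s1 : smooth1 (fun t => flatexp 0 (t - 1)).
  have := smooth1_aff 1 (-1) (@smooth1_flatexp 0).
  by under eq_fun do rewrite mul1r.
have s2 : smooth1 (fun t => flatexp 0 (2 - t)).
  have := smooth1_aff (-1) 2 (@smooth1_flatexp 0).
  by under eq_fun do rewrite mulN1r addrC.
apply: smooth1M => // n; apply: ndiffV; last exact: ndiffD.
by move=> t; rewrite gt_eqF.
Qed.

Lemma step0 t : t <= 1 -> step t = 0.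
Proof. by move=> t1; rewrite /step {1}/flatexp subr_le0 t1 mul0r. Qed.

Lemma step1 t : 2 <= t -> step t = 1.
Proof.
move=> t2; have := step_den t; rewrite /step.
have -> : flatexp 0 (2 - t) = 0 by rewrite /flatexp subr_le0 t2.
by rewrite addr0 => ?; rewrite divff// gt_eqF.
Qed.

Lemma step_ge0 t : 0 <= step t.
Proof. by rewrite divr_ge0 ?flatexp_ge0// ltW. Qed.

Lemma step_le1 t : step t <= 1.
Proof. by rewrite ler_pdivrMr// mul1r lerDl flatexp_ge0. Qed.

End smooth1.

(** * One-dimensional kernels *)

Section kernel1.
Context {R : realType}.
Local Open Scope classical_set_scope.
Implicit Types (f g : R -> R).

Lemma derive1nZ n c f : smooth1 f ->
  (fun t => c * f t)^`(n) = (fun t => c * f^`(n)%classic t).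
Proof.
move=> sf; elim: n => // n IH; rewrite derive1nS IH; apply: derivesE => t.
have := smooth1_derives1n n sf t => ?.
exact: is_deriveZ.
Qed.

Definition mono m (t : R) := t ^+ m / m`!%:R.

Lemma smooth1_mono m : smooth1 (mono m).
Proof. by apply: smooth1M; [exact: smooth1X|exact: smooth1_cst]. Qed.

Lemma derive1_mono m : (mono m.+1)^`() = mono m.
Proof.
apply: derivesE => t.
have H := is_deriveX m.+1 (is_derive_id t (1 : R)); rewrite exprfctE in H.
have H2 := is_deriveZ (m.+1`!%:R^-1) H.
rewrite (_ : mono m.+1 = (m.+1)`!%:R^-1 \*: (fun x : R => x ^+ m.+1)); last first.
  by apply/funext => u; rewrite /mono mulrC.
apply: (is_derive_eq H2); rewrite /GRing.scale/= /mono mulr1 factS natrM.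
by rewrite /= invfM mulrACA mulVf ?pnatr_eq0// mul1r mulrC.
Qed.

Lemma derive1n_mono j m : (mono (j + m))^`(j) = mono m.
Proof. by elim: j => // j IH; rewrite derive1Sn addSn derive1_mono. Qed.

Lemma derive1n_mono_gt m : (mono m)^`(m.+1) = fun=> 0.
Proof.
rewrite derive1nS -[in mono m](addn0 m) derive1n_mono; apply: derivesE => t.
rewrite (_ : mono 0 = fun=> 1); first exact: is_derive_cst.
by apply/funext => u; rewrite /mono expr0 fact0 divr1.
Qed.

Lemma derive1n_cst0 n : (fun _ : R => 0 : R)^`(n) = fun=> 0.
Proof.
by elim: n => // n IH; rewrite derive1nS IH; apply: derivesE => t; exact: is_derive_cst.
Qed.

Lemma bounded_off_segment f a b : a <= b -> continuous f ->
  (forall t, t < a -> f t = 0) -> (forall t, b < t -> f t = 0) ->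
  exists2 C, 0 <= C & forall t, `|f t| <= C.
Proof.
move=> ab cf fa fb.
have [] := @EVT_max R (fun t => `|f t|) a b ab.
  apply: continuous_subspaceT => t.
  by apply: continuous_comp; [exact: cf|exact: norm_continuous].
move=> c cab fc; exists `|f c|; first by [].
move=> t; have [ta|at_] := ltP t a; first by rewrite fa// normr0.
have [bt|tb] := ltP b t; first by rewrite fb// normr0.
by apply: fc; rewrite in_itv/= at_ tb.
Qed.

Lemma lipschitz_derives f g C : derives f g -> (forall t, `|g t| <= C) ->
  forall s t, `|f s - f t| <= C * `|s - t|.
Proof.
move=> fg gC; suff H : forall s t, t <= s -> `|f s - f t| <= C * `|s - t|.
  by move=> s t; have [/H//|/ltW/H] := leP t s; rewrite distrC (distrC s).
move=> s t ts; have [] := @MVT_segment R f g t s ts.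
- by move=> x _; exact: fg.
- by apply: continuous_subspaceT; exact: derives_continuous fg.
by move=> c _ ->; rewrite normrM ler_wpM2r.
Qed.

Variable l : nat.
Hypothesis l0 : (0 < l)%N.

(** The polynomial [mono l.-1] is killed by l derivatives, so cutting it off at scale
    2^-k leaves a derivative of order l that lives in the transition zone only. *)
Definition wker k (t : R) := mono l.-1 t * step (2 ^+ k * t).

Lemma smooth1_wker k : smooth1 (wker k).
Proof.
apply: smooth1M; first exact: smooth1_mono.
rewrite (_ : (fun _ => _) = fun t : R => step (2 ^+ k * t + 0)).
  exact: (smooth1_aff _ _ smooth1_step).
by apply/funext => t; rewrite addr0.
Qed.

Lemma wker_scale k j t :
  (wker k)^`(j) t = (2 ^+ k) ^+ j / (2 ^+ k) ^+ l.-1 * (wker 0)^`(j)%classic (2 ^+ k * t).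
Proof.
have -> : wker k = fun t => ((2 ^+ k) ^+ l.-1)^-1 * wker 0 (2 ^+ k * t + 0).
  apply/funext => u; rewrite /wker /mono addr0 expr0 mul1r exprMn.
  rewrite !mulrA mulVf ?mul1r// !expf_neq0//.
rewrite derive1nZ; last exact/smooth1_aff/smooth1_wker.
rewrite derive1n_aff; last exact: smooth1_wker.
by rewrite addr0 mulrA [_^-1 * _]mulrC.
Qed.

(** [eta k] is a mollifier of width 2^-k supported to the right of 0 and [prim k] is its
    primitive. The function [zeta k] has compact support, because far from 0 the two
    cut-offs agree and the polynomials cancel; its derivative of order l is
    [eta k - eta k.+1]. This is what allows l integrations by parts in the difference
    of two consecutive mollifications. *)
Definition eta k : R -> R := (wker k)^`(l).
Definition prim k : R -> R := (wker k)^`(l.-1).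
Definition zeta k (t : R) := wker k t - wker k.+1 t.

Let wker_near0 j t : t < 1 -> (wker 0)^`(j) t = 0.
Proof.
move=> t1; have /(near_eq_derive1n j) : \forall x \near t, wker 0 x = (fun=> 0) x.
  near=> x; rewrite /wker step0 ?mulr0// expr0 mul1r ltW//; near: x.
  exact: lt_nbhsl.
by move/nbhs_singleton; rewrite derive1n_cst0.
Unshelve. all: by end_near. Qed.

Let wker_near2 j t : 2 < t -> (wker 0)^`(j) t = (mono l.-1)^`(j) t.
Proof.
move=> t2; have /(near_eq_derive1n j) : \forall x \near t, wker 0 x = mono l.-1 x.
  near=> x; rewrite /wker step1 ?mulr1// expr0 mul1r ltW//; near: x.
  exact: lt_nbhsr.
by move/nbhs_singleton.
Unshelve. all: by end_near. Qed.

Lemma eta0_lt1 t : t < 1 -> eta 0 t = 0. Proof. exact: wker_near0. Qed.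

Lemma eta0_gt2 t : 2 < t -> eta 0 t = 0.
Proof.
by move=> t2; rewrite /eta wker_near2// -[in X in _^`(X)](prednK l0) derive1n_mono_gt.
Qed.

Lemma prim0_lt1 t : t < 1 -> prim 0 t = 0. Proof. exact: wker_near0. Qed.

Lemma prim0_gt2 t : 2 < t -> prim 0 t = 1.
Proof.
move=> t2; rewrite /prim wker_near2// -[X in mono X](addn0 l.-1) derive1n_mono.
by rewrite /mono expr0 fact0 divr1.
Qed.

Lemma smooth1_eta k : smooth1 (eta k).
Proof. exact/smooth1_derive1n/smooth1_wker. Qed.

Lemma derives_prim k : derives (prim k) (eta k).
Proof.
by rewrite /eta -(prednK l0); apply: smooth1_derives1n; exact: smooth1_wker.
Qed.

Lemma etaE k t : eta k t = 2 ^+ k * eta 0 (2 ^+ k * t).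
Proof.
rewrite /eta wker_scale; congr (_ * _).
by rewrite -[X in _ ^+ X / _](prednK l0) exprS mulfK// !expf_neq0.
Qed.

Lemma primE k t : prim k t = prim 0 (2 ^+ k * t).
Proof. by rewrite /prim wker_scale divff ?mul1r// !expf_neq0. Qed.

Lemma eta0_bounded : exists2 C, 0 <= C & forall t, `|eta 0 t| <= C.
Proof.
apply: (@bounded_off_segment _ 1 2); [lra| | |].
- exact/smooth1_continuous/smooth1_eta.
- exact: eta0_lt1.
- exact: eta0_gt2.
Qed.

Lemma eta0_lipschitz : exists2 C, 0 <= C & forall s t,
  `|eta 0 s - eta 0 t| <= C * `|s - t|.
Proof.
have E : derives (eta 0) ((wker 0)^`(l.+1)).
  by apply: smooth1_derives1n; exact: smooth1_wker.
have [||||C C0 EC] := @bounded_off_segment ((wker 0)^`(l.+1)) 1 2; first lra.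
- exact/smooth1_continuous/smooth1_derive1n/smooth1_wker.
- exact: wker_near0.
- move=> t t2; rewrite wker_near2// derive1nS.
  by rewrite -[in X in _^`(X)](prednK l0) derive1n_mono_gt -derive1n1 derive1n_cst0.
by exists C => //; exact: lipschitz_derives EC.
Qed.

(** [prim 0 - step] is continuous and vanishes off a segment. *)
Lemma prim_bounded : exists2 C, 0 <= C & forall k t, `|prim k t| <= C.
Proof.
(* The two functions agree off the segment from 1 to 2. *)
have [||||C C0 pC] := @bounded_off_segment (fun t => prim 0 t - step t) 1 2; first lra.
- apply: smooth1_continuous; apply: smooth1B; last exact: smooth1_step.
  exact/smooth1_derive1n/smooth1_wker.
- by move=> t t1; rewrite prim0_lt1// step0 ?subrr// ltW.
- by move=> t t2; rewrite prim0_gt2// step1 ?subrr// ltW.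
exists (C + 1); first by rewrite addr_ge0.
move=> k t; rewrite primE; set u := _ * t.
rewrite -(subrK (step u) (prim 0 u)) (le_trans (ler_normD _ _))// lerD//.
by rewrite ger0_norm ?step_le1// step_ge0.
Qed.

Lemma smooth1_zeta k : smooth1 (zeta k).
Proof. by apply: smooth1B; exact: smooth1_wker. Qed.

Lemma derive1n_zeta k : (zeta k)^`(l) = fun t => eta k t - eta k.+1 t.
Proof. by rewrite derive1nB//; exact: smooth1_wker. Qed.

Lemma zeta_lt k t : 2 ^+ k.+1 * t < 1 -> zeta k t = 0.
Proof.
move=> kt; rewrite /zeta /wker !step0 ?mulr0 ?subrr// ?(ltW kt)//.
have [t0|t0] := leP t 0; first by rewrite (le_trans _ ler01)// pmulr_rle0 ?exprn_gt0.
apply/ltW/(le_lt_trans _ kt); rewrite ler_wpM2r ?(ltW t0)//.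
by rewrite exprS ler_peMl ?exprn_ge0//; lra.
Qed.

Lemma zeta_gt k t : 2 < 2 ^+ k * t -> zeta k t = 0.
Proof.
move=> kt; rewrite /zeta /wker !step1 ?mulr1 ?subrr// ?(ltW kt)//.
apply/ltW/(lt_le_trans kt).
have t0 : 0 < t by rewrite -(@pmulr_rgt0 _ (2 ^+ k)) ?exprn_gt0//; lra.
rewrite ler_wpM2r ?(ltW t0)//.
by rewrite exprS ler_peMl ?exprn_ge0//; lra.
Qed.

(** On the support t is at most 2 / 2^k, and the two cut-offs differ by at most 1. *)
Lemma zeta_bound k t : `|zeta k t| <= (2 / 2 ^+ k) ^+ l.-1.
Proof.
have p2 n : 0 < (2 : R) ^+ n by rewrite exprn_gt0.
have b0 : 0 <= (2 / 2 ^+ k : R) ^+ l.-1 by rewrite exprn_ge0// divr_ge0// ltW.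
have [kt|kt] := ltP 2 (2 ^+ k * t); first by rewrite zeta_gt// normr0.
have [kt'|kt'] := ltP (2 ^+ k.+1 * t) 1; first by rewrite zeta_lt// normr0.
have t0 : 0 < t by rewrite -(@pmulr_rgt0 _ (2 ^+ k.+1)) ?p2//; lra.
rewrite /zeta /wker -mulrBr normrM -[leRHS]mulr1 ler_pM//.
  rewrite /mono ger0_norm ?divr_ge0 ?exprn_ge0 ?(ltW t0)//.
  rewrite ler_pdivrMr ?ltr0n ?fact_gt0//.
  apply: (@le_trans _ _ ((2 / 2 ^+ k) ^+ l.-1)).
    by rewrite lerXn2r ?nnegrE ?divr_ge0 ?(ltW t0) ?(ltW (p2 _))// ler_pdivlMr// mulrC.
  by rewrite ler_peMr// ler1n fact_gt0.
have := step_ge0 (2 ^+ k * t); have := step_ge0 (2 ^+ k.+1 * t).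
have := step_le1 (2 ^+ k * t); have := step_le1 (2 ^+ k.+1 * t).
by move=> *; rewrite ler_norml; apply/andP; split; lra.
Qed.

Lemma integral_eta k a b s : a <= b ->
  (\int[lebesgue_measure]_(x in `[a, b]) (eta k (x - s))%:E =
    (prim k (b - s) - prim k (a - s))%:E)%E.
Proof.
rewrite le_eqVlt => /orP[/eqP ->|ab].
  by rewrite set_itv1 integral_set1 subrr.
have dp : derives (fun x => prim k (x - s)) (fun x => eta k (x - s)).
  by have := derives_aff 1 (- s) (derives_prim k) => H x; have := H x; rewrite !mul1r;
    under eq_fun do rewrite mul1r.
have ce : continuous (fun x => eta k (x - s)).
  have := smooth1_aff 1 (- s) (smooth1_eta k).
  by under eq_fun do rewrite mul1r; exact: smooth1_continuous.
rewrite EFinB; apply: (continuous_FTC2 (F := fun x => prim k (x - s))) => //.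
- exact: continuous_subspaceT.
- have cp : continuous (fun x => prim k (x - s)) := derives_continuous dp.
  split.
  + by move=> x _; exact: (@ex_derive _ _ _ _ _ _ _ (dp x)).
  + exact/cvg_at_right_filter/cp.
  + exact/cvg_at_left_filter/cp.
- by move=> x _; rewrite (derivesE dp).
Qed.

End kernel1.

(** * Boxes in coordinates and the du Bois-Reymond lemma *)

Section coordinate_boxes.
Local Open Scope classical_set_scope.
Context {R : realType} d (T : measurableType d) (I : finType).
Variable c : I -> T -> R.
Implicit Types (a b : I -> R) (U D : set T).

Definition box a b : set T := [set z | forall i, a i <= c i z < b i].

(** The box keeps a margin e inside U, the space needed to smooth its indicator without
    leaving U. *)
Definition fat_in U a b (e : R) :=
  forall z, (forall i, a i - e <= c i z <= b i + e) -> U z.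

(** Openness read off from the coordinates, so that a product space and its factors can
    be treated alike. *)
Definition coord_open U := forall z, U z ->
  exists2 e : R, 0 < e & forall z', (forall i, `|c i z' - c i z| <= e) -> U z'.

Lemma boxI a b a' b' : box a b `&` box a' b' =
  box (fun i => Num.max (a i) (a' i)) (fun i => Num.min (b i) (b' i)).
Proof.
apply/seteqP; split => z /=.
  move=> [H H'] i; have /andP[? ?] := H i; have /andP[? ?] := H' i.
  by rewrite ge_max lt_min; apply/andP; split; apply/andP.
by move=> H; split => i; have := H i; rewrite ge_max lt_min => /andP[/andP[h1 h2]/andP[h3 h4]];
  rewrite ?h1 ?h2 ?h3 ?h4.
Qed.

Hypothesis c_meas : forall i, measurable_fun [set: T] (c i).

Lemma measurable_box a b : measurable (box a b).
Proof.
rewrite (_ : box a b = \bigcap_(i in [set: I]) (c i @^-1` `[a i, b i[)).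
  apply: fin_bigcap_measurable => [|i _]; first exact: finite_finset.
  by rewrite -[X in measurable X]setTI; apply: c_meas.
apply/seteqP; split => z /=; first by move=> H i _ /=; rewrite in_itv/=; exact: H.
by move=> H i; have := H i Logic.I; rewrite /= in_itv.
Qed.

Definition dyad n (m : {ffun I -> int}) : set T :=
  box (fun i => (m i)%:~R / 2 ^+ n) (fun i => ((m i)%:~R + 1) / 2 ^+ n).

Definition fat_dyad U n (m : {ffun I -> int}) :=
  fat_in U (fun i => (m i)%:~R / 2 ^+ n) (fun i => ((m i)%:~R + 1) / 2 ^+ n)
    (2 ^- n).

Lemma exp2_small (e : R) : 0 < e -> exists n, 2 ^- n <= e.
Proof.
move=> e0; exists (Num.trunc e^-1).+1.
rewrite -[leRHS]invrK lef_pV2 ?posrE ?invr_gt0 ?exprn_gt0//.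
apply: (@le_trans _ _ (Num.trunc e^-1).+1%:R); first by rewrite ltW// truncnS_gt.
by rewrite -natrX ler_nat ltnW// ltn_expl.
Qed.

(** If the side is at most half of the available radius, the dyadic box around z and its
    enlargement by one side stay in U. *)
Lemma dyad_cover U z : coord_open U -> U z -> exists n m, dyad n m z /\ fat_dyad U n m.
Proof.
move=> oU Uz; have [e e0 He] := oU z Uz.
have [n ne] := exp2_small (divr_gt0 e0 (ltr0n R 2)).
have p2 : 0 < (2 : R) ^+ n by rewrite exprn_gt0.
pose m := [ffun i => Num.floor (2 ^+ n * c i z)]; exists n, m.
have mz i : (m i)%:~R / 2 ^+ n <= c i z < ((m i)%:~R + 1) / 2 ^+ n.
  rewrite ler_pdivrMr// ltr_pdivlMr// ffunE [c i z * _]mulrC.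
  by have := floor_itv (2 ^+ n * c i z); rewrite intrD.
split; first exact: mz.
move=> z' z'm; apply: He => i; have /andP[m1 m2] := mz i; have /andP[] := z'm i.
move=> m3 m4.
have E : ((m i)%:~R + 1) / 2 ^+ n = (m i)%:~R / 2 ^+ n + 2 ^- n :> R.
  by rewrite mulrDl mul1r.
rewrite E in m2 m4.
rewrite ler_norml; apply/andP; split; lra.
Qed.

Lemma countable_dyads (P : nat -> {ffun I -> int} -> Prop) (Q : set T) :
  (forall z, Q z -> exists n m, dyad n m z /\ P n m) ->
  exists F : nat -> option (nat * {ffun I -> int}),
    (forall j n m, F j = Some (n, m) -> P n m) /\
    forall z, Q z -> exists j n m, F j = Some (n, m) /\ dyad n m z.
Proof.
move=> H; exists (fun j => if @unpickle (nat * {ffun I -> int})%type j is Some nm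
  then if `[< P nm.1 nm.2 >] then Some nm else None else None); split.
  move=> j n m; case: unpickle => // -[n' m'] /=.
  by case: asboolP => // Pnm [<- <-].
move=> z Qz; have [n [m [zm Pnm]]] := H z Qz.
by exists (pickle (n, m)), n, m; rewrite pickleK/= asboolT.
Qed.

Lemma coord_open_measurable U : coord_open U -> measurable U.
Proof.
move=> oU; have [F [FP Fcov]] := countable_dyads (fun z => @dyad_cover U z oU).
rewrite (_ : U = \bigcup_j (if F j is Some nm then dyad nm.1 nm.2 else set0)).
  apply: bigcupT_measurable => j; case: (F j) => [nm|]; last exact: measurable0.
  exact: measurable_box.
apply/seteqP; split => z.
  by move=> /Fcov[j [n [m [Fj zm]]]]; exists j => //; rewrite Fj.
move=> [j _]; case Fj: (F j) => [[n m]|//] zm; apply: (FP j n m Fj) => i.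
have p2 : 0 <= (2 : R) ^- n by rewrite invr_ge0 exprn_ge0.
by have /andP[? ?] := zm i; apply/andP; split; lra.
Qed.

Hypothesis c_gen : forall A : set T, measurable A ->
  <<s [set c p.1 @^-1` p.2 | p in [set p : I * set (measurableTypeR R) | measurable p.2]] >> A.

Definition boxes : set (set T) := [set box p.1 p.2 | p in [set: (I -> R) * (I -> R)]].

Lemma boxes_setI : setI_closed boxes.
Proof.
move=> _ _ [[a b] _ <-] [[a' b'] _ <-]; rewrite /= boxI.
by exists (fun i => Num.max (a i) (a' i), fun i => Num.min (b i) (b' i)).
Qed.

Lemma boxes_gen : @measurable _ T = <<s boxes >>.
Proof.
apply/seteqP; split; last first.
  move=> A; apply; split; first exact: sigma_algebra_measurable.
  by move=> _ [[a b] _ <-]; exact: measurable_box.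
move=> A /c_gen; apply: smallest_sub; first exact: smallest_sigma_algebra.
move=> _ [[i B] /= mB <-].
pose T' := g_sigma_algebraType boxes.
have : measurable_fun [set: T'] (c i : T' -> measurableTypeR R).
  apply: (@measurability _ _ T' (measurableTypeR R) setT (c i) (@RGenCInfty.G R)).
    exact: RGenCInfty.measurableE.
  move=> _ [_ [x ->] <-]; rewrite setTI.
  rewrite (_ : _ @^-1` _ = \bigcup_N box
    (fun j => if j == i then x else - N%:R) (fun=> N%:R)).
    apply: bigcupT_measurable => N; apply: sub_sigma_algebra.
    exact: (ex_intro2 _ _ (fun j => if j == i then x else - N%:R,
                           fun=> N%:R) Logic.I erefl).
  apply/seteqP; split => z /=.
    rewrite in_itv/= andbT => xz.
    pose M := \sum_j `|c j z|; exists (Num.trunc M).+1 => // j.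
    have jM : `|c j z| < (Num.trunc M).+1%:R.
      apply: le_lt_trans (truncnS_gt M).
      by rewrite /M (bigD1 j)//= lerDl sumr_ge0.
    move: jM; rewrite ltr_norml => /andP[/ltW j1 ->]; rewrite andbT.
    by case: eqP => [->|].
  by move=> [N _ /(_ i)]; rewrite eqxx in_itv/= => /andP[->].
move=> /(_ measurableT B mB); rewrite setTI; exact.
Qed.

Variable mu : {measure set T -> \bar R}.

(** Boxes are stable under intersection and generate the sigma-algebra, so Dynkin's
    lemma passes from boxes to all measurable sets. *)
Lemma box_determines (D : set T) (h : T -> R) : measurable D ->
  mu.-integrable D (EFin \o h) -> (\int[mu]_(z in D) (h z)%:E = 0)%E ->
  (forall a b, (\int[mu]_(z in box a b `&` D) (h z)%:E = 0)%E) ->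
  {ae mu, forall z, D z -> h z = 0}.
Proof.
move=> mD ih hD hB.
have H S : measurable S -> (\int[mu]_(z in S `&` D) (h z)%:E = 0)%E.
  move=> mS; have : <<s boxes >> S by rewrite -boxes_gen.
  apply: (@dynkin_induction _ T boxes
    (fun S => (\int[mu]_(z in S `&` D) (h z)%:E = 0)%E) boxes_gen boxes_setI).
  - by rewrite setTI.
  - by move=> _ [[a b] _ <-]; exact: hB.
  - move=> {mS} {}S mS S0.
    have : (\int[mu]_(z in (S `&` D) `|` (~` S `&` D)) (h z)%:E = 0)%E.
      by rewrite -setIUl setUv setTI.
    rewrite integral_setU//.
    + by rewrite [X in (X + _)%E]S0 add0e.
    + exact: measurableI.
    + by apply: measurableI => //; exact: measurableC.
    + rewrite -setIUl setUv setTI; exact: measurable_int ih.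
    + by rewrite disj_set2E; apply/eqP; rewrite setIACA setICr set0I.
  - move=> F mF tF F0; rewrite setI_bigcupl integral_bigcup.
    + by rewrite eseries0// => i _ _; exact: F0.
    + exact: trivIset_setIr.
    + by move=> k; exact: measurableI.
    + apply: (integrableS mD) => //.
        by apply: bigcupT_measurable => k; exact: measurableI.
      by apply: bigcup_sub => k _; exact: subIsetr.
have : ae_eq mu D (EFin \o h) (cst 0%E).
  apply: (integral_ae_eq mD ih) => // E ED mE.
  rewrite [RHS]integral0_eq// -[RHS](H E mE).
  by rewrite setIidl.
by apply: filterS => z Hz /Hz [].
Qed.

(** The du Bois-Reymond lemma, in the form used on the x-space, on the y-space and on
    their product. Countably many dyadic boxes with a margin cover U, and the boxes
    inside one of them inherit its margin, so that [box_determines] applies there. *)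
Lemma box_null_ae U (h : T -> R) : coord_open U ->
  (forall a b e, 0 < e -> (forall i, a i < b i) -> fat_in U a b e ->
     mu.-integrable (box a b) (EFin \o h) /\
     (\int[mu]_(z in box a b) (h z)%:E = 0)%E) ->
  {ae mu, forall z, U z -> h z = 0}.
Proof.
move=> oU H.
have [F [FP Fcov]] := countable_dyads (fun z => @dyad_cover U z oU).
have : {ae mu, forall z, forall j, (if F j is Some nm then dyad nm.1 nm.2 else set0) z -> h z = 0}.
  apply: ae_foralln => j; case Fj: (F j) => [[n m]|]; last by apply: aeW => z.
  have fnm := FP j n m Fj; move: fnm; rewrite /fat_dyad.
  have p2 : 0 < (2 : R) ^- n by rewrite invr_gt0 exprn_gt0.
  rewrite /dyad /=; set a := fun i : I => _; set b := fun i : I => _ => fab.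
  have ab i : a i < b i by rewrite /a /b mulrDl mul1r ltrDl.
  have [ih h0] := H a b _ p2 ab fab.
  apply: box_determines => //; first exact: measurable_box.
  move=> a' b'; rewrite boxI.
  have [ab'|/existsNP[i /negP]] := pselect (forall i, Num.max (a' i) (a i) < Num.min (b' i) (b i)).
    (* The intersection of two boxes has the margin of either of them. *)
    apply: (proj2 (H _ _ _ p2 ab' _)) => z Hz; apply: fab => i.
    have := Hz i; have : a i <= Num.max (a' i) (a i) by rewrite le_max lexx orbT.
    have : Num.min (b' i) (b i) <= b i by rewrite ge_min lexx orbT.
    move=> ? ? /andP[? ?]; apply/andP; split; lra.
  rewrite -leNgt => abi; rewrite (_ : box _ _ = set0) ?integral_set0//.
  apply/seteqP; split => // z /(_ i) /andP[] /le_lt_trans /[apply].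
  by rewrite ltNge abi.
apply: filterS => z Hz /Fcov[j [n [m [Fj zm]]]]; apply: (Hz j).
by rewrite Fj.
Qed.

End coordinate_boxes.

(** * Integrals up to null sets, and coordinates of Euclidean spaces *)

Section integral_ae.
Local Open Scope classical_set_scope.
Local Open Scope ereal_scope.
Context {R : realType} d (T : measurableType d).
Import HBNNSimple.
Variable mu : {measure set T -> \bar R}.

(** The integral is a supremum over measurable simple functions below the integrand.
    Multiplying such a function by the indicator of the complement of a null set keeps
    its integral and forgets the values on the null set; hence integrals of functions
    that are measurable only for the completed sigma-algebra can be handled through
    measurable representatives. *)
Lemma ge0_integral_ae_le (f g : T -> \bar R) :
  (forall x, 0 <= f x) -> (forall x, 0 <= g x) ->
  {ae mu, forall x, f x <= g x} ->
  \int[mu]_x f x <= \int[mu]_x g x.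
Proof.
move=> f0 g0 [N [mN N0 fgN]].
rewrite !ge0_integralTE//; apply: ge_ereal_sup => _ [h hf <-].
have mNC : measurable (~` N) by exact: measurableC.
pose h' := mul_nnsfun h (indic_nnsfun R mNC).
apply: (@le_trans _ _ (sintegral mu h')).
  rewrite -!integralT_nnsfun; apply: ae_ge0_le_integral => //.
  - by move=> x _; rewrite lee_fin fun_ge0.
  - exact/measurable_EFinP.
  - by move=> x _; rewrite lee_fin fun_ge0.
  - exact/measurable_EFinP.
  - exists N; split => // x /= Hx; apply: contrapT => Nx; apply: Hx => _.
    by rewrite /= mindicE mem_set ?mulr1.
apply: ereal_sup_ubound; exists h' => // x /=.
rewrite mindicE; have [Nx|Nx] := pselect (N x).
  by rewrite memNset ?mulr0//; exact.
rewrite mem_set ?mulr1//; apply: (le_trans (hf x)).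
by apply: contrapT => H; apply: Nx; exact: fgN.
Qed.

Lemma ge0_ae_eq_integralT (f g : T -> \bar R) :
  (forall x, 0 <= f x) -> (forall x, 0 <= g x) ->
  {ae mu, forall x, f x = g x} ->
  \int[mu]_x f x = \int[mu]_x g x.
Proof.
move=> f0 g0 fg; apply/eqP; rewrite eq_le; apply/andP; split;
  by apply: ge0_integral_ae_le => //; apply: filterS fg => x ->.
Qed.

Lemma integral_ae_congr (D : set T) (f g : T -> \bar R) :
  {ae mu, forall x, D x -> f x = g x} ->
  \int[mu]_(x in D) f x = \int[mu]_(x in D) g x.
Proof.
move=> fg; rewrite integral_mkcond [RHS]integral_mkcond integralE [RHS]integralE.
have H : {ae mu, forall x, (f \_ D) x = (g \_ D) x}.
  by apply: filterS fg => x H; rewrite !patchE; case: ifPn => // /set_mem/H.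
by congr (_ - _); apply: ge0_ae_eq_integralT => //; apply: filterS H => x Hx;
  rewrite ?funeposE ?funenegE Hx.
Qed.

End integral_ae.

Section coordinates.
Local Open Scope classical_set_scope.
Context {R : realType}.

Definition rV_coord n (i : 'I_n) (x : 'rV[R]_n) : R := x ord0 i.

Lemma rV_coord_meas n i : measurable_fun [set: 'rV[R]_n] (@rV_coord n i).
Proof. exact: measurable_coord. Qed.

Lemma rV_coord_gen n (A : set 'rV[R]_n) : measurable A ->
  <<s [set rV_coord p.1 @^-1` p.2 |
    p in [set p : 'I_n * set (measurableTypeR R) | measurable p.2]] >> A.
Proof.
apply: smallest_sub; first exact: smallest_sigma_algebra.
rewrite -bigcup_seq/=; apply: bigcup_sub => i _ _ [B mB <-]; rewrite setTI.
by apply: sub_sigma_algebra; exists (i, B).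
Qed.

Lemma rV_coord_open n (U : set 'rV[R]_n) : open U -> coord_open (@rV_coord n) U.
Proof.
move=> oU z Uz; have /nbhs_ballP[e/= e0 He] := open_nbhs_nbhs (conj oU Uz).
exists (e / 2); first by rewrite divr_gt0.
move=> z' zz'; apply: He; split => // i j; rewrite !ord1 /ball/= distrC.
by apply: le_lt_trans (zz' j) _; rewrite ltr_pdivrMr// ltr_pMr// ltr1n.
Qed.

Variables d1 d2 : nat.
Local Notation E := ('rV[R]_d1 * 'rV[R]_d2)%type.
Local Notation coord := ('I_d1 + 'I_d2)%type.

Definition E_coord (c : coord) (z : E) : R :=
  match c with inl i => rV_coord i z.1 | inr j => rV_coord j z.2 end.

Lemma E_coord_meas c : measurable_fun [set: E] (E_coord c).
Proof.
case: c => i; first exact: (measurableT_comp (rV_coord_meas i) measurable_fst).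
exact: (measurableT_comp (rV_coord_meas i) measurable_snd).
Qed.

Lemma E_coord_gen (A : set E) : measurable A ->
  <<s [set E_coord p.1 @^-1` p.2 |
    p in [set p : coord * set (measurableTypeR R) | measurable p.2]] >> A.
Proof.
set G := [set _ | _ in _].
pose T' := g_sigma_algebraType G.
have m1 : measurable_fun [set: T'] (fst : T' -> 'rV[R]_d1).
  apply: measurable_fun_rVP => i _ B mB; rewrite setTI.
  by apply: sub_sigma_algebra; exists (inl i, B).
have m2 : measurable_fun [set: T'] (snd : T' -> 'rV[R]_d2).
  apply: measurable_fun_rVP => i _ B mB; rewrite setTI.
  by apply: sub_sigma_algebra; exists (inr i, B).
apply: smallest_sub; first exact: smallest_sigma_algebra.
move=> _ [[B mB <-]|[B mB <-]].
  exact: (m1 measurableT B mB).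
exact: (m2 measurableT B mB).
Qed.

Lemma E_coord_open (U : set E) : open U -> coord_open E_coord U.
Proof.
move=> oU z Uz; have /nbhs_ballP[e/= e0 He] := open_nbhs_nbhs (conj oU Uz).
exists (e / 2); first by rewrite divr_gt0.
have e2 : e / 2 < e by rewrite ltr_pdivrMr// ltr_pMr// ltr1n.
move=> z' zz'; apply: He; split; split => // i j; rewrite !ord1 /ball/= distrC.
  exact: le_lt_trans (zz' (inl j)) _.
exact: le_lt_trans (zz' (inr j)) _.
Qed.

Lemma open_measurable_rV n (U : set 'rV[R]_n) : open U -> measurable U.
Proof.
move=> /rV_coord_open oU.
exact: (coord_open_measurable (@rV_coord_meas n) oU).
Qed.

Lemma closed_measurable_rV n (U : set 'rV[R]_n) : closed U -> measurable U.
Proof. by move=> /closed_openC/open_measurable_rV/measurableC; rewrite setCK. Qed.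

Lemma open_measurable_E (U : set E) : open U -> measurable U.
Proof.
move=> /E_coord_open oU.
exact: (coord_open_measurable E_coord_meas oU).
Qed.

Lemma closed_measurable_E (U : set E) : closed U -> measurable U.
Proof. by move=> /closed_openC/open_measurable_E/measurableC; rewrite setCK. Qed.

Definition cbox (a b : coord -> R) : set E :=
  [set z | forall c, a c <= E_coord c z <= b c].

Lemma compact_cbox a b : compact (cbox a b).
Proof.
rewrite (_ : cbox a b =
  [set v : 'rV[R]_d1 | forall i, `[a (inl i), b (inl i)] (v ord0 i)] `*`
  [set v : 'rV[R]_d2 | forall i, `[a (inr i), b (inr i)] (v ord0 i)]).
  apply: compact_setX.
    apply: (@rV_compact _ _ (fun i => `[a (inl i), b (inl i)])) => i.
    exact: segment_compact.
  apply: (@rV_compact _ _ (fun i => `[a (inr i), b (inr i)])) => i.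
  exact: segment_compact.
apply/seteqP; split => z.
  by move=> H; split => i /=; rewrite in_itv/=; [exact: (H (inl i))|exact: (H (inr i))].
move=> [H1 H2] [i|i]; first by have := H1 i; rewrite /= in_itv.
by have := H2 i; rewrite /= in_itv.
Qed.

Lemma closed_cbox a b : closed (cbox a b).
Proof. exact: (compact_closed (@norm_hausdorff _ [the normedModType R of E]) (@compact_cbox a b)). Qed.

End coordinates.

(** * Tensor products as test functions *)

Section tensors.
Local Open Scope classical_set_scope.
Context {R : realType} {d1 d2 : nat}.
Local Notation E := ('rV[R]_d1 * 'rV[R]_d2)%type.
Local Notation coord := ('I_d1 + 'I_d2)%type.
Implicit Types (g : coord -> R -> R).

Definition tens g (z : E) : R := \prod_c g c (E_coord c z).

(** Reduces a directional derivative on the product space to one real variable. *)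
Lemma is_derive_dir (f : E -> R) (z v : E) (l : R) :
  is_derive (0 : R) (1 : R) (fun h : R => f (h *: v + z)) l -> is_derive z v f l.
Proof.
move=> [df dl].
have E0 : (fun h : R => h^-1 *: ((f \o shift z) (h *: v) - f z)) =
    (fun h : R => h^-1 *: (((fun h : R => f (h *: v + z)) \o shift 0) (h *: 1) -
      (fun h : R => f (h *: v + z)) 0)).
  by apply/funext => h /=; rewrite addr0 scale0r add0r /GRing.scale/= mulr1.
apply: DeriveDef; first by apply/derivable1P.
by rewrite /derive E0; exact: dl.
Qed.

Lemma E_coord_shift c c' (h : R) (z : E) :
  E_coord c' (h *: basis_vec c + z) = (c' == c)%:R * h + E_coord c' z.
Proof.
case: c => i; case: c' => j; rewrite /= /rV_coord !mxE /=.
- by rewrite mulrC.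
- by rewrite mul0r mulr0.
- by rewrite mul0r mulr0.
- by rewrite mulrC.
Qed.

Lemma is_derive_tens g c (z : E) : (forall c, smooth1 (g c)) ->
  is_derive z (basis_vec c) (tens g)
    (tens (fun c' => if c' == c then (g c)^`()%classic else g c') z).
Proof.
move=> sg; apply: is_derive_dir.
pose K := \prod_(c' | c' != c) g c' (E_coord c' z).
have -> : (fun h : R => tens g (h *: basis_vec c + z)) =
    (fun h => K * g c (1 * h + E_coord c z)).
  apply/funext => h; rewrite /tens (bigD1 c)//= E_coord_shift eqxx mulrC.
  congr (_ * _); apply: eq_bigr => c' c'c.
  by rewrite E_coord_shift (negbTE c'c) mul0r add0r.
have [dg _] := smooth1_derives (sg c).
have H := is_deriveZ K (derives_aff 1 (E_coord c z) dg 0).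
apply: (is_derive_eq H).
rewrite /GRing.scale/= /tens [RHS](bigD1 c)//= eqxx mul1r mulr0 add0r mulrC.
by congr (_ * _); apply: eq_bigr => c' /negbTE ->.
Qed.

Lemma partials_tens g s : (forall c, smooth1 (g c)) ->
  partials s (tens g) = tens (fun c => (g c)^`(count_mem c s)%classic).
Proof.
move=> sg; elim: s => [//|c s IH].
rewrite /= -/(partials s _) IH; apply/funext => z.
have sg' c' : smooth1 ((g c')^`(count_mem c' s)%classic) by exact: smooth1_derive1n.
rewrite (@derive_val _ _ _ _ _ _ _ (is_derive_tens c z sg')).
apply: eq_bigr => c' _; rewrite eq_sym; case: eqVneq => [->|_ /=].
  by rewrite add1n derive1nS.
by rewrite add0n.
Qed.

Lemma continuous_tens g : (forall c, smooth1 (g c)) -> continuous (tens g).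
Proof.
move=> sg; rewrite /tens; have : forall s : seq coord,
    continuous (fun z : E => \prod_(c <- s) g c (E_coord c z)).
  elim=> [|c s IH].
    rewrite (_ : (fun _ => _) = fun=> 1); first by move=> z; exact: cvg_cst.
    by apply/funext => z; rewrite big_nil.
  rewrite (_ : (fun _ => _) = fun z =>
      g c (E_coord c z) * \prod_(c <- s) g c (E_coord c z)); last first.
    by apply/funext => z; rewrite big_cons.
  move=> z; apply: continuousM; last exact: IH.
  apply: (@continuous_comp _ _ _ (E_coord c) (g c)); last exact: smooth1_continuous.
  case: c => i.
    by apply: (@continuous_comp _ _ _ fst); [exact: cvg_fst|exact: coord_continuous].
  by apply: (@continuous_comp _ _ _ snd); [exact: cvg_snd|exact: coord_continuous].
by move=> H; have := H (index_enum _).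
Qed.

Lemma smooth_tens g : (forall c, smooth1 (g c)) -> smooth (tens g).
Proof.
move=> sg s; rewrite partials_tens//.
have sg' c' : smooth1 ((g c')^`(count_mem c' s)%classic) by exact: smooth1_derive1n.
split; first exact: continuous_tens.
by move=> z i; exact: (@ex_derive _ _ _ _ _ _ _ (is_derive_tens i z sg')).
Qed.

(** Partial derivatives act factor by factor, so that only the multiplicity of each
    coordinate counts, not the order of differentiation. *)
Lemma multi_partial_tens g alpha : (forall c, smooth1 (g c)) ->
  multi_partial alpha (tens g) = tens (fun c => (g c)^`(alpha c)%classic).
Proof.
move=> sg; rewrite /multi_partial partials_tens//; congr tens.
apply/funext => c; congr (_ ^`(_))%classic.
rewrite count_flatten -map_comp sumnE big_map big_enum/= (bigD1 c)//=.
rewrite count_nseq/= eqxx mul1n big1 ?addn0// => j jc.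
by rewrite count_nseq/= (negbTE jc).
Qed.

Lemma tens_supp g a b z : (forall c t, ~~ (a c <= t <= b c) -> g c t = 0) ->
  ~ cbox a b z -> tens g z = 0.
Proof.
move=> g0 /existsNP[c /negP zc].
by rewrite /tens (bigD1 c)//= g0// mul0r.
Qed.

(** Products of one-variable functions are the only test functions that the proof uses. *)
Lemma test_function_tens (Omega : set E) g a b : (forall c, smooth1 (g c)) ->
  (forall c t, ~~ (a c <= t <= b c) -> g c t = 0) ->
  cbox a b `<=` Omega -> test_function Omega (tens g).
Proof.
move=> sg g0 abO.
have H : closure [set z | tens g z != 0] `<=` cbox a b.
  rewrite [X in _ `<=` X](closure_id (cbox a b)).1; last exact: closed_cbox.
  apply: closure_subset => z /= z0; apply: contrapT => zab.
  by move: z0; rewrite (tens_supp g0 zab) eqxx.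
split; first exact: smooth_tens.
- exact: (subclosed_compact (@closed_closure _ _) (@compact_cbox _ _ _ a b) H).
- exact: subset_trans H abO.
Qed.

Definition single (c : coord) (l : nat) : coord -> nat :=
  fun c' => if c' == c then l else 0%N.

Lemma multi_order_single c l : multi_order (single c l) = l.
Proof.
rewrite /multi_order (bigD1 c)//= /single eqxx big1 ?addn0// => i ic.
by rewrite (negbTE ic).
Qed.

End tensors.

(** * Integrals of tensor products *)

Section tensor_integral.
Local Open Scope classical_set_scope.
Context {R : realType}.

Lemma integral_tensor2 d1 d2 (T1 : measurableType d1) (T2 : measurableType d2)
    (m1 : {sigma_finite_measure set T1 -> \bar R})
    (m2 : {sigma_finite_measure set T2 -> \bar R}) (u : T1 -> R) (v : T2 -> R) :
  m1.-integrable [set: T1] (EFin \o u) -> m2.-integrable [set: T2] (EFin \o v) ->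
  (m1 \x m2)%E.-integrable [set: T1 * T2] (fun z => (u z.1 * v z.2)%:E) /\
  (\int[m1 \x m2]_z (u z.1 * v z.2)%:E =
    (\int[m1]_x (u x) * \int[m2]_y (v y))%R%:E)%E.
Proof.
move=> iu iv.
have mu_ : measurable_fun setT u by apply/measurable_EFinP; exact: measurable_int iu.
have mv : measurable_fun setT v by apply/measurable_EFinP; exact: measurable_int iv.
have muv : measurable_fun [set: T1 * T2] (fun z => (u z.1 * v z.2)%:E).
  apply/measurable_EFinP; apply: measurable_funM.
    exact: (measurableT_comp mu_ measurable_fst).
  exact: (measurableT_comp mv measurable_snd).
have iuv : (m1 \x m2)%E.-integrable [set: T1 * T2] (fun z => (u z.1 * v z.2)%:E).
  apply/(integrable12ltyP m1 m2 muv) => /=.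
  have av : (\int[m2]_y `|(v y)%:E| < +oo)%E by case/integrableP: iv.
  have fv : (\int[m2]_y `|(v y)%:E|)%E \is a fin_num.
    by rewrite ge0_fin_numE ?integral_ge0.
  rewrite (_ : (fun x => _) = (fun x => (`|(u x)%:E| * \int[m2]_y `|(v y)%:E|)%E)).
    rewrite -(fineK fv) ge0_integralZr//.
    - rewrite fineK// muleC lte_mul_pinfty ?integral_ge0//.
      by case/integrableP: iu.
    - by apply: measurableT_comp => //; exact/measurable_EFinP.
    - by rewrite lee_fin fine_ge0 ?integral_ge0.
  apply/funext => x; under eq_integral do rewrite normrM EFinM.
  rewrite ge0_integralZl//.
  by apply/measurable_EFinP; exact: measurableT_comp.
split => //; rewrite -integral12_prod_meas1//.
rewrite (_ : fubini_F _ _ = fun x => ((u x)%:E * (\int[m2]_y (v y))%R%:E)%E).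
  rewrite integralZr// EFinM; congr (_ * _)%E.
  by rewrite /Rintegral fineK//; exact: integrable_fin_num.
apply/funext => x; rewrite /fubini_F /=.
under eq_integral do rewrite EFinM.
by rewrite integralZl// /Rintegral fineK//; exact: integrable_fin_num.
Qed.

(** Induction on n: the measure is the image of a product measure under [rV_cons]. *)
Lemma integral_tensor n (g : 'I_n -> R -> R) :
  (forall j, (@lebesgue_measure R).-integrable setT (EFin \o g j)) ->
  (lebesgue_rV n).-integrable setT (fun y => (\prod_j g j (rV_coord j y))%:E) /\
  (\int[lebesgue_rV n]_y (\prod_j g j (rV_coord j y))%:E =
    (\prod_j \int[lebesgue_measure]_t (g j t))%R%:E)%E.
Proof.
elim: n g => [|n IH] g ig.
  have -> : (fun y : 'rV[R]_0 => (\prod_(j < 0) g j (rV_coord j y))%:E) = cst 1%E.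
    by apply/funext => y; rewrite big_ord0.
  rewrite big_ord0; split => /=.
    apply/integrableP; split; first exact: measurable_cst.
    by rewrite integral_dirac//= diracT mul1e normr1 ltry.
  by rewrite integral_dirac//= diracT mul1e.
have [iG EG] := IH (fun j => g (lift ord0 j)) (fun j => ig _).
have [iT ET] := integral_tensor2 (ig ord0) iG.
set F := fun y : 'rV[R]_n.+1 => _.
have FE : F \o @rV_cons R n = fun z =>
    (g ord0 z.1 * \prod_j g (lift ord0 j) (rV_coord j z.2))%:E.
  apply/funext => -[a x]; rewrite /F /= big_ord_recl; congr (_ * _)%:E.
    by rewrite /rV_coord mxE unlift_none.
  by apply: eq_bigr => j _; rewrite /rV_coord mxE liftK.
have mF : measurable_fun setT F.
  apply/measurable_EFinP; apply: measurable_prod => j _.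
  apply: (measurableT_comp _ (rV_coord_meas j)).
  by apply/measurable_EFinP; exact: measurable_int (ig j).
have iF : (lebesgue_measure \x lebesgue_rV n)%E.-integrable (@rV_cons R n @^-1` setT)
    (F \o @rV_cons R n) by rewrite FE preimage_setT.
split; first exact: (integrable_pushforward (@measurable_rV_cons R n) mF iF).
rewrite big_ord_recl (integral_pushforward (@measurable_rV_cons R n) mF iF)//.
rewrite FE preimage_setT ET; congr (_ * _)%:E.
by rewrite /Rintegral EG.
Qed.

End tensor_integral.

(** * Product kernels and their telescoping sums *)

Section telescoping_products.
Context {R : realType} (d : nat).
Implicit Types a b : 'I_d -> R.

(** The i-th term of the telescoping sum for a difference of two products, when [e] is the
    difference of the factors at i. *)
Definition mixed a b (i : 'I_d) (e : R) (j : 'I_d) : R :=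
  if (j < i)%N then b j else if j == i then e else a j.

Lemma telescope_prod a b :
  \sum_i \prod_j mixed a b i (a i - b i) j = \prod_j a j - \prod_j b j.
Proof.
pose P (m : nat) := \prod_(j < d) (if (j < m)%N then b j else a j).
have PE i : \prod_j mixed a b i (a i - b i) j = - (P i.+1 - P i).
  have PD m : P m = (if (i < m)%N then b i else a i) *
      \prod_(j < d | j != i) (if (j < m)%N then b j else a j).
    by rewrite /P (bigD1 i).
  rewrite !PD (bigD1 i)//= /mixed ltnn eqxx ltnSn opprB.
  set Q := \prod_(j < d | _) _.
  rewrite (_ : \prod_(j < d | j != i) (if (j < i)%N then b j else a j) = Q); last first.
    by apply: eq_bigr => j /negbTE ->.
  rewrite (_ : \prod_(j < d | j != i) (if (j < i.+1)%N then b j else a j) = Q); last first.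
    apply: eq_bigr => j ji; rewrite ltnS leq_eqVlt.
    by rewrite (inj_eq val_inj) (negbTE ji).
  by rewrite -mulrBl.
rewrite (eq_bigr _ (fun i _ => PE i)).
rewrite sumrN -(big_mkord xpredT (fun i => P i.+1 - P i)) telescope_sumr// opprB.
by rewrite /P; congr (_ - _); apply: eq_bigr => j _; rewrite ?ltn_ord.
Qed.

Lemma prod_le_expn (M : R) (f : 'I_d -> R) :
  (forall j, `|f j| <= M) -> `|\prod_j f j| <= M ^+ d.
Proof.
move=> fM; rewrite normr_prod; apply: (@le_trans _ _ (\prod_(j < d) M)).
  by apply: ler_prod => j _; rewrite normr_ge0 fM.
by rewrite prodr_const card_ord.
Qed.

Lemma dist_prod (M : R) a b : 1 <= M -> (forall j, `|a j| <= M) ->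
  (forall j, `|b j| <= M) ->
  `|\prod_j a j - \prod_j b j| <= M ^+ d * \sum_j `|a j - b j|.
Proof.
move=> M1 aM bM; rewrite -telescope_prod (le_trans (ler_norm_sum _ _ _))//.
rewrite mulr_sumr; apply: ler_sum => i _.
rewrite normr_prod (bigD1 i)//= {1}/mixed ltnn eqxx mulrC ler_wpM2r//.
apply: (@le_trans _ _ (\prod_(j < d) M)); last by rewrite prodr_const card_ord.
rewrite [leRHS](bigD1 i)//=; apply: (@le_trans _ _ (\prod_(j < d | j != i) M)).
  apply: ler_prod => j ji; rewrite normr_ge0/= /mixed (negbTE ji).
  by case: ifP => _.
by rewrite ler_peMl// prodr_ge0// => j _; rewrite (le_trans ler01).
Qed.

End telescoping_products.

Section kernels.
Local Open Scope classical_set_scope.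
Context {R : realType} (l d : nat).
Hypothesis l0 : (0 < l)%N.
Implicit Types (y u : 'rV[R]_d).

Definition kap k y u : R := \prod_j eta l k (rV_coord j y - rV_coord j u).

Definition zfac k (i : 'I_d) (e : R -> R) (j : 'I_d) : R -> R :=
  if (j < i)%N then eta l k.+1 else if j == i then e else eta l k.

(** The i-th term of the telescoping sum for [kap k - kap k.+1], in which the factor
    [eta k - eta k.+1] of the i-th coordinate is replaced by its iterated primitive
    [zeta k]. Only pure derivatives of order l are met in this way. *)
Definition zker k i y u : R :=
  \prod_j zfac k i (zeta l k) j (rV_coord j y - rV_coord j u).

Lemma kap_telescope k y u :
  \sum_i \prod_j zfac k i (fun t => eta l k t - eta l k.+1 t) j
    (rV_coord j y - rV_coord j u) = kap k y u - kap k.+1 y u.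
Proof.
rewrite -telescope_prod; apply: eq_bigr => i _; apply: eq_bigr => j _.
by rewrite /zfac /mixed; case: ifP => // _; case: eqVneq => // ->.
Qed.

(** A cube containing the supports in u of [kap k y], [kap k.+1 y] and [zker k i y]; its
    size and its distance to y are both of order 2^-k. *)
Definition kbox k y : set 'rV[R]_d :=
  [set u | forall j, `[rV_coord j y - 2 / 2 ^+ k, rV_coord j y - 2^-1 / 2 ^+ k] (rV_coord j u)].

Let p2 k : 0 < (2 : R) ^+ k. Proof. by rewrite exprn_gt0. Qed.

Lemma kboxP k y u : kbox k y u <->
  forall j, 1 <= 2 ^+ k.+1 * (rV_coord j y - rV_coord j u) /\
            2 ^+ k * (rV_coord j y - rV_coord j u) <= 2.
Proof.
split=> H j; have := H j; rewrite /= in_itv/= exprS.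
  move=> /andP[]; rewrite lerBlDr -lerBlDl ler_pdivlMr// => h1.
  rewrite lerBrDr -lerBrDl ler_pdivrMr// => h2.
  by split; nra.
move=> [h1 h2]; rewrite lerBlDr -lerBlDl ler_pdivlMr//.
by rewrite lerBrDr -lerBrDl ler_pdivrMr//; apply/andP; split; nra.
Qed.

Lemma measurable_kbox k y : measurable (kbox k y).
Proof.
rewrite (_ : kbox k y = \bigcap_(j in [set: 'I_d]) (rV_coord j @^-1`
    `[rV_coord j y - 2 / 2 ^+ k, rV_coord j y - 2^-1 / 2 ^+ k])).
  apply: fin_bigcap_measurable => [|i _]; first exact: finite_finset.
  by rewrite -[X in measurable X]setTI; apply: rV_coord_meas.
by apply/seteqP; split => z Hz j; [move=> _|]; exact: Hz.
Qed.

Lemma lebesgue_kbox k y : (lebesgue_rV d (kbox k y) <= ((2 / 2 ^+ k) ^+ d)%:E)%E.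
Proof.
rewrite /kbox (@lebesgue_rV_box _ _ (fun j =>
  `[rV_coord j y - 2 / 2 ^+ k, rV_coord j y - 2^-1 / 2 ^+ k]))//.
under eq_bigr do rewrite lebesgue_measure_itv/= lte_fin ltrD2l ltrN2 ltr_pM2r ?invr_gt0//.
rewrite (_ : (2^-1 : R) < 2); last by lra.
have e0 : 0 < (2 ^+ k : R)^-1 by rewrite invr_gt0.
rewrite (eq_bigr (fun=> (2 / 2 ^+ k - 2^-1 / 2 ^+ k)%:E)); last first.
  by move=> j _; rewrite -EFinB; congr EFin; ring.
rewrite prodEFin prodr_const card_ord lee_fin lerXn2r ?nnegrE//.
- by rewrite subr_ge0 ler_pM2r//; lra.
- by rewrite lerBlDr lerDl mulr_ge0 ?invr_ge0 ?ltW.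
Qed.

Lemma eta_gt k t : 2 < 2 ^+ k * t -> eta l k t = 0 :> R.
Proof. by move=> kt; rewrite etaE// eta0_gt2 ?mulr0. Qed.

Lemma eta_lt k t : 2 ^+ k * t < 1 -> eta l k t = 0 :> R.
Proof. by move=> kt; rewrite etaE// eta0_lt1 ?mulr0. Qed.

Let kt_lt k (t : R) : 2 ^+ k.+1 * t < 1 -> 2 ^+ k * t < 1.
Proof. by have := p2 k; rewrite exprS => ? ?; nra. Qed.

Let kt_gt k (t : R) : 2 < 2 ^+ k * t -> 2 < 2 ^+ k.+1 * t.
Proof. by have := p2 k; rewrite exprS => ? ?; nra. Qed.

Lemma zfac_supp k i j t : ~ (1 <= 2 ^+ k.+1 * t /\ 2 ^+ k * t <= 2) ->
  zfac k i (zeta l k) j t = 0.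
Proof.
move=> /not_andP H; rewrite /zfac.
case: H => /negP; rewrite -ltNge => H.
  case: ifP => _; first exact: eta_lt.
  by case: ifP => _; [exact: zeta_lt|exact/eta_lt/kt_lt].
case: ifP => _; first exact/eta_gt/kt_gt.
by case: ifP => _; [exact: zeta_gt|exact/eta_gt].
Qed.

Lemma zker_supp k i y u : ~ kbox k y u -> zker k i y u = 0.
Proof.
move=> /kboxP/existsNP[j H]; rewrite /zker (bigD1 j)//=.
by rewrite zfac_supp ?mul0r.
Qed.

Lemma kap_supp k y u : ~ kbox k y u -> kap k y u = 0.
Proof.
move=> /kboxP/existsNP[j /not_andP H]; rewrite /kap (bigD1 j)//=.
by case: H => /negP; rewrite -ltNge => H;
  [rewrite (eta_lt (kt_lt H)) mul0r|rewrite (eta_gt H) mul0r].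
Qed.

Lemma kap_supp1 k y u : ~ kbox k y u -> kap k.+1 y u = 0.
Proof.
move=> /kboxP/existsNP[j /not_andP H]; rewrite /kap (bigD1 j)//=.
by case: H => /negP; rewrite -ltNge => H;
  [rewrite (eta_lt H) mul0r|rewrite (eta_gt (kt_gt H)) mul0r].
Qed.

Lemma eta_bound : exists2 C : R, 1 <= C & forall k t, `|eta l k t| <= C * 2 ^+ k :> R.
Proof.
have [C C0 HC] := @eta0_bounded R l l0.
exists (1 + C); first by rewrite lerDl.
move=> k t; rewrite etaE// normrM ger0_norm ?(ltW (p2 _))// mulrC ler_pM2r//.
by rewrite (le_trans (HC _))// lerDr.
Qed.

(** There are d - 1 factors of size 2^k and one of size 2^(-k(l - 1)). *)
Lemma zker_bound : exists2 C : R, 0 <= C & forall k i y u,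
  `|zker k i y u| <= C * ((2 ^+ k) ^+ d / (2 ^+ k) ^+ l) * \1_(kbox k y) u.
Proof.
have [C C1 HC] := eta_bound.
have C0 : 0 <= C by rewrite (le_trans ler01).
pose A := 2 * C + 2 ^+ l.-1.
have A0 : 0 <= A by rewrite addr_ge0 ?mulr_ge0 ?exprn_ge0.
exists (A ^+ d); first by rewrite exprn_ge0.
move=> k i y u; have [uk|uk] := pselect (kbox k y u); last first.
  by rewrite zker_supp// normr0 indicE memNset// mulr0.
rewrite indicE mem_set// mulr1 normr_prod.
apply: (@le_trans _ _ (\prod_(j < d) (A * 2 ^+ k * (if j == i then ((2 ^+ k) ^+ l)^-1 else 1)))).
  apply: ler_prod => j _; rewrite normr_ge0/= /zfac.
  have e1 t : `|eta l k.+1 t| <= A * 2 ^+ k.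
    rewrite (le_trans (HC _ _))// exprS mulrA ler_pM2r// mulrC /A.
    by rewrite lerDl exprn_ge0.
  have e0 t : `|eta l k t| <= A * 2 ^+ k.
    rewrite (le_trans (HC _ _))// ler_pM2r// /A.
    have : 0 <= (2 : R) ^+ l.-1 by rewrite exprn_ge0.
    lra.
  have [ji|ij] := ltnP j i.
    by rewrite ifF ?mulr1//; apply/negbTE; rewrite neq_ltn ji.
  case: eqVneq => [_|_]; last by rewrite mulr1.
  rewrite (le_trans (zeta_bound _ _ _))//.
  rewrite -[in leRHS](prednK l0) exprS invfM mulrA mulfK ?gt_eqF//.
  rewrite expr_div_n ler_wpM2r ?invr_ge0 ?exprn_ge0//.
  by rewrite /A lerDr mulr_ge0.
rewrite big_split/= prodr_const card_ord exprMn mulrA ler_wpM2l//.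
  by rewrite mulr_ge0 ?exprn_ge0.
by rewrite -big_mkcond/= big_pred1_eq.
Qed.

Lemma kap_bound : exists2 C : R, 0 <= C & forall k y u,
  `|kap k y u| <= C * (2 ^+ k) ^+ d * \1_(kbox k y) u.
Proof.
have [C C1 HC] := eta_bound.
exists (C ^+ d); first by rewrite exprn_ge0 ?(le_trans ler01).
move=> k y u; have [uk|uk] := pselect (kbox k y u); last first.
  by rewrite kap_supp// normr0 indicE memNset// mulr0.
by rewrite indicE mem_set// mulr1 -exprMn; exact: prod_le_expn.
Qed.

Lemma kap_lipschitz k : exists2 C : R, 0 <= C & forall y z u,
  `|kap k y u - kap k z u| <=
    C * (\sum_j `|rV_coord j y - rV_coord j z|) * (\1_(kbox k y) u + \1_(kbox k z) u).
Proof.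
have [C C1 HC] := eta_bound.
have [L L0 HL] := @eta0_lipschitz R l l0.
have M1 : 1 <= C * 2 ^+ k.
  by rewrite -[leLHS]mulr1 ler_pM// -[leLHS](expr1n _ k) lerXn2r ?nnegrE// ler1n.
exists ((C * 2 ^+ k) ^+ d * (2 ^+ k * L * 2 ^+ k)).
  by rewrite !(mulr_ge0, exprn_ge0)// (le_trans ler01).
move=> y z u.
have S0 : 0 <= \sum_(j < d) `|rV_coord j y - rV_coord j z| by exact: sumr_ge0.
set D := _ ^+ d * _.
have D0 : 0 <= D by rewrite !(mulr_ge0, exprn_ge0)// (le_trans ler01).
have main : `|kap k y u - kap k z u| <= D * \sum_j `|rV_coord j y - rV_coord j z|.
  apply: (le_trans (dist_prod M1 (fun j => HC k _) (fun j => HC k _))).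
  rewrite -mulrA ler_wpM2l ?exprn_ge0 ?(le_trans ler01)// mulr_sumr.
  apply: ler_sum => j _; rewrite etaE// (etaE _ k)// -mulrBr normrM.
  rewrite ger0_norm ?exprn_ge0// -!mulrA ler_wpM2l ?exprn_ge0//.
  apply: (le_trans (HL _ _)); rewrite ler_wpM2l//.
  by rewrite -mulrBr normrM ger0_norm ?exprn_ge0// opprB addrA subrK.
have [uy|uy] := pselect (kbox k y u).
  rewrite (le_trans main)// ler_peMr ?(mulr_ge0 D0)//.
  by rewrite [\1_(kbox k y) u]indicE mem_set// lerDl indicE.
have [uz|uz] := pselect (kbox k z u).
  rewrite (le_trans main)// ler_peMr ?(mulr_ge0 D0)//.
  by rewrite [\1_(kbox k z) u]indicE mem_set// lerDr indicE.
by rewrite !kap_supp// subrr normr0 mulr_ge0 ?(mulr_ge0 D0)// addr_ge0.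
Qed.

Lemma measurable_eta k : measurable_fun setT (eta l k : R -> R).
Proof. by apply: continuous_measurable_fun; exact/smooth1_continuous/smooth1_eta. Qed.

Lemma measurable_zeta k : measurable_fun setT (zeta l k : R -> R).
Proof. by apply: continuous_measurable_fun; exact/smooth1_continuous/smooth1_zeta. Qed.

Lemma measurable_kap k :
  measurable_fun [set: 'rV[R]_d * 'rV[R]_d] (fun z => kap k z.1 z.2).
Proof.
apply: measurable_prod => j _; apply: (measurableT_comp (measurable_eta k)).
apply: measurable_funB.
  exact: (measurableT_comp (rV_coord_meas j) measurable_fst).
exact: (measurableT_comp (rV_coord_meas j) measurable_snd).
Qed.

Lemma measurable_kap2 k y : measurable_fun setT (kap k y).
Proof.
exact: (measurableT_comp (measurable_kap k) (measurable_pair1 y)).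
Qed.

Lemma measurable_zker k i y : measurable_fun setT (zker k i y).
Proof.
apply: measurable_prod => j _.
apply: (@measurableT_comp _ _ _ _ _ _ (zfac k i (zeta l k) j)); last first.
  by apply: measurable_funB => //; exact: rV_coord_meas.
rewrite /zfac; case: ifP => _; first exact: measurable_eta.
by case: ifP => _; [exact: measurable_zeta|exact: measurable_eta].
Qed.

(** Needed to identify the limit of the mollifications: by Fubini, the integral of a
    mollified function over a box is an integral against this product. *)
Lemma integral_kap_box k (a b : 'I_d -> R) u : (forall j, a j <= b j) ->
  (\int[lebesgue_rV d]_(y in box (@rV_coord R d) a b) (kap k y u)%:E =
    (\prod_j (prim l k (b j - rV_coord j u) - prim l k (a j - rV_coord j u)))%:E)%E.
Proof.
move=> ab.
pose g j t : R := \1_(`[a j, b j[%classic) t * eta l k (t - rV_coord j u).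
have ce j : continuous (fun x => eta l k (x - rV_coord j u)).
  have := smooth1_aff 1 (- rV_coord j u) (@smooth1_eta R l k).
  by under eq_fun do rewrite mul1r; exact: smooth1_continuous.
have iE j : (\int[lebesgue_measure]_t (g j t)%:E =
    (prim l k (b j - rV_coord j u) - prim l k (a j - rV_coord j u))%:E)%E.
  rewrite -integral_eta// -integral_itv_bndo_bndc; last first.
    by apply: measurable_funTS; apply/measurable_EFinP; exact: continuous_measurable_fun.
  rewrite [RHS]integral_mkcond; apply: eq_integral => t _.
  by rewrite patchE /g indicE; case: ifP => _; rewrite ?mul1r ?mul0r.
have ig j : (@lebesgue_measure R).-integrable setT (EFin \o g j).
  rewrite (_ : EFin \o g j = (EFin \o (fun x => eta l k (x - rV_coord j u))) \_ `[a j, b j[).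
    have : (@lebesgue_measure R).-integrable `[a j, b j[%classic
        (EFin \o (fun x => eta l k (x - rV_coord j u))).
      have := @integrableS _ (measurableTypeR R) R lebesgue_measure `[a j, b j]%classic `[a j, b j[%classic (EFin \o (fun x => eta l k (x - rV_coord j u))); apply => //.
        by apply: subset_itv; rewrite bnd_simp.
      apply: continuous_compact_integrable; first exact: segment_compact.
      exact: continuous_subspaceT.
    by move/integrable_mkcond; apply.
  apply/funext => t; rewrite patchE /g /= indicE.
  by case: ifP => _; rewrite ?mul1r ?mul0r.
have [_ E] := integral_tensor ig.
rewrite integral_mkcond.
rewrite (_ : \prod_j _ = \prod_j \int[lebesgue_measure]_t g j t); last first.
  by apply: eq_bigr => j _; rewrite /Rintegral iE.
rewrite -E; apply: eq_integral => y _; rewrite patchE.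
case: ifPn => [/set_mem yab|/negP yab].
  congr EFin; apply: eq_bigr => j _; rewrite /g indicE mem_set ?mul1r//=.
  by rewrite in_itv/=; exact: yab.
have /existsNP[j /negP yj] : ~ box (@rV_coord R d) a b y by move/mem_set.
rewrite (bigD1 j)//= /g indicE memNset ?mul0r//.
by rewrite /= in_itv/=; exact/negP.
Qed.

End kernels.

(** * Sums of dyadic potentials *)

Lemma measurable_above {R : realType} d (T : measurableType d) (w : T -> R) (N : R) :
  measurable_fun setT w -> measurable_fun setT (fun z => w z * (N < w z)%R%:R).
Proof.
move=> mw; apply: measurable_funM => //.
rewrite (_ : (fun _ => _) = \1_(w @^-1` `]N, +oo[%classic)).
  apply: measurable_indic; rewrite -[X in measurable X]setTI.
  exact: mw.
by apply/funext => u; rewrite indicE; congr (nat_of_bool _)%:R;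
  apply/idP/idP => [h|/set_mem]; [apply/mem_set|]; rewrite /= in_itv/= andbT.
Qed.

Section potential.
Local Open Scope classical_set_scope.
Context {R : realType}.

Lemma geometric_le (q : R) n m : 0 <= q < 1 ->
  \sum_(n <= k < m) q ^+ k <= q ^+ n / (1 - q).
Proof.
move=> /andP[q0 q1]; have q1' : 0 < 1 - q by rewrite subr_gt0.
have [mn|nm] := leqP m n.
  by rewrite big_geq// divr_ge0 ?exprn_ge0// ltW.
rewrite ler_pdivlMr// mulr_suml.
rewrite (eq_big_nat _ _ (F2 := fun k => - (q ^+ k.+1 - q ^+ k))); last first.
  by move=> k _; rewrite exprS; ring.
rewrite sumrN telescope_sumr ?(ltnW nm)// opprB lerBlDr lerDl exprn_ge0//.
Qed.

(** If 1 <= 2^(k + 1) t then 2^(k + i) t > 2 for every i >= 3. *)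
Lemma overlap_le (t : R) n j :
  (\sum_(0 <= i < j) ((1 <= 2 ^+ (n + i).+1 * t)%R && (2 ^+ (n + i) * t <= 2)%R) <= 3)%N.
Proof.
pose P k := ((1 <= 2 ^+ k.+1 * t) && (2 ^+ k * t <= 2)).
have far m : P m -> forall i, (3 <= i)%N -> P (m + i)%N = false.
  move=> /andP[Pm _] i i3; apply/negbTE; rewrite /P negb_and -!ltNge.
  apply/orP; right; have t0 : 0 < t.
    by rewrite -(@pmulr_rgt0 _ (2 ^+ m.+1)) ?exprn_gt0//; apply: lt_le_trans Pm.
  rewrite -(subnKC i3) addnA exprD -mulrA mulrCA.
  have h : 4 <= 2 ^+ (m + 3) * t.
    have -> : 2 ^+ (m + 3) * t = 4 * (2 ^+ m.+1 * t) by rewrite exprD [2 ^+ m.+1]exprS; ring.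
    lra.
  apply: (@lt_le_trans _ _ 4); first by rewrite ltr_nat.
  apply: (le_trans h); rewrite ler_peMl//.
    by rewrite (le_trans _ h).
  by rewrite exprn_ege1// ler1n.
have main : forall j n, (\sum_(0 <= i < j) P (n + i)%N <= 3)%N.
  elim=> [|{}j IH] {}n; first by rewrite big_nil.
  rewrite big_nat_recl// addn0; case Pn: (P n); last first.
    rewrite add0n; apply: leq_trans (IH n.+1).
    by apply: leq_sum => i _; rewrite addnS addSn.
  rewrite add1n ltnS.
  have b1 i : (P i <= 1)%N by case: (P i).
  case: j {IH} => [|[|j]]; first by rewrite big_nil.
    by rewrite big_nat1; apply: leq_trans (b1 _) _.
  rewrite big_nat_recl// big_nat_recl// big1; last first.
    by move=> i _; rewrite far.
  by rewrite addn0 -[2%N]/(1 + 1)%N leq_add.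
exact: main.
Qed.

Variables (l d : nat) (p : R).
Hypothesis p1 : 1 <= p.
Implicit Types (w : 'rV[R]_d -> R) (y : 'rV[R]_d).
Local Notation leb := (lebesgue_rV d).

(** The contribution of generation k to the bound given by [zker_bound]: a dyadic piece
    of the Riesz potential of order l. *)
Definition pot k y w : \bar R :=
  (((2 ^+ k) ^+ d / (2 ^+ k) ^+ l)%:E * \int[leb]_(u in kbox k y) (w u)%:E)%E.

Let p0 : 0 < p. Proof. exact: lt_le_trans p1. Qed.

Let p2 k : 0 < (2 : R) ^+ k. Proof. by rewrite exprn_gt0. Qed.

Let exprn_powR (x : R) k : 0 <= x -> (x ^+ k) `^ p = (x `^ p) ^+ k.
Proof.
move=> x0; elim: k => [|k IH]; first by rewrite !expr0 powR1.
by rewrite !exprS powRM ?exprn_ge0// IH.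
Qed.

(** Above the height M one has a / M <= (a / M)^p. *)
Lemma threshold_le (M a : R) : 0 < M -> 0 <= a -> a <= M + M / M `^ p * a `^ p.
Proof.
move=> M0 a0; have [aM|Ma] := leP a M.
  by rewrite (le_trans aM)// lerDl mulr_ge0 ?divr_ge0 ?powR_ge0 ?(ltW M0).
rewrite -[leLHS]add0r lerD ?(ltW M0)//.
have -> : a = M * (a / M) by rewrite mulrCA divff ?mulr1// gt_eqF.
rewrite [X in _ * X `^ _]mulrCA divff ?gt_eqF// mulr1 mulrAC -mulrA.
rewrite ler_pM2l// mulrC.
apply: (@le_trans _ _ ((a / M) `^ p)).
  have aM1 : 1 <= a / M by rewrite ler_pdivlMr// mul1r ltW.
  have := ler_powR aM1 p1; rewrite powRr1 ?(le_trans ler01 aM1)// => h.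
  by rewrite mulrC.
by rewrite powRM ?invr_ge0 ?(ltW M0)// -powR_inv1 ?(ltW M0)// -powRrM mulN1r powRN.
Qed.

Let int_box_ge0 w k y : (forall u, 0 <= w u) ->
  (0 <= \int[leb]_(u in kbox k y) (w u)%:E)%E.
Proof. by move=> w0; apply: integral_ge0 => u _; rewrite lee_fin. Qed.

Let box_le w k y : (forall u, 0 <= w u) -> measurable_fun setT w ->
  (\int[leb]_(u in kbox k y) (w u)%:E <= \int[leb]_u (w u)%:E)%E.
Proof.
move=> w0 mw; apply: ge0_subset_integral => //; first exact: measurable_kbox.
- by apply/measurable_EFinP.
- by move=> u _; rewrite lee_fin.
Qed.

Lemma kbox_integral_le w k y (M : R) : 0 < M -> (forall u, 0 <= w u) ->
  measurable_fun setT w ->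
  (\int[leb]_(u in kbox k y) (w u)%:E <=
    (M * (2 / 2 ^+ k) ^+ d)%:E + (M / M `^ p)%:E * \int[leb]_u (w u `^ p)%:E)%E.
Proof.
move=> M0 w0 mw.
have mwp : measurable_fun setT (fun u => w u `^ p).
  exact: (measurableT_comp (measurable_powR _) mw).
apply: (@le_trans _ _ (\int[leb]_(u in kbox k y) (M%:E + (M / M `^ p * w u `^ p)%:E))%E).
  apply: ge0_le_integral => //; first exact: measurable_kbox.
  - by move=> u _; rewrite lee_fin.
  - exact/measurable_EFinP/measurable_funTS.
  - apply/measurable_EFinP/measurable_funTS; apply: measurable_funD => //.
    exact: measurable_funM.
  - by move=> u _; rewrite -EFinD lee_fin threshold_le.
have mM : 0 <= M / M `^ p by rewrite divr_ge0 ?powR_ge0 ?ltW.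
rewrite ge0_integralD//=; first last.
- by apply/measurable_EFinP/measurable_funTS; exact: measurable_funM.
- by move=> u _; rewrite lee_fin mulr_ge0 ?powR_ge0.
- by move=> u _; rewrite lee_fin ltW.
- exact: measurable_kbox.
apply: leeD.
  rewrite integral_cst; last exact: measurable_kbox.
  rewrite [leRHS]EFinM; apply: lee_wpmul2l; first by rewrite lee_fin ltW.
  exact: lebesgue_kbox.
under eq_integral do rewrite EFinM.
rewrite ge0_integralZl_EFin//.
- apply: lee_wpmul2l; first by rewrite lee_fin.
  by apply: (@box_le (fun u => w u `^ p)) => // u; exact: powR_ge0.
- exact: measurable_kbox.
- by move=> u _; rewrite lee_fin powR_ge0.
- exact/measurable_EFinP/measurable_funTS.
Qed.

Lemma pot_ge0 w k y : (forall u, 0 <= w u) -> (0 <= pot k y w)%E.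
Proof. by move=> w0; rewrite mule_ge0 ?int_box_ge0// lee_fin divr_ge0 ?exprn_ge0 ?ltW. Qed.

(** In generation k cut w at the height lam 2^(kd/p). The two terms given by
    [kbox_integral_le], once multiplied by 2^(kd - kl), are both multiples of q^k with
    q = 2^(d/p - l) < 1, and the first one is as small as lam. *)
Lemma pot_sum_subcritical (tau : R) : d%:R < p * l%:R -> 0 < tau ->
  exists2 Lam : R, 0 <= Lam & forall w, (forall u, 0 <= w u) -> measurable_fun setT w ->
  forall y n m, (\sum_(n <= k < m) pot k y w <=
    tau%:E + Lam%:E * \int[leb]_u (w u `^ p)%:E)%E.
Proof.
move=> dpl tau0.
pose B : R := 2 `^ (d%:R / p); have B0 : 0 < B by rewrite powR_gt0.
pose q := B / 2 ^+ l.
have q01 : 0 <= q < 1.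
  rewrite divr_ge0 ?(ltW B0) ?(ltW (p2 _))//= /q ltr_pdivrMr// mul1r.
  rewrite -powR_mulrn// /B /powR pnatr_eq0/= ltr_expR ltr_pM2r ?ln_gt0 ?ltr1n//.
  by rewrite ltr_pdivrMr// mulrC.
have [q0 q1] := andP q01.
have q1' : 0 < 1 - q by rewrite subr_gt0.
pose lam := tau * (1 - q) / 2 ^+ d.
have lam0 : 0 < lam by rewrite divr_gt0// mulr_gt0.
pose c := lam / lam `^ p.
have c0 : 0 <= c by rewrite divr_ge0 ?powR_ge0 ?ltW.
exists (c / (1 - q)); first by rewrite divr_ge0// ltW.
move=> w w0 mw y n m.
set W := (\int[_]_u _)%E.
have W0 : (0 <= W)%E by apply: integral_ge0 => u _; rewrite lee_fin powR_ge0.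
have L0 : (0 <= (2 ^+ d * lam)%:E)%E by rewrite lee_fin mulr_ge0 ?exprn_ge0 ?(ltW lam0).
have cW0 : (0 <= c%:E * W)%E by rewrite mule_ge0// lee_fin.
have potk k : (pot k y w <= ((2 ^+ d * lam)%:E + c%:E * W) * (q ^+ k)%:E)%E.
  pose M := lam * B ^+ k; have M0 : 0 < M by rewrite mulr_gt0// exprn_gt0.
  have H := kbox_integral_le k y M0 w0 mw.
  rewrite /pot; apply: (le_trans (lee_wpmul2l _ H)); first by rewrite lee_fin.
  have n2 : (2 : R) ^+ k != 0 by rewrite gt_eqF.
  have e1 : (2 ^+ k) ^+ d / (2 ^+ k) ^+ l * (M * (2 / 2 ^+ k) ^+ d) =
      2 ^+ d * lam * q ^+ k.
    rewrite /q /M !expr_div_n -[(2 ^+ l) ^+ k]exprM [(l * k)%N]mulnC exprM.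
    have : (2 ^+ k : R) ^+ d != 0 by rewrite expf_neq0.
    have : (2 ^+ k : R) ^+ l != 0 by rewrite expf_neq0.
    move: ((2 ^+ k) ^+ d) ((2 ^+ k) ^+ l) (B ^+ k) (2 ^+ d) => x1 x2 x3 x4 *.
    by field; apply/andP.
  have e2 : (2 ^+ k) ^+ d / (2 ^+ k) ^+ l * (M / M `^ p) = c * q ^+ k.
    have -> : M `^ p = lam `^ p * (2 ^+ k) ^+ d.
      rewrite /M powRM ?exprn_ge0 ?(ltW lam0) ?(ltW B0)// exprn_powR ?(ltW B0)//.
      congr (_ * _); rewrite /B -powRrM mulfVK ?gt_eqF// powR_mulrn//.
      by rewrite -!exprM mulnC.
    rewrite /q /M /c !expr_div_n -[(2 ^+ l) ^+ k]exprM [(l * k)%N]mulnC exprM.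
    have : lam `^ p != 0 by rewrite gt_eqF// powR_gt0.
    have : (2 ^+ k : R) ^+ d != 0 by rewrite expf_neq0.
    have : (2 ^+ k : R) ^+ l != 0 by rewrite expf_neq0.
    move: ((2 ^+ k) ^+ d) ((2 ^+ k) ^+ l) (B ^+ k) (lam `^ p) => x1 x2 x3 x4 *.
    by field; apply/and3P.
  rewrite ge0_muleDr//; first last.
  - by rewrite mule_ge0// lee_fin divr_ge0 ?powR_ge0 ?ltW.
  - by rewrite lee_fin mulr_ge0 ?exprn_ge0 ?divr_ge0 ?ltW.
  rewrite ge0_muleDl//.
  by rewrite -EFinM e1 muleA -EFinM e2 [(c * q ^+ k)%:E]EFinM muleAC.
apply: (le_trans (lee_sum _ (fun k _ => potk k))).
rewrite -ge0_sume_distrr; last by move=> k _; rewrite lee_fin exprn_ge0.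
have X0 : (0 <= (2 ^+ d * lam)%:E + c%:E * W)%E.
  by rewrite adde_ge0.
rewrite sumEFin; apply: (@le_trans _ _ (((2 ^+ d * lam)%:E + c%:E * W) * ((1 - q)^-1)%:E)%E).
  apply: lee_wpmul2l => //; rewrite lee_fin (le_trans (geometric_le n m q01))//.
  rewrite ler_piMl ?invr_ge0 ?(ltW q1')// exprn_ile1// ltW//.
rewrite ge0_muleDl//.
rewrite -EFinM muleAC -EFinM leeD2r// lee_fin /lam mulrCA divff ?gt_eqF// mulr1.
by rewrite mulfK// gt_eqF.
Qed.

(** For l = d the weights are 1, and every point belongs to at most three cubes. *)
Lemma pot_sum_critical w y n m : (0 < d)%N -> l = d ->
  (forall u, 0 <= w u) -> measurable_fun setT w ->
  (\sum_(n <= k < m) pot k y w <= 3%:E * \int[leb]_u (w u)%:E)%E.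
Proof.
move=> d0 ld w0 mw.
have potE k : pot k y w = (\int[leb]_u (w u * \1_(kbox k y) u)%:E)%E.
  rewrite /pot ld divff ?mul1e; last by rewrite gt_eqF// exprn_gt0.
  rewrite integral_mkcond; apply: eq_integral => u _; rewrite patchE indicE.
  by case: ifP => _; rewrite ?mulr1 ?mulr0.
have mi k : measurable_fun [set: 'rV[R]_d] (fun u => (w u * \1_(kbox k y) u)%:E).
  apply/measurable_EFinP/measurable_funM => //.
  by apply: measurable_indic; exact: measurable_kbox.
under eq_bigr do rewrite potE.
rewrite -ge0_integral_sum//; last first.
  by move=> k u _; rewrite lee_fin mulr_ge0.
rewrite -ge0_integralZl_EFin//; first last.
- exact/measurable_EFinP.
- by move=> u _; rewrite lee_fin.
apply: ge0_le_integral => //.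
- by move=> u _; apply: sume_ge0 => k _; rewrite lee_fin mulr_ge0.
- exact: emeasurable_sum.
- by apply/measurable_EFinP; exact: measurable_funM.
move=> u _; rewrite sumEFin -EFinM lee_fin -mulr_sumr mulrC ler_wpM2r//.
(* Overlaps are counted in a single coordinate. *)
pose j0 := Ordinal d0; pose t := rV_coord j0 y - rV_coord j0 u.
have le1 k : \1_(kbox k y) u <= ((1 <= 2 ^+ k.+1 * t) && (2 ^+ k * t <= 2))%:R :> R.
  rewrite indicE; have [/set_mem/kboxP/(_ j0)[h1 h2]|_] := boolP (u \in _); last by [].
  by rewrite h1 h2.
apply: (le_trans (ler_sum _ (fun k _ => le1 k))).
rewrite -natr_sum ler_nat -{1}[n]add0n big_addn.
apply: leq_trans (overlap_le t n (m - n)).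
by apply: leq_sum => i _; rewrite addnC.
Qed.

Hypothesis pl : (d%:R < p * l%:R) \/ (p = 1 /\ l = d).
Hypothesis l0 : (0 < l)%N.

(** The heart of the proof, and the only place where the relation between p, l and d is
    used. The additive constant tau is arbitrarily small and Lam depends neither on w
    nor on y; estimates of this shape are exactly what a norm defined by majorants
    a(x) + b(y) requires. *)
Lemma pot_sum (tau : R) : 0 < tau ->
  exists2 Lam : R, 0 <= Lam & forall w, (forall u, 0 <= w u) -> measurable_fun setT w ->
  forall y n m, (\sum_(n <= k < m) pot k y w <=
    tau%:E + Lam%:E * \int[leb]_u (w u `^ p)%:E)%E.
Proof.
move=> tau0; case: pl => [dpl|[pp ld]]; first exact: pot_sum_subcritical.
exists 3 => // w w0 mw y n m.
rewrite (_ : (fun u => (w u `^ p)%:E) = fun u => (w u)%:E); last first.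
  by apply/funext => u; rewrite pp powRr1.
apply: (le_trans (pot_sum_critical _ _ _ _ ld w0 mw)); first by rewrite -ld.
by rewrite leeDr// lee_fin ltW.
Qed.

(** Apply [pot_sum] to the part of w above the height N. The part below N is bounded by
    N, so that it contributes a multiple of 2^(-kl) in generation k, which is
    negligible for late generations. *)
Lemma pot_tail (tau : R) : 0 < tau ->
  exists2 Lam : R, 0 <= Lam & forall N : R, 0 <= N -> exists n0, forall w,
  (forall u, 0 <= w u) -> measurable_fun setT w ->
  forall y n m, (n0 <= n)%N -> (\sum_(n <= k < m) pot k y w <=
    tau%:E + Lam%:E * \int[leb]_u ((w u * (N < w u)%R%:R) `^ p)%:E)%E.
Proof.
move=> tau0; have tau2 : 0 < tau / 2 by rewrite divr_gt0.
have [Lam Lam0 HLam] := pot_sum tau2; exists Lam => // N N0.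
pose D : R := N * 2 ^+ d.
have D0 : 0 <= D by rewrite mulr_ge0// exprn_ge0.
have [n0 Hn0] : exists n0, D * (2^-1 ^+ n0 * 2) <= tau / 2.
  have D1 : 0 < D * 2 + 1 by rewrite ltr_wpDl// mulr_ge0.
  have [n0 Hn0] := exp2_small (divr_gt0 tau2 D1).
  exists n0; rewrite exprVn; move: Hn0; rewrite ler_pdivlMr//.
  apply: le_trans; rewrite mulrCA ler_pM2l ?invr_gt0//; lra.
exists n0 => w w0 mw y n m n0n.
pose wt u := w u * (N < w u)%R%:R.
have wt0 u : 0 <= wt u by rewrite mulr_ge0.
have mwt : measurable_fun setT wt by exact: measurable_above.
have potk k : (pot k y w <= (D * 2^-1 ^+ k)%:E + pot k y wt)%E.
  rewrite /pot.
  have H : (\int[leb]_(u in kbox k y) (w u)%:E <=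
     (N * (2 / 2 ^+ k) ^+ d)%:E + \int[leb]_(u in kbox k y) (wt u)%:E)%E.
    apply: (@le_trans _ _ (\int[leb]_(u in kbox k y) (N%:E + (wt u)%:E))%E).
      apply: ge0_le_integral => //; first exact: measurable_kbox.
      - by move=> u _; rewrite lee_fin.
      - exact/measurable_EFinP/measurable_funTS.
      - by apply/measurable_EFinP/measurable_funTS; exact: measurable_funD.
      - move=> u _; rewrite -EFinD lee_fin /wt.
        by case: ltP => // ?; rewrite ?mulr1 ?mulr0 ?addr0// lerDr.
    rewrite ge0_integralD//=; first last.
    - exact/measurable_EFinP/measurable_funTS.
    - by move=> u _; rewrite lee_fin.
    - exact: measurable_kbox.
    apply: leeD => //; rewrite integral_cst; last exact: measurable_kbox.
    rewrite EFinM; apply: lee_wpmul2l; first by rewrite lee_fin.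
    exact: lebesgue_kbox.
  apply: (le_trans (lee_wpmul2l _ H)); first by rewrite lee_fin.
  rewrite ge0_muleDr ?lee_fin ?mulr_ge0 ?exprn_ge0 ?divr_ge0 ?(ltW (p2 _)) ?int_box_ge0//.
  apply: leeD => //; rewrite -EFinM lee_fin.
  have -> : (2 ^+ k) ^+ d / (2 ^+ k) ^+ l * (N * (2 / 2 ^+ k) ^+ d) =
      D * ((2 ^+ k) ^+ l)^-1.
    have n2 : (2 : R) ^+ k != 0 by rewrite gt_eqF.
    rewrite /D !expr_div_n.
    have : (2 ^+ k : R) ^+ d != 0 by rewrite expf_neq0.
    have : (2 ^+ k : R) ^+ l != 0 by rewrite expf_neq0.
    move: ((2 ^+ k) ^+ d) ((2 ^+ k) ^+ l) (2 ^+ d) => x1 x2 x3 *.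
    by field; apply/andP.
  rewrite ler_wpM2l// exprVn lef_pV2 ?posrE ?exprn_gt0//.
  rewrite -[leLHS]expr1 ler_weXn2l//.
  by rewrite -[leLHS](expr1n _ k) lerXn2r ?nnegrE// ler1n.
apply: (le_trans (lee_sum _ (fun k _ => potk k))).
rewrite big_split/= sumEFin -mulr_sumr.
rewrite (_ : tau = tau / 2 + tau / 2); last by rewrite -splitr.
rewrite EFinD -addeA; apply: leeD; last exact: HLam.
rewrite lee_fin (le_trans _ Hn0)// ler_wpM2l//.
apply: (le_trans (geometric_le n m (_ : 0 <= 2^-1 < 1))).
  by apply/andP; split; lra.
rewrite (_ : (1 - 2^-1 : R)^-1 = 2); last by field.
rewrite ler_pM2r// !exprVn lef_pV2 ?posrE ?exprn_gt0//.
by rewrite ler_weXn2l// ler1n.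
Qed.

End potential.

(** * Semimetrics generated by a sequence of functions *)

Section sequence_semimetric.
Local Open Scope classical_set_scope.
Context {R : realType} d (T : measurableType d).
Variable m : nat -> T -> R.

(** Truncating at 2^-k makes only finitely many functions matter at a given precision,
    while a small supremum still controls each [m k]. *)
Definition trunc_dist (k : nat) (x y : T) : R :=
  Num.min (2 ^- k) `|m k x - m k y|.

Definition seq_dist (x y : T) : R := sup (range (fun k => trunc_dist k x y)).

Let p2 k : 0 < (2 : R) ^- k. Proof. by rewrite invr_gt0 exprn_gt0. Qed.

Let trunc_ge0 k x y : 0 <= trunc_dist k x y.
Proof. by rewrite /trunc_dist le_min normr_ge0 ltW. Qed.

Let trunc_le k x y : trunc_dist k x y <= 2 ^- k.
Proof. by rewrite /trunc_dist ge_min lexx. Qed.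

Let p2_le k n : (n <= k)%N -> (2 : R) ^- k <= 2 ^- n.
Proof. by move=> nk; rewrite lef_pV2 ?posrE ?exprn_gt0// ler_weXn2l// ler1n. Qed.

Let trunc_ub x y : has_ubound (range (fun k => trunc_dist k x y)).
Proof.
exists 1 => _ [k _ <-]; apply: (le_trans (trunc_le k x y)).
by have := p2_le (leq0n k); rewrite expr0 invr1.
Qed.

Let dist_ge k x y : trunc_dist k x y <= seq_dist x y.
Proof. by apply: ub_le_sup => //; exists k. Qed.

Let dist_le x y (e : R) : (forall k, trunc_dist k x y <= e) -> seq_dist x y <= e.
Proof.
by move=> H; apply: ge_sup => [|_ [k _ <-]//]; exists (trunc_dist 0 x y), 0%N.
Qed.

Lemma seq_dist_control k (e : R) : 0 < e -> exists2 r : R, 0 < r &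
  forall x y, seq_dist x y < r -> `|m k x - m k y| < e.
Proof.
move=> e0; exists (Num.min e (2 ^- k)); first by rewrite lt_min e0 p2.
move=> x y xy; have := le_lt_trans (dist_ge k x y) xy.
rewrite /trunc_dist !lt_min !gt_min => /andP[/orP[H|//] /orP[|H']].
  by rewrite ltxx.
by rewrite (lt_le_trans H')// (le_trans _ (ltW H)).
Qed.

Lemma seq_dist_semimetric (A : set T) : semimetric A seq_dist.
Proof.
split.
- move=> x _; apply/eqP; rewrite eq_le; apply/andP; split.
    by apply: dist_le => k; rewrite /trunc_dist subrr normr0 ge_min lexx orbT.
  exact: le_trans (trunc_ge0 0 x x) (dist_ge 0 x x).
- by move=> x y _ _; exact: le_trans (trunc_ge0 0 x y) (dist_ge 0 x y).
- move=> x y _ _; rewrite /seq_dist.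
  rewrite (_ : (fun k => trunc_dist k x y) = (fun k => trunc_dist k y x))//.
  by apply/funext => k; rewrite /trunc_dist distrC.
- move=> x y z _ _ _; apply: dist_le => k.
  apply: (@le_trans _ _ (trunc_dist k x y + trunc_dist k y z)); last exact: lerD.
  have := ler_distD (m k y) (m k x) (m k z).
  rewrite /trunc_dist => H; have := p2 k => pk.
  have h1 := normr_ge0 (m k x - m k y); have h2 := normr_ge0 (m k y - m k z).
  rewrite ge_min; case: (leP (2 ^- k) `|m k x - m k y|) => c1;
    case: (leP (2 ^- k) `|m k y - m k z|) => c2; apply/orP;
    try (by left; lra); by right; lra.
Qed.

(** Code a point by the integer parts of 2^n [m k] for k < n. Two points with the same
    code are at distance at most 2^-n, and there are countably many codes. *)
Lemma seq_dist_separable (A : set T) : separable_for A seq_dist.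
Proof.
pose code n x := [seq Num.floor (2 ^+ n * m k x) | k <- iota 0 n].
pose good (i : nat * seq int) := [set c | A c /\ code i.1 c = i.2].
exists ((fun i => xget point (good i)) @` [set i | good i !=set0]); split.
- apply: (sub_countable (card_image_le (fun i => xget point (good i)) _)).
  exact: countableP.
- by move=> _ [i [c Hc] <-]; have [] := xgetI point Hc.
move=> x Ax e e0.
have [n ne] := exp2_small (divr_gt0 e0 (ltr0n R 2)).
have gx : good (n, code n x) x by [].
have [Ac /= codec] := xgetI point gx.
set c := xget _ _ in Ac codec *.
exists c; first by exists (n, code n x) => //; exists x.
apply: (@le_lt_trans _ _ (e / 2)); last by rewrite ltr_pdivrMr// ltr_pMr// ltr1n.
apply: le_trans ne; apply: dist_le => k.
have [nk|kn] := leqP n k; first by rewrite (le_trans (trunc_le _ _ _))// p2_le.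
have E : Num.floor (2 ^+ n * m k c) = Num.floor (2 ^+ n * m k x).
  have := congr1 (fun s => nth 0 s k) codec.
  by rewrite !(nth_map 0%N) ?size_iota// nth_iota.
rewrite /trunc_dist ge_min; apply/orP; right.
have := floor_itv (2 ^+ n * m k c); have := floor_itv (2 ^+ n * m k x).
rewrite E intrD => /andP[h1 h2] /andP[h3 h4].
have q0 : 0 < (2 : R) ^+ n by rewrite exprn_gt0.
rewrite -(ler_pM2l q0) divff ?gt_eqF// -[in leLHS](gtr0_norm q0) -normrM mulrBr.
by rewrite ler_norml; apply/andP; split; lra.
Qed.

Lemma seq_dist_measurable : (forall k, measurable_fun setT (m k)) ->
  measurable_fun [set: T * T] (fun z => seq_dist z.1 z.2).
Proof.
move=> mm.
rewrite (_ : (fun z => _) = (fun z : T * T => sups (fun k => trunc_dist k z.1 z.2) 0%N)).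
  apply: measurable_fun_sups => // k.
  apply: measurable_minr => //; apply: measurableT_comp => //.
  apply: measurable_funB; first exact: (measurableT_comp (mm k) measurable_fst).
  exact: (measurableT_comp (mm k) measurable_snd).
apply/funext => z; rewrite /sups/= /sdrop; congr sup.
by apply/seteqP; split => _ [k _ <-]; exists k.
Qed.

Lemma admissible_seq_dist (mu : {sigma_finite_measure set T -> \bar R}) (A : set T) :
  measurable A -> (forall k, measurable_fun setT (m k)) -> admissible mu A seq_dist.
Proof.
move=> mA mm; split; first exact: seq_dist_semimetric.
  exists (fun z => seq_dist z.1 z.2); last exact: aeW.
  by apply: measurable_funTS; exact: seq_dist_measurable.
exists A; split => //; first by rewrite setDv; exact: negligible_set0.
exact: seq_dist_separable.
Qed.

End sequence_semimetric.

(** * Functions with integrable p-th power, and cut-offs *)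

Section Lp_integrability.
Local Open Scope classical_set_scope.
Context {R : realType} d (T : measurableType d).
Variables (mu : {measure set T -> \bar R}) (p : R).
Hypothesis p1 : 1 <= p.

Definition in_Lp (v : T -> R) :=
  measurable_fun [set: T] v /\ (\int[mu]_z (`|v z| `^ p)%:E < +oo)%E.

Lemma norm_le_Lp (a : R) : `|a| <= 1 + `|a| `^ p.
Proof.
have := @threshold_le R p p1 1 `|a| ltr01 (normr_ge0 _).
by rewrite powR1 divr1 mul1r.
Qed.

Lemma measurable_normpow (v : T -> R) : measurable_fun setT v ->
  measurable_fun setT (fun z => `|v z| `^ p).
Proof.
move=> mv; apply: (measurableT_comp (measurable_powR p)).
exact: measurableT_comp.
Qed.

Lemma Lp_integral_le (v : T -> R) B : in_Lp v -> measurable B ->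
  (\int[mu]_(z in B) `|v z|%:E <= mu B + \int[mu]_z (`|v z| `^ p)%:E)%E.
Proof.
move=> [mv vp] mB.
have mvp := measurable_normpow mv.
apply: (@le_trans _ _ (\int[mu]_(z in B) (1%:E + (`|v z| `^ p)%:E))%E).
  apply: ge0_le_integral => //.
  - by apply/measurable_EFinP/measurable_funTS; exact: measurableT_comp.
  - by apply/measurable_EFinP/measurable_funTS; exact: measurable_funD.
  - by move=> z _; rewrite -EFinD lee_fin norm_le_Lp.
rewrite ge0_integralD//=; last exact/measurable_EFinP/measurable_funTS.
rewrite integral_cst// mul1e leeD2l//.
by apply: ge0_subset_integral => //; exact/measurable_EFinP.
Qed.

Lemma Lp_integrable (v : T -> R) B : in_Lp v -> measurable B ->
  (mu B < +oo)%E -> mu.-integrable B (EFin \o v).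
Proof.
move=> Lv mB Boo; apply/integrableP; split.
  by apply/measurable_EFinP/measurable_funTS; case: Lv.
apply: le_lt_trans (Lp_integral_le Lv mB) _.
by rewrite lte_add_pinfty//; case: Lv.
Qed.

Lemma Lp_integrable_ker (v K : T -> R) B C : in_Lp v -> measurable B ->
  (mu B < +oo)%E -> measurable_fun setT K -> (forall z, `|K z| <= C * \1_B z) ->
  mu.-integrable setT (fun z => (v z * K z)%:E).
Proof.
move=> Lv mB Boo mK KC.
have iv := Lp_integrable Lv mB Boo.
have ivB : mu.-integrable setT ((EFin \o v) \_ B).
  by move: iv => /integrable_mkcond; apply.
apply: (@le_integrable _ _ _ _ _ measurableT _ (fun z => (C%:E * ((EFin \o v) \_ B) z)%E)).
- by apply/measurable_EFinP; apply: measurable_funM => //; case: Lv.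
- move=> z _; rewrite patchE; have := KC z; rewrite indicE.
  case: ifP => _; rewrite ?mulr1 ?mulr0 => h; rewrite -?EFinM lee_fin !normrM mulrC.
    by rewrite ler_wpM2r// (le_trans h)// ler_norm.
  by rewrite (le_trans (ler_wpM2r _ h))// mul0r mulr_ge0.
- exact: integrableZl.
Qed.

Lemma Lp_Rintegral_ker_le (v K : T -> R) B C : in_Lp v -> measurable B ->
  (mu B < +oo)%E -> measurable_fun setT K -> 0 <= C -> (forall z, `|K z| <= C * \1_B z) ->
  (`|\int[mu]_z (v z * K z)|%:E <= C%:E * \int[mu]_(z in B) `|v z|%:E)%E.
Proof.
move=> Lv mB Boo mK C0 KC.
have iK := Lp_integrable_ker Lv mB Boo mK KC.
apply: (@le_trans _ _ (\int[mu]_z `|(v z * K z)%:E|)%E).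
  have := le_normr_Rintegral measurableT iK; rewrite -lee_fin => /le_trans; apply.
  rewrite /Rintegral fineK//.
  exact: integrable_fin_num (integrable_norm iK).
rewrite -ge0_integralZl_EFin//; last first.
  by apply/measurable_EFinP/measurable_funTS; apply: measurableT_comp => //; case: Lv.
rewrite [leRHS]integral_mkcond; apply: ge0_le_integral => //.
- by apply: measurableT_comp => //; exact: measurable_int iK.
- apply/(measurable_restrictT _ mB); apply/measurable_EFinP/measurable_funTS.
  apply: measurable_funM => //; apply: measurableT_comp => //; by case: Lv.
- move=> z _; rewrite patchE; have := KC z; rewrite indicE.
  case: ifP => _; rewrite ?mulr1 ?mulr0 => h; rewrite -?EFinM lee_fin normrM mulrC.
    by rewrite ler_wpM2r.
  by rewrite (le_trans (ler_wpM2r _ h))// mul0r.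
Qed.

End Lp_integrability.

Lemma lebesgue_box_lty {R : realType} n (a b : 'I_n -> R) :
  (lebesgue_rV n (box (@rV_coord R n) a b) < +oo)%E.
Proof.
have -> : box (@rV_coord R n) a b = [set x | forall i, `[a i, b i[%classic (x ord0 i)].
  by apply/seteqP; split => x /= H i; have := H i; rewrite /rV_coord/= in_itv/=.
rewrite (@lebesgue_rV_box _ _ (fun i => `[a i, b i[%classic))//.
under eq_bigr do rewrite lebesgue_measure_itv/=.
rewrite (eq_bigr (fun i => (if a i < b i then b i - a i else 0)%:E)).
  by rewrite prodEFin ltry.
by move=> i _; rewrite lte_fin; case: ifP.
Qed.

Section box_cutoff.
Local Open Scope classical_set_scope.
Context {R : realType} d (T : measurableType d) (I : finType) (c : I -> T -> R).
Implicit Types (a b : I -> R).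

(** A smoothed indicator of the interval from a to b: the transitions take place just
    below a and just below b, at distances of order 1 / m. *)
Definition cutoff1 (a b : R) m (t : R) : R :=
  step (m%:R * (b - t)) - step (m%:R * (a - t)).

Lemma smooth1_cutoff1 (a b : R) m : smooth1 (cutoff1 a b m).
Proof.
have H s : smooth1 (fun t : R => step (m%:R * (s - t))).
  rewrite (_ : (fun _ => _) = fun t => step (- m%:R * t + m%:R * s)).
    exact: (smooth1_aff _ _ smooth1_step).
  by apply/funext => t; congr step; ring.
exact: smooth1B.
Qed.

Lemma cutoff1_le1 (a b : R) m t : `|cutoff1 a b m t| <= 1.
Proof.
rewrite /cutoff1; have := step_ge0 (m%:R * (b - t)); have := step_ge0 (m%:R * (a - t)).
have := step_le1 (m%:R * (b - t)); have := step_le1 (m%:R * (a - t)).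
by move=> *; rewrite ler_norml; apply/andP; split; lra.
Qed.

Lemma cutoff1_supp (a b : R) m (e : R) t : a < b -> 2 <= m%:R * e ->
  ~~ (a - e <= t <= b) -> cutoff1 a b m t = 0.
Proof.
move=> ab me; have m0 : 0 <= m%:R :> R by [].
rewrite negb_and -!ltNge /cutoff1 => /orP[h|h].
  by rewrite !step1 ?subrr//; nra.
by rewrite !step0 ?subrr//; nra.
Qed.

(** One-sided steps converge to indicators of half-open intervals everywhere, end points
    included; this is why the boxes are half-open. *)
Lemma steps_diff_cvg (F : nat -> R -> R) (a b t : R) : a < b ->
  (forall s, 0 < s -> \forall m \near \oo, F m s = 1) ->
  (forall m s, s <= 0 -> F m s = 0) ->
  F m (b - t) - F m (a - t) @[m --> \oo] --> (\1_`[a, b[ t : R).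
Proof.
move=> ab F1 F0; apply: cvg_near_cst; rewrite indicE.
have [ta|at_] := ltP t a.
  rewrite memNset; last by rewrite /= in_itv/= leNgt ta.
  have tb := lt_trans ta ab; rewrite -subr_gt0 in ta; rewrite -subr_gt0 in tb.
  near=> m; rewrite (near (F1 _ ta) m)// (near (F1 _ tb) m)// subrr//.
have at0 : a - t <= 0 by rewrite subr_le0.
have [tb|bt] := ltP t b.
  rewrite mem_set/= ?in_itv/= ?at_ ?tb//.
  rewrite -subr_gt0 in tb.
  by near=> m; rewrite (near (F1 _ tb) m)// F0// subr0.
rewrite memNset; last by rewrite /= in_itv/= ltNge bt andbF.
by rewrite -subr_le0 in bt; near=> m; rewrite !F0// subrr.
Unshelve. all: by end_near. Qed.

Lemma cutoff1_cvg (a b : R) t : a < b ->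
  cutoff1 a b m t @[m --> \oo] --> (\1_`[a, b[ t : R).
Proof.
move=> ab; apply: (@steps_diff_cvg (fun m s => step (m%:R * s))) => // [s s0|m s s0].
  exists (Num.trunc (2 / s)).+1 => // m /= hm; apply: step1; rewrite -ler_pdivrMr//.
  apply: (@le_trans _ _ (Num.trunc (2 / s)).+1%:R); first by rewrite ltW// truncnS_gt.
  by rewrite ler_nat.
by apply: step0; apply: le_trans ler01; rewrite mulr_ge0_le0.
Qed.

Lemma box_indic_cvg (G : nat -> I -> R -> R) a b x :
  (forall i t, G m i t @[m --> \oo] --> (\1_`[a i, b i[ t : R)) ->
  \prod_i G m i (c i x) @[m --> \oo] --> (\1_(box c a b) x : R).
Proof.
move=> G1.
have -> : \1_(box c a b) x = \prod_i (\1_`[a i, b i[ (c i x) : R).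
  rewrite indicE; have [xb|xb] := pselect (box c a b x).
    rewrite mem_set// big1// => i _; rewrite indicE mem_set//= in_itv/=; exact: xb.
  have /existsNP[i /negP H] := xb.
  by rewrite memNset// (bigD1 i)//= indicE memNset ?mul0r//= in_itv/=; exact/negP.
elim: (index_enum _) => [|i s IH].
  under eq_fun do rewrite big_nil; rewrite big_nil; exact: cvg_cst.
by under eq_fun do rewrite big_cons; rewrite big_cons; apply: cvgM.
Qed.

Definition cutoff a b m (x : T) := \prod_i cutoff1 (a i) (b i) m (c i x).

Lemma measurable_cutoff a b m : (forall i, measurable_fun setT (c i)) ->
  measurable_fun setT (cutoff a b m).
Proof.
move=> mc; apply: measurable_prod => i _; apply: (@measurableT_comp _ _ _ _ _ _ (cutoff1 (a i) (b i) m)).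
  by apply: continuous_measurable_fun; exact/smooth1_continuous/smooth1_cutoff1.
exact: mc.
Qed.

Lemma cutoff_le1 a b m x : `|cutoff a b m x| <= 1.
Proof.
by rewrite /cutoff normr_prod prodr_ile1// => i _; rewrite normr_ge0 cutoff1_le1.
Qed.

Lemma cutoff_supp a b m (e : R) x : (forall i, a i < b i) -> 2 <= m%:R * e -> 0 < e ->
  ~ box c (fun i => a i - e) (fun i => b i + e) x -> cutoff a b m x = 0.
Proof.
move=> ab me e0 /existsNP[i /negP H]; rewrite /cutoff (bigD1 i)//=.
rewrite (cutoff1_supp (ab i) me) ?mul0r//; apply: contra H => /andP[-> h]/=.
by rewrite (le_lt_trans h)// ltrDl.
Qed.

Lemma cutoff_cvg a b x : (forall i, a i < b i) ->
  cutoff a b m x @[m --> \oo] --> (\1_(box c a b) x : R).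
Proof. by move=> ab; apply: (@box_indic_cvg (fun m i => cutoff1 (a i) (b i) m)) => i t; exact: cutoff1_cvg. Qed.

End box_cutoff.

(** * The telescoping identity on almost every slice *)

Section weak_telescoping.
Local Open Scope classical_set_scope.
Context {R : realType} {d1 d2 : nat}.
Local Notation E := ('rV[R]_d1 * 'rV[R]_d2)%type.
Local Notation coord := ('I_d1 + 'I_d2)%type.
Local Notation leb1 := (@lebesgue_rV R d1).
Local Notation leb2 := (@lebesgue_rV R d2).
Local Notation mu := (leb1 \x leb2)%E.
Variables (Omega1 : set 'rV[R]_d1) (Omega2 : set 'rV[R]_d2) (p : R) (l : nat).
Hypotheses (open1 : open Omega1) (p1 : 1 <= p) (l0 : (0 < l)%N).

(** The derivative of order l in the i-th coordinate of y, tested on tensor products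
    only. The integrals run over the whole space because the functions of interest are
    extended by zero. *)
Definition tensor_weak (v0 vi : E -> R) (i : 'I_d2) :=
  forall (g : coord -> R -> R) a b, (forall c, smooth1 (g c)) ->
  (forall c t, ~~ (a c <= t <= b c) -> g c t = 0) ->
  cbox a b `<=` Omega1 `*` Omega2 ->
  \int[mu]_z (v0 z * tens (fun c => (g c)^`(single (inr i) l c)%classic) z) =
  (-1) ^+ l * \int[mu]_z (vi z * tens g z).

(** From generation k on, the kernels at y are then supported in Omega2. *)
Definition room k (y : 'rV[R]_d2) :=
  forall u, (forall j, `|rV_coord j u - rV_coord j y| <= 2 / 2 ^+ k) -> Omega2 u.

Lemma room_kbox k y : room k y -> kbox k y `<=` Omega2.
Proof.
move=> H u uk; apply: H => j; have := uk j; rewrite /= in_itv/= => /andP[h1 h2].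
have : 0 <= (2 ^+ k : R)^-1 by rewrite invr_ge0 exprn_ge0.
by rewrite ler_norml => ?; apply/andP; split; lra.
Qed.

Variables (v0 : E -> R) (v : 'I_d2 -> E -> R).
Hypotheses (Lv0 : in_Lp mu p v0) (Lv : forall i, in_Lp mu p (v i)).
Hypothesis weak : forall i, tensor_weak v0 (v i) i.

Local Notation cutoff := (cutoff (@rV_coord R d1)).

(** Up to the sign (-1)^l, the derivative of order l of [zker k i y] in its i-th
    coordinate. *)
Definition dzker k i (y u : 'rV[R]_d2) : R :=
  \prod_j zfac l k i (fun t => eta l k t - eta l k.+1 t) j (rV_coord j y - rV_coord j u).

Let single_inr (i j : 'I_d2) : single (inr i : coord) l (inr j) = if j == i then l else 0%N.
Proof. by []. Qed.

Lemma dzfacE k i j :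
  zfac l k i (fun t => eta l k t - eta l k.+1 t) j =
  (zfac l k i (zeta l k) j)^`(single (inr i : coord) l (inr j))%classic :> (R -> R).
Proof.
rewrite /zfac single_inr; case: (ltnP j i) => ji.
  by rewrite -val_eqE /= ltn_eqF.
by case: eqVneq => // _; rewrite derive1n_zeta.
Qed.

Lemma dzker_bound k : exists C : R, forall i y u,
  `|dzker k i y u| <= C * \1_(kbox k y) u.
Proof.
have [C C1 HC] := @eta_bound R l l0.
pose M : R := C * 2 ^+ k + C * 2 ^+ k.+1.
have C0 n : 0 <= C * 2 ^+ n by rewrite mulr_ge0 ?exprn_ge0 ?(le_trans ler01 C1).
exists (M ^+ d2) => i y u; have [uk|uk] := pselect (kbox k y u); last first.
  suff -> : dzker k i y u = 0 by rewrite normr0 indicE memNset// mulr0.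
  have /kboxP/existsNP[j H] := uk; rewrite /dzker (bigD1 j)//= dzfacE.
  rewrite single_inr; case: eqVneq => [ji|_].
    rewrite {1}/zfac ji ltnn eqxx derive1n_zeta//.
    have /not_andP[/negP|/negP] := H; rewrite -ltNge ji => h.
      rewrite (eta_lt _ h)// eta_lt ?subrr ?mul0r//.
      by move: h; rewrite exprS; have := exprn_gt0 k (@ltr0n R 2); nra.
    rewrite (eta_gt _ h)// eta_gt ?subrr ?mul0r//.
    by move: h; rewrite exprS; have := exprn_gt0 k (@ltr0n R 2); nra.
  by rewrite derive1n0 zfac_supp ?mul0r.
rewrite indicE mem_set// mulr1; apply: prod_le_expn => j.
rewrite /zfac; case: ifP => _; first by rewrite (le_trans (HC _ _))// lerDr.
case: ifP => _; last by rewrite (le_trans (HC _ _))// lerDl.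
by rewrite (le_trans (ler_normB _ _))// lerD.
Qed.

Lemma measurable_dzker k i y : measurable_fun setT (dzker k i y).
Proof.
apply: measurable_prod => j _.
apply: (@measurableT_comp _ _ _ _ _ _ (zfac l k i (fun t => eta l k t - eta l k.+1 t) j)); last first.
  by apply: measurable_funB => //; exact: rV_coord_meas.
rewrite /zfac; case: ifP => _; first exact: measurable_eta.
by case: ifP => _; [apply: measurable_funB|]; exact: measurable_eta.
Qed.

Lemma smooth1_zfac k (i j : 'I_d2) : smooth1 (zfac l k i (zeta l k) j : R -> R).
Proof.
by rewrite /zfac; case: ifP => _; [|case: ifP => _]; [exact: smooth1_eta|exact: smooth1_zeta|exact: smooth1_eta].
Qed.

Lemma measurable_muE_ker (th : 'rV[R]_d1 -> R) (K : 'rV[R]_d2 -> R) :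
  measurable_fun setT th -> measurable_fun setT K ->
  measurable_fun [set: E] (fun z => th z.1 * K z.2).
Proof.
move=> mth mK; apply: measurable_funM.
  exact: (measurableT_comp mth measurable_fst).
exact: (measurableT_comp mK measurable_snd).
Qed.

Lemma mu_box_lty (a b : 'I_d1 -> R) k y :
  (mu (box (@rV_coord R d1) a b `*` kbox k y) < +oo)%E.
Proof.
rewrite product_measure1E//; last 2 first.
- by apply: measurable_box; exact: rV_coord_meas.
- exact: measurable_kbox.
rewrite lte_mul_pinfty// ?ge0_fin_numE ?lebesgue_box_lty//.
exact: le_lt_trans (lebesgue_kbox _ _) (ltry _).
Qed.

Lemma integrable_ker (w : E -> R) (th : 'rV[R]_d1 -> R) (K : 'rV[R]_d2 -> R) a b k y C :
  in_Lp mu p w -> measurable_fun setT th -> measurable_fun setT K ->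
  (forall x, `|th x| <= \1_(box (@rV_coord R d1) a b) x) ->
  (forall u, `|K u| <= C * \1_(kbox k y) u) ->
  mu.-integrable setT (fun z => (w z * (th z.1 * K z.2))%:E).
Proof.
move=> Lw mth mK thb KC.
have mA : measurable (box (@rV_coord R d1) a b).
  by apply: measurable_box; exact: rV_coord_meas.
apply: (Lp_integrable_ker p1 (C := C) Lw (measurableX mA (measurable_kbox k y))).
- exact: mu_box_lty.
- exact: measurable_muE_ker.
- move=> [x u] /=; rewrite normrM (_ : \1_(_ `*` _) (x, u) =
    \1_(box (@rV_coord R d1) a b) x * \1_(kbox k y) u :> R).
    by rewrite mulrCA ler_pM.
  rewrite !indicE -natrM mulnb; congr (nat_of_bool _)%:R.
  by rewrite in_setX.
Qed.

(** The defect of the telescoping identity at y. Its integral in u has to vanish for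
    almost every x. *)
Definition rem_kernel k y (z : E) : R :=
  v0 z * (kap l k y z.2 - kap l k.+1 y z.2) - \sum_i v i z * zker l k i y z.2.

Lemma kap_diff_bound k : exists C : R, forall y u : 'rV[R]_d2,
  `|kap l k y u - kap l k.+1 y u| <= C * \1_(kbox k y) u.
Proof.
have [C C0 HC] := @kap_bound R l d2 l0.
exists (C * (2 ^+ k) ^+ d2 + C * (2 ^+ k.+1) ^+ d2) => y u.
have [uk|uk] := pselect (kbox k y u); last first.
  by rewrite kap_supp// kap_supp1// subrr normr0 indicE memNset// mulr0.
rewrite indicE mem_set// mulr1 (le_trans (ler_normB _ _))// lerD//.
  apply: (le_trans (HC k y u)); rewrite ler_piMr ?mulr_ge0 ?exprn_ge0//.
apply: (le_trans (HC k.+1 y u)); rewrite ler_piMr ?mulr_ge0 ?exprn_ge0//.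
Qed.

Lemma rem_integrable k y a b (th : 'rV[R]_d1 -> R) :
  measurable_fun setT th -> (forall x, `|th x| <= \1_(box (@rV_coord R d1) a b) x) ->
  [/\ mu.-integrable setT (fun z =>
        (v0 z * (th z.1 * (kap l k y z.2 - kap l k.+1 y z.2)))%:E),
      forall i, mu.-integrable setT (fun z => (v i z * (th z.1 * zker l k i y z.2))%:E) &
      mu.-integrable setT (fun z => (th z.1 * rem_kernel k y z)%:E)].
Proof.
move=> mth thb.
have [C HC] := kap_diff_bound k.
have i1 : mu.-integrable setT (fun z =>
        (v0 z * (th z.1 * (kap l k y z.2 - kap l k.+1 y z.2)))%:E).
  apply: (integrable_ker Lv0 mth _ thb (HC y)).
  by apply: measurable_funB; exact: measurable_kap2.
have [D D0 HD] := @zker_bound R l d2 l0.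
have i2 i : mu.-integrable setT (fun z => (v i z * (th z.1 * zker l k i y z.2))%:E).
  apply: (integrable_ker (Lv i) mth _ thb (HD k i y)).
  exact: measurable_zker.
split => //.
have := integrableB measurableT i1 (integrable_sum measurableT (index_enum _) (fun i _ => i2 i)).
move=> H; apply: (eq_integrable measurableT _ _ _ (H xpredT)) => z _.
rewrite sumEFin -EFinB; congr EFin; rewrite /rem_kernel [RHS]mulrBr.
congr (_ - _); first by rewrite mulrCA.
by rewrite mulr_sumr; apply: eq_bigr => i _; rewrite mulrCA.
Qed.

(** Testing the weak derivative on a cut-off in x times [zker] in the other variable
    cancels the defect on average. *)
Lemma rem_weak k y a b m (e : R) : room k y -> (forall i, a i < b i) ->
  0 < e -> 2 <= m%:R * e -> fat_in (@rV_coord R d1) Omega1 a b e ->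
  (\int[mu]_z (cutoff a b m z.1 * rem_kernel k y z)%:E = 0)%E.
Proof.
move=> Oy ab e0 me fab.
have mth := measurable_cutoff a b m (@rV_coord_meas R d1).
have thb x : `|cutoff a b m x| <= \1_(box (@rV_coord R d1) (fun i => a i - e) (fun i => b i + e)) x.
  rewrite indicE; have [xb|xb] := pselect (box (@rV_coord R d1) (fun i => a i - e) (fun i => b i + e) x).
    by rewrite mem_set// cutoff_le1.
  by rewrite memNset// (cutoff_supp ab me e0 xb) normr0.
have [i1 i2 _] := rem_integrable k y mth thb.
have i3 i : mu.-integrable setT (fun z => (v0 z * (cutoff a b m z.1 * dzker k i y z.2))%:E).
  have [C HC] := dzker_bound k.
  exact: (integrable_ker Lv0 mth (measurable_dzker k i y) thb (HC i y)).
have wk i : (\int[mu]_z (v0 z * (cutoff a b m z.1 * dzker k i y z.2))%:E =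
             \int[mu]_z (v i z * (cutoff a b m z.1 * zker l k i y z.2))%:E)%E.
  pose g (c : coord) : R -> R := match c with
    | inl i => cutoff1 (a i) (b i) m
    | inr j => fun t => zfac l k i (zeta l k) j (-1 * t + rV_coord j y) end.
  have sg c : smooth1 (g c).
    case: c => j; first exact: smooth1_cutoff1.
    exact/smooth1_aff/smooth1_zfac.
  pose lo (c : coord) : R := match c with inl i => a i - e
    | inr j => rV_coord j y - 2 / 2 ^+ k end.
  pose hi (c : coord) : R := match c with inl i => b i
    | inr j => rV_coord j y - 2^-1 / 2 ^+ k end.
  have gsupp c t : ~~ (lo c <= t <= hi c) -> g c t = 0.
    case: c => j; first exact: cutoff1_supp.
    rewrite /lo /hi => H; rewrite /g zfac_supp// mulN1r addrC => -[h1 h2].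
    move/negP: H; apply.
    have k0 : 0 < (2 : R) ^+ k by rewrite exprn_gt0.
    move: h1; rewrite exprS => h1.
    rewrite lerBlDr -lerBlDl ler_pdivlMr// lerBrDr -lerBrDl ler_pdivrMr//.
    by apply/andP; split; nra.
  have sub : cbox lo hi `<=` Omega1 `*` Omega2.
    move=> z zb; split.
      apply: fab => j; have := zb (inl j); rewrite /= => /andP[-> h]/=.
      by rewrite (le_trans h)// lerDl ltW.
    apply: (room_kbox Oy) => j; rewrite /= in_itv/=.
    exact: (zb (inr j)).
  have := weak i sg gsupp sub.
  have E1 z : tens g z = cutoff a b m z.1 * zker l k i y z.2.
    rewrite /tens big_sumType; congr (_ * _).
    by apply: eq_bigr => j _; rewrite /= mulN1r addrC.
  have E2 z : tens (fun c => (g c)^`(single (inr i) l c)%classic) z =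
      (-1) ^+ l * (cutoff a b m z.1 * dzker k i y z.2).
    rewrite /tens big_sumType mulrCA; congr (_ * _).
    rewrite (eq_bigr (fun j => (-1) ^+ (if j == i then l else 0%N) *
        zfac l k i (fun t => eta l k t - eta l k.+1 t) j (rV_coord j y - rV_coord j z.2))).
      rewrite big_split/=; congr (_ * _).
      by rewrite (bigD1 i)//= eqxx big1 ?mulr1// => j /negbTE ->.
    move=> j _; rewrite derive1n_aff; last exact: smooth1_zfac.
    by rewrite dzfacE single_inr mulN1r [- _ + _]addrC.
  under eq_Rintegral do rewrite E2 mulrCA.
  under [in X in _ = _ * X -> _]eq_Rintegral do rewrite E1.
  rewrite (RintegralZl _ measurableT (i3 i)) => W.
  have W' : \int[mu]_z (v0 z * (cutoff a b m z.1 * dzker k i y z.2)) =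
            \int[mu]_z (v i z * (cutoff a b m z.1 * zker l k i y z.2)).
    by apply: (mulfI _ W); rewrite expf_neq0// oppr_eq0 oner_eq0.
  have := congr1 EFin W'; rewrite /Rintegral !fineK//.
    exact: integrable_fin_num (i2 i).
  exact: integrable_fin_num (i3 i).
rewrite (_ : (fun z => _) = fun z => (\sum_i ((v0 z * (cutoff a b m z.1 * dzker k i y z.2))%:E
    - (v i z * (cutoff a b m z.1 * zker l k i y z.2))%:E))%E); last first.
  apply/funext => z; under [RHS]eq_bigr do rewrite -EFinB.
  rewrite sumEFin; congr EFin.
  rewrite big_split/= sumrN /rem_kernel -kap_telescope [LHS]mulrBr.
  congr (_ - _); first by rewrite mulrCA !mulr_sumr.
  by rewrite mulr_sumr; apply: eq_bigr => i _; rewrite mulrCA.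
rewrite (integral_sum measurableT (fun i => integrableB measurableT (i3 i) (i2 i))).
rewrite big1// => i _; rewrite integralB// wk subee//.
exact: integrable_fin_num (i2 i).
Qed.

Lemma rem_box k y a b (e : R) : room k y -> (forall i, a i < b i) ->
  0 < e -> fat_in (@rV_coord R d1) Omega1 a b e ->
  (\int[mu]_z (\1_(box (@rV_coord R d1) a b) z.1 * rem_kernel k y z)%:E = 0)%E.
Proof.
move=> Oy ab e0 fab.
pose A' := box (@rV_coord R d1) (fun i => a i - e) (fun i => b i + e).
have mA (a' b' : 'I_d1 -> R) : measurable (box (@rV_coord R d1) a' b').
  by apply: measurable_box; exact: rV_coord_meas.
have ind1 a' b' (x : 'rV[R]_d1) : `|\1_(box (@rV_coord R d1) a' b') x : R| <=
    \1_(box (@rV_coord R d1) a' b') x by rewrite ger0_norm.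
have mind a' b' : measurable_fun setT (\1_(box (@rV_coord R d1) a' b') : _ -> R).
  exact: measurable_indic.
have [_ _ iA'] := rem_integrable k y (mind _ _) (ind1 (fun i => a i - e) (fun i => b i + e)).
have [_ _ iA] := rem_integrable k y (mind _ _) (ind1 a b).
have [n Hn] : exists n : nat, 2 <= n%:R * e.
  exists (Num.trunc (2 / e)).+1; rewrite -ler_pdivrMr//.
  by rewrite ltW// truncnS_gt.
have fm m : 2 <= (m + n)%:R * e.
  by rewrite (le_trans Hn)// ler_pM2r// ler_nat leq_addl.
have cb m x : `|cutoff a b (m + n) x| <= \1_A' x.
  rewrite indicE; have [xb|xb] := pselect (A' x).
    by rewrite mem_set// cutoff_le1.
  by rewrite memNset// (cutoff_supp ab (fm m) e0 xb) normr0.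
pose f_ m z := (cutoff a b (m + n) z.1 * rem_kernel k y z)%:E.
have := @dominated_convergence _ _ _ mu setT measurableT f_
  (fun z => (\1_(box (@rV_coord R d1) a b) z.1 * rem_kernel k y z)%:E)
  (fun z => `|(\1_A' z.1 * rem_kernel k y z)%:E|%E).
have mf m : measurable_fun setT (f_ m).
  have [_ _ H] := rem_integrable k y (measurable_cutoff a b (m + n) (@rV_coord_meas R d1)) (cb m).
  exact: measurable_int H.
case => //.
- exact: measurable_int iA.
- apply: aeW => z _; apply/fine_cvgP; split; first exact: nearW.
  apply: cvgM; last exact: cvg_cst.
  by rewrite (cvg_shiftn n (fun m => cutoff a b m z.1)); exact: cutoff_cvg.
- exact: integrable_abse iA'.
- apply: aeW => z m _; rewrite /f_ /= lee_fin !normrM ler_wpM2r//.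
  by rewrite (le_trans (cb m _))// ler_norm.
move=> _ _; rewrite (_ : (fun m => _) = fun=> 0%E).
  by move/cvg_lim => <-//; rewrite lim_cst.
by apply/funext => m; apply: (rem_weak Oy ab e0 (fm m) fab).
Qed.

(** The exceptional set depends on k and y; countably many y will suffice. *)
Lemma rem_ae k y : room k y ->
  {ae leb1, forall x, Omega1 x -> \int[leb2]_u rem_kernel k y (x, u) = 0}.
Proof.
move=> Oy.
apply: (box_null_ae (@rV_coord_meas R d1) (@rV_coord_gen R d1) (rV_coord_open open1)).
move=> a b e e0 ab fab.
have mA : measurable (box (@rV_coord R d1) a b).
  by apply: measurable_box; exact: rV_coord_meas.
have ind1 (x : 'rV[R]_d1) : `|\1_(box (@rV_coord R d1) a b) x : R| <=
    \1_(box (@rV_coord R d1) a b) x by rewrite ger0_norm.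
have [_ _ iA] := rem_integrable k y (measurable_indic mA : measurable_fun setT (\1_(box (@rV_coord R d1) a b) : _ -> R)) ind1.
have FE : fubini_F leb2 (fun z => (\1_(box (@rV_coord R d1) a b) z.1 * rem_kernel k y z)%:E) =
    (fun x => (\int[leb2]_u (rem_kernel k y (x, u))%:E)%E) \_ (box (@rV_coord R d1) a b).
  apply/funext => x; rewrite /fubini_F patchE /= indicE.
  case: ifP => _; last by under eq_integral do rewrite mul0r; rewrite integral0.
  by under eq_integral do rewrite mul1r.
have := integrable_fubini_F iA; rewrite FE => iF.
have := integral12_prod_meas1 iA; rewrite FE (rem_box Oy ab e0 fab).
rewrite -integral_mkcond => F0.
have iF' : leb1.-integrable (box (@rV_coord R d1) a b) (fun x => (\int[leb2]_u (rem_kernel k y (x, u))%:E)%E).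
  by apply/integrable_mkcond.
have aeF : ae_eq leb1 (box (@rV_coord R d1) a b)
   (EFin \o (fun x => \int[leb2]_u rem_kernel k y (x, u)))
   (fun x => (\int[leb2]_u (rem_kernel k y (x, u))%:E)%E).
  by have := integrable_ae mA iF'; apply: filterS => x H Ax; rewrite /= /Rintegral fineK// H.
have mF : measurable_fun (box (@rV_coord R d1) a b)
    (EFin \o (fun x => \int[leb2]_u rem_kernel k y (x, u))).
  apply/measurable_EFinP; apply: (measurableT_comp (fine_measurable measurableT)) => //.
  exact: measurable_int iF'.
split.
  apply/integrableP; split => //.
  rewrite (@ae_eq_integral _ _ _ _ _ (fun x => `|\int[leb2]_u (rem_kernel k y (x, u))%:E|%E))//.
  - by case/integrableP: iF'.
  - exact: measurableT_comp.
  - by apply: measurableT_comp => //; exact: measurable_int iF'.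
  - by apply: filterS aeF => x H Ax; rewrite H.
rewrite (@ae_eq_integral _ _ _ _ _ (fun x => (\int[leb2]_u (rem_kernel k y (x, u))%:E)%E))//.
exact: measurable_int iF'.
Qed.

End weak_telescoping.

(** * Mollification of one slice *)

Section one_variable.
Local Open Scope classical_set_scope.
Context {R : realType} {d : nat}.
Local Notation leb := (@lebesgue_rV R d).
Variables (Omega : set 'rV[R]_d) (p : R) (l : nat).
Hypotheses (p1 : 1 <= p) (l0 : (0 < l)%N).
Hypothesis pl : (d%:R < p * l%:R) \/ (p = 1 /\ l = d).
Implicit Types (u : 'I_d -> 'rV[R]_d -> R) (w : 'rV[R]_d -> R).

Local Notation Lp u := (in_Lp leb p u).
Local Notation "`||[ u ]||" := (\int[leb]_z (`|u z| `^ p)%:E)%E (at level 0).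
Local Notation room := (room Omega).

Definition smoothed k w y : R := \int[leb]_z (w z * kap l k y z).

Definition qpt (q : 'rV[rat]_d) : 'rV[R]_d := map_mx ratr q.

Lemma qpt_dense y (e : R) : 0 < e ->
  exists q, forall j, `|rV_coord j (qpt q) - rV_coord j y| < e.
Proof.
move=> e0.
have /choice[q Hq] : forall j : 'I_d, exists r : rat, `|ratr r - rV_coord j y| < e.
  move=> j; have [r] := @rat_in_itvoo R (rV_coord j y - e) (rV_coord j y + e) (ltac:(lra)).
  by rewrite in_itv/= => /andP[r1 r2]; exists r; rewrite ltr_norml; apply/andP; split; lra.
by exists (\row_j q j) => j; rewrite /rV_coord /qpt !mxE.
Qed.

Lemma room_step k y y' : room k y ->
  (forall j, `|rV_coord j y' - rV_coord j y| <= 2 / 2 ^+ k.+1) -> room k.+1 y'.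
Proof.
move=> Hy yy' z zy'; apply: Hy => j.
apply: (le_trans (ler_distD (rV_coord j y') _ _)).
apply: (le_trans (lerD (zy' j) (yy' j))).
have n0 : (2 : R) ^+ k != 0 by rewrite expf_neq0.
by rewrite exprS le_eqVlt; apply/orP; left; apply/eqP; field.
Qed.

Lemma room_le k m y : (k <= m)%N -> room k y -> room m y.
Proof.
move=> km; rewrite -(subnKC km); elim: (m - k)%N => [|n IH]; first by rewrite addn0.
move=> /IH H; rewrite addnS; apply: (room_step H) => j.
by rewrite subrr normr0 divr_ge0 ?exprn_ge0.
Qed.

Lemma open_room y : open Omega -> Omega y -> exists k, room k y.
Proof.
move=> oO Oy; have [e e0 He] := rV_coord_open oO Oy.
have [k ke] := exp2_small (divr_gt0 e0 (ltr0n R 2)).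
exists k => z zy; apply: He => j; apply: (le_trans (zy j)).
lra.
Qed.

Lemma kbox_lty k (y : 'rV[R]_d) : (leb (kbox k y) < +oo)%E.
Proof. exact: le_lt_trans (lebesgue_kbox _ _) (ltry _). Qed.

(** Like [pot_sum], a bound with an arbitrarily small additive constant. *)
Lemma smoothed_le k (tau : R) : 0 < tau -> exists2 Lam : R, 0 <= Lam &
  forall w y, Lp w -> (`|smoothed k w y|%:E <= tau%:E + Lam%:E * `||[w]||)%E.
Proof.
move=> tau0; have [C C0 HC] := @kap_bound R l d l0.
pose A := C * (2 ^+ k) ^+ d.
have A0 : 0 <= A by rewrite mulr_ge0 ?exprn_ge0.
pose B : R := (2 / 2 ^+ k) ^+ d.
have B0 : 0 <= B by rewrite exprn_ge0// divr_ge0// exprn_ge0.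
pose s := tau / (A * B + 1).
have AB : 0 < A * B + 1 by rewrite ltr_wpDl// mulr_ge0.
have s0 : 0 < s by rewrite divr_gt0.
have c0 : 0 <= s / s `^ p by rewrite divr_ge0 ?powR_ge0 ?(ltW s0).
exists (A * (s / s `^ p)); first by rewrite mulr_ge0.
move=> w y Lu; have mu0 := Lu.1.
apply: (le_trans (Lp_Rintegral_ker_le p1 Lu (measurable_kbox k y) (kbox_lty k y)
   (measurable_kap2 l k y) A0 (HC k y))).
have H := kbox_integral_le p1 k y s0 (fun z => normr_ge0 (w z))
  (measurableT_comp (@normr_measurable R setT) mu0).
apply: (le_trans (lee_wpmul2l _ H)); first by rewrite lee_fin.
have I0 : (0 <= `||[w]||)%E by apply: integral_ge0 => z _; rewrite lee_fin powR_ge0.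
rewrite ge0_muleDr; last 2 first.
- by rewrite lee_fin mulr_ge0// ltW.
- by rewrite mule_ge0.
rewrite muleA -!EFinM leeD2r// lee_fin /s mulrCA mulrAC ler_pdivrMr//.
by rewrite ler_pM2l// lerDl.
Qed.

Lemma smoothed_lipschitz k : exists2 L : R, 0 <= L &
  forall w y z, Lp w -> (`|smoothed k w y - smoothed k w z|%:E <=
    (L * \sum_j `|rV_coord j y - rV_coord j z|)%:E * (1 + `||[w]||))%E.
Proof.
have [C C0 HC] := @kap_lipschitz R l d l0 k.
have [D D0 HD] := @kap_bound R l d l0.
pose B : R := (2 / 2 ^+ k) ^+ d.
have B0 : 0 <= B by rewrite exprn_ge0// divr_ge0// exprn_ge0.
exists (C * 2 * (2 * B + 1)); first by rewrite !mulr_ge0// addr_ge0// mulr_ge0.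
move=> w y z Lu; have mu0 := Lu.1.
have iy := Lp_integrable_ker p1 Lu (measurable_kbox k y) (kbox_lty k y)
   (measurable_kap2 l k y) (HD k y).
have iz := Lp_integrable_ker p1 Lu (measurable_kbox k z) (kbox_lty k z)
   (measurable_kap2 l k z) (HD k z).
rewrite /smoothed -RintegralB//.
under eq_Rintegral do rewrite -mulrBr.
set S := \sum_j _; have S0 : 0 <= S by apply: sumr_ge0.
have bU : forall t, `|kap l k y t - kap l k z t| <= (C * S * 2) * \1_(kbox k y `|` kbox k z) t.
  move=> t; apply: (le_trans (HC y z t)); rewrite -[leRHS]mulrA ler_wpM2l ?(mulr_ge0 C0 S0)//.
  rewrite !indicE in_setU; case: (t \in kbox k y); case: (t \in kbox k z) => /=; lra.
have mU : measurable (kbox k y `|` kbox k z) by apply: measurableU; exact: measurable_kbox.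
have U2 : (leb (kbox k y `|` kbox k z) <= (2 * B)%:E)%E.
  apply: le_trans (measureU2 _ _ _) _; [exact: measurable_kbox|exact: measurable_kbox|].
  rewrite mulr2n mulrDl mul1r EFinD; apply: leeD; exact: lebesgue_kbox.
have CS0 : 0 <= C * S * 2 by rewrite !mulr_ge0.
have mk : measurable_fun setT (fun t => kap l k y t - kap l k z t).
  by apply: measurable_funB; exact: measurable_kap2.
apply: (le_trans (Lp_Rintegral_ker_le p1 Lu mU (le_lt_trans U2 (ltry _)) mk CS0 bU)).
have I0 : (0 <= `||[w]||)%E by apply: integral_ge0 => t _; rewrite lee_fin powR_ge0.
apply: (@le_trans _ _ ((C * S * 2)%:E * ((2 * B + 1)%:E * (1 + `||[w]||)))%E).
  apply: lee_wpmul2l; first by rewrite lee_fin.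
  apply: (le_trans (Lp_integral_le p1 Lu mU)).
  rewrite EFinD ge0_muleDl ?lee_fin ?mulr_ge0//
    ge0_muleDr ?lee_fin ?mulr_ge0// mule1 mul1e.
  rewrite -addeA; apply: leeD => //.
  rewrite addeA; apply: leeDr; rewrite adde_ge0// mule_ge0// lee_fin mulr_ge0//.
by rewrite muleA -EFinM (_ : C * S * 2 * (2 * B + 1) = C * 2 * (2 * B + 1) * S)//; ring.
Qed.

End one_variable.

(** * Oscillation of the mollifications *)

Lemma dist_via {R : realDomainType} (a b c d r s t : R) : `|a - c| <= r ->
  `|c - d| <= s -> `|b - d| <= t -> `|a - b| <= r + s + t.
Proof.
by rewrite !ler_norml => /andP[? ?] /andP[? ?] /andP[? ?]; apply/andP; split; lra.
Qed.

Section tails.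
Local Open Scope classical_set_scope.
Context {R : realType} dd (T : measurableType dd) (mu : {measure set T -> \bar R}).
Variables (p : R) (n : nat).
Hypothesis p1 : 1 <= p.

Lemma measurable_tail_fun (v : T -> R) (N : R) : measurable_fun setT v ->
  measurable_fun setT (fun z => (`|v z| * (N < `|v z|)%R%:R) `^ p).
Proof.
move=> mv; apply: (measurableT_comp (measurable_powR p)).
by apply: (@measurable_above _ _ _ (fun z => `|v z|)); exact: measurableT_comp.
Qed.

Lemma Lp_tail_cvg (v : T -> R) : in_Lp mu p v ->
  (\int[mu]_z ((`|v z| * (N%:R < `|v z|)%R%:R) `^ p)%:E)%E @[N --> \oo] --> 0%E.
Proof.
move=> [mv vp].
have p0 : p != 0 by rewrite gt_eqF// (lt_le_trans ltr01).
have mf N : measurable_fun setT (fun z => ((`|v z| * (N%:R < `|v z|)%R%:R) `^ p)%:E).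
  by apply/measurable_EFinP; exact: measurable_tail_fun.
have H := @dominated_convergence _ _ _ mu setT measurableT
  (fun N z => ((`|v z| * (N%:R < `|v z|)%R%:R) `^ p)%:E) (cst 0%E)
  (fun z => (`|v z| `^ p)%:E) mf (measurable_cst _).
have [] := H.
- apply: aeW => z _; apply: cvg_near_cst.
  exists (Num.trunc `|v z|).+1 => // N /= hN.
  rewrite ltNge (_ : `|v z| <= N%:R) ?mulr0 ?powR0//.
  by rewrite (le_trans (ltW (truncnS_gt _)))// ler_nat.
- apply/integrableP; split; first by apply/measurable_EFinP; exact: measurable_normpow.
  by under eq_integral do rewrite /= ger0_norm ?powR_ge0//.
- apply: aeW => z N _; rewrite /= lee_fin ger0_norm ?powR_ge0//.
  rewrite ge0_ler_powR ?nnegrE ?mulr_ge0//; first exact: le_trans p1.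
  by case: (_ < _); rewrite ?mulr1 ?mulr0.
by rewrite integral0.
Qed.

(** The p-energy above the height N. The part below N is negligible in late
    generations, by [pot_tail]. *)
Definition tail (u : 'I_n -> T -> R) (N : R) : \bar R :=
  (\sum_i \int[mu]_z ((`|u i z| * (N < `|u i z|)%R%:R) `^ p)%:E)%E.

Lemma tail_ge0 u N : (0 <= tail u N)%E.
Proof. by apply: sume_ge0 => i _; apply: integral_ge0 => z _; rewrite lee_fin powR_ge0. Qed.

Lemma tail_small u (e : R) : (forall i, in_Lp mu p (u i)) -> 0 < e ->
  exists N : nat, (tail u N%:R <= e%:E)%E.
Proof.
move=> Lu e0; have tail0 : tail u N%:R @[N --> \oo] --> 0%E.
  rewrite /tail; elim: (index_enum _) => [|i s IH].
    by under eq_fun do rewrite big_nil; exact: cvg_cst.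
  under eq_fun do rewrite big_cons.
  by have := cvgeD _ (Lp_tail_cvg (Lu i)) IH; rewrite adde0; apply.
have /fine_cvgP[fin_t /cvgr0Pnorm_lt/(_ _ e0) t0] := tail0.
have [N [/= hN1 hN2]] := filter_ex (filterI fin_t t0).
by exists N; rewrite -(fineK hN1) lee_fin (le_trans (ler_norm _))// ltW.
Qed.

End tails.

Section oscillation.
Local Open Scope classical_set_scope.
Context {R : realType} {d : nat}.
Local Notation leb := (@lebesgue_rV R d).
Variables (Omega : set 'rV[R]_d) (p : R) (l : nat).
Hypotheses (p1 : 1 <= p) (l0 : (0 < l)%N).
Hypothesis pl : (d%:R < p * l%:R) \/ (p = 1 /\ l = d).
Implicit Types (u : 'I_d -> 'rV[R]_d -> R) (w : 'rV[R]_d -> R).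

Local Notation Lp u := (in_Lp leb p u).
Local Notation room := (room Omega).
Local Notation f := (smoothed l).
Local Notation tail := (tail leb p).

(** The identity is required at rational points only, so that it consists of countably
    many conditions and holds on almost every slice. *)
Definition telescopes w u := forall k q, room k (qpt q) ->
  \int[leb]_z (w z * (kap l k (qpt q) z - kap l k.+1 (qpt q) z) -
     \sum_i u i z * zker l k i (qpt q) z) = 0.

Definition slice_data w u := [/\ Lp w, forall i, Lp (u i) & telescopes w u].

(** The telescoping identity turns the increment into integrals of the derivatives
    against [zker], which the potentials dominate. *)
Lemma increment_le : exists2 C : R, 0 <= C & forall w u, slice_data w u ->
  forall k q, room k (qpt q) ->
  (`|f k w (qpt q) - f k.+1 w (qpt q)|%:E <=
    C%:E * \sum_i pot l k (qpt q) (fun z => `|u i z|%R))%E.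
Proof.
have [C C0 HC] := @zker_bound R l d l0.
have [D D0 HD] := @kap_bound R l d l0.
exists C => // w u [Lw Lu tel] k q rq; set y := qpt q in rq *.
have iw j := Lp_integrable_ker p1 Lw (measurable_kbox j y) (kbox_lty j y)
   (measurable_kap2 l j y) (HD j y).
have iu i := Lp_integrable_ker p1 (Lu i) (measurable_kbox k y) (kbox_lty k y)
   (measurable_zker l k i y) (HC k i y).
have E : f k w y - f k.+1 w y = \sum_i \int[leb]_z (u i z * zker l k i y z).
  have /eqP := tel k q rq; rewrite -/y.
  have iB : leb.-integrable setT (EFin \o (fun z => w z * (kap l k y z - kap l k.+1 y z))).
    have := integrableB measurableT (iw k) (iw k.+1).
    by move=> H; apply: (eq_integrable measurableT _ _ _ H) => z _; rewrite /= mulrBr EFinB.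
  have iS : leb.-integrable setT (EFin \o (fun z => \sum_i u i z * zker l k i y z)).
    have H := integrable_sum measurableT (index_enum 'I_d) (fun i _ => iu i).
    by apply: (eq_integrable measurableT _ _ _ (H xpredT)) => z _; rewrite /= sumEFin.
  rewrite RintegralB// subr_eq0 => /eqP.
  under eq_Rintegral do rewrite mulrBr.
  rewrite (RintegralB measurableT (iw k) (iw k.+1)) => ->.
  apply: EFin_inj; rewrite -sumEFin.
  rewrite /Rintegral fineK; last exact: integrable_fin_num iS.
  under eq_integral do rewrite -sumEFin.
  rewrite (integral_sum measurableT iu); apply: eq_bigr => i _.
  by rewrite fineK//; exact: integrable_fin_num (iu i).
rewrite E; apply: (@le_trans _ _ (\sum_i `|\int[leb]_z (u i z * zker l k i y z)|%:E)%E).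
  by rewrite sumEFin lee_fin ler_norm_sum.
rewrite ge0_sume_distrr; last first.
  by move=> i _; exact: pot_ge0.
apply: lee_sum => i _.
have c0 : 0 <= (2 ^+ k : R) ^+ d / (2 ^+ k) ^+ l by rewrite divr_ge0 ?exprn_ge0.
apply: (le_trans (Lp_Rintegral_ker_le p1 (Lu i) (measurable_kbox k y) (kbox_lty k y)
   (measurable_zker l k i y) (mulr_ge0 C0 c0) (HC k i y))).
by rewrite /pot EFinM muleA.
Qed.

Lemma increments_le : exists2 C : R, 0 <= C & forall w u, slice_data w u ->
  forall n m q, (n <= m)%N -> room n (qpt q) ->
  (`|f n w (qpt q) - f m w (qpt q)|%:E <=
    C%:E * \sum_i \sum_(n <= k < m) pot l k (qpt q) (fun z => `|u i z|%R))%E.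
Proof.
have [C C0 HC] := increment_le; exists C => // w u A n m q nm rq.
have pot0 k i : (0 <= pot l k (qpt q) (fun z => `|u i z|%R))%E.
  exact: pot_ge0.
rewrite -(subnKC nm); elim: (m - n)%N => [|j IH].
  rewrite addn0 subrr normr0; apply: mule_ge0; rewrite ?lee_fin//.
  by apply: sume_ge0 => i _; apply: sume_ge0.
rewrite addnS.
apply: (@le_trans _ _ (`|f n w (qpt q) - f (n + j)%N w (qpt q)|%:E +
    `|f (n + j)%N w (qpt q) - f (n + j).+1 w (qpt q)|%:E)%E).
  by rewrite -EFinD lee_fin ler_distD.
have rj : room (n + j) (qpt q) by apply: room_le rq; rewrite leq_addr.
apply: (le_trans (leeD IH (HC w u A _ q rj))).
rewrite -ge0_muleDr; first last.
- exact: sume_ge0.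
- by apply: sume_ge0 => i _; exact: sume_ge0.
apply: lee_wpmul2l; first by rewrite lee_fin.
rewrite -big_split/=; apply: lee_sum => i _.
by rewrite big_nat_recr//= leq_addr.
Qed.

Lemma sum_affine_le (C tau : R) : 0 <= C -> 0 < tau -> exists2 s : R, 0 < s &
  forall (Lam : R) (P J : 'I_d -> \bar R), 0 <= Lam -> (forall i, 0 <= J i)%E ->
    (forall i, 0 <= P i)%E ->
    (forall i, P i <= s%:E + Lam%:E * J i)%E ->
    (C%:E * \sum_i P i <= tau%:E + (C * Lam)%:E * \sum_i J i)%E.
Proof.
move=> C0 tau0; have D0 : 0 < C * d%:R + 1 by rewrite ltr_wpDl// mulr_ge0.
exists (tau / (C * d%:R + 1)); first by rewrite divr_gt0.
set s := tau / _; have s0 : 0 < s by rewrite divr_gt0.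
move=> Lam P J L0 J0 P0 PJ.
apply: (@le_trans _ _ (C%:E * \sum_i (s%:E + Lam%:E * J i))%E).
  by apply: lee_wpmul2l; rewrite ?lee_fin//; apply: lee_sum => i _; exact: PJ.
rewrite big_split/= sumEFin sumr_const card_ord -ge0_sume_distrr//.
rewrite ge0_muleDr; first last.
- by rewrite mule_ge0 ?lee_fin// sume_ge0.
- by rewrite lee_fin mulrn_wge0// ltW.
rewrite muleA -!EFinM leeD2r// lee_fin -mulr_natr.
rewrite (_ : C * (s * d%:R) = tau * (C * d%:R / (C * d%:R + 1))); last by rewrite /s; ring.
by rewrite ler_piMr ?(ltW tau0)// ler_pdivrMr// mul1r lerDl.
Qed.

Lemma osc_rat (tau : R) : 0 < tau -> exists2 Lam : R, 0 <= Lam &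
  forall w u, slice_data w u -> forall n m q, (n <= m)%N -> room n (qpt q) ->
  (`|f n w (qpt q) - f m w (qpt q)|%:E <=
    tau%:E + Lam%:E * \sum_i \int[leb]_z (`|u i z| `^ p)%:E)%E.
Proof.
move=> tau0; have [C C0 HC] := increments_le.
have [s s0 Hs] := sum_affine_le C0 tau0.
have [Lam L0 HL] := pot_sum p1 pl l0 s0.
exists (C * Lam); first by rewrite mulr_ge0.
move=> w u A n m q nm rq; apply: (le_trans (HC w u A n m q nm rq)).
apply: Hs => // [i|i|i].
- by apply: integral_ge0 => z _; rewrite lee_fin powR_ge0.
- by apply: sume_ge0 => k _; exact: pot_ge0.
- apply: HL => //; case: A => _ Lu _; apply: measurableT_comp => //; exact: (Lu i).1.
Qed.

Lemma osc_tail_rat (tau : R) : 0 < tau -> exists2 Lam : R, 0 <= Lam &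
  forall N : R, 0 <= N -> exists n0,
  forall w u, slice_data w u -> forall n m q, (n0 <= n)%N -> (n <= m)%N -> room n (qpt q) ->
  (`|f n w (qpt q) - f m w (qpt q)|%:E <= tau%:E + Lam%:E * tail u N)%E.
Proof.
move=> tau0; have [C C0 HC] := increments_le.
have [s s0 Hs] := sum_affine_le C0 tau0.
have [Lam L0 HL] := pot_tail p1 pl l0 s0.
exists (C * Lam); first by rewrite mulr_ge0.
move=> N N0; have [n0 Hn0] := HL N N0; exists n0.
move=> w u A n m q n0n nm rq; apply: (le_trans (HC w u A n m q nm rq)).
apply: Hs => // [i|i|i].
- by apply: integral_ge0 => z _; rewrite lee_fin powR_ge0.
- by apply: sume_ge0 => k _; exact: pot_ge0.
- apply: Hn0 => //; case: A => _ Lu _; apply: measurableT_comp => //; exact: (Lu i).1.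
Qed.

(** The mollifications are continuous in y, and the rational points close to y have
    room in the next generation. *)
Lemma rational_closure w n k m y (b : \bar R) : Lp w -> room n y ->
  (forall q, room n.+1 (qpt q) -> (`|f k w (qpt q) - f m w (qpt q)|%:E <= b)%E) ->
  (`|f k w y - f m w y|%:E <= b)%E.
Proof.
move=> Lw ry H.
have [Lk Lk0 HLk] := @smoothed_lipschitz R d p l p1 l0 k.
have [Lm Lm0 HLm] := @smoothed_lipschitz R d p l p1 l0 m.
have I0 : (0 <= \int[leb]_z (`|w z| `^ p)%:E)%E.
  by apply: integral_ge0 => t _; rewrite lee_fin powR_ge0.
have Ifin : (\int[leb]_z (`|w z| `^ p)%:E)%E \is a fin_num by rewrite ge0_fin_numE//; case: Lw.
set I := (\int[leb]_z _)%E in I0 Ifin *.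
pose M := 1 + fine I; have M0 : 0 < M by rewrite ltr_wpDr// fine_ge0.
have near (e : R) : 0 < e -> exists q, [/\ room n.+1 (qpt q),
    `|f k w y - f k w (qpt q)| <= e & `|f m w y - f m w (qpt q)| <= e].
  move=> e0; pose A := (Lk + Lm) * d%:R * M + 1.
  have A0 : 0 < A by rewrite ltr_wpDl// !mulr_ge0 ?(ltW M0) ?(addr_ge0 Lk0 Lm0).
  (* The first bound keeps room around q, the second one makes both differences small. *)
  pose del := Num.min (2 / 2 ^+ n.+1) (e / A).
  have del0 : 0 < del by rewrite lt_min !divr_gt0 ?exprn_gt0.
  have [q Hq] := qpt_dense y del0; exists q.
  have Hq' j : `|rV_coord j y - rV_coord j (qpt q)| <= e / A.
    by rewrite distrC (le_trans (ltW (Hq j)))// ge_min lexx orbT.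
  have bnd L : 0 <= L -> L <= Lk + Lm ->
      L * (\sum_j `|rV_coord j y - rV_coord j (qpt q)|) * M <= e.
    move=> LL0 LL; apply: (@le_trans _ _ ((Lk + Lm) * (d%:R * (e / A)) * M)).
      rewrite ler_pM2r// ler_pM ?sumr_ge0//.
      apply: (le_trans (ler_sum _ (fun j _ => Hq' j))).
      by rewrite sumr_const card_ord mulr_natl.
    rewrite mulrA [_ * M]mulrAC mulrA ler_pdivrMr// mulrC ler_pM2l//.
    by rewrite /A lerDl.
  split.
  - apply: (room_step ry) => j; apply/ltW/(lt_le_trans (Hq j)).
    by rewrite ge_min lexx.
  - have := HLk w y (qpt q) Lw; rewrite -/I -(fineK Ifin) -EFinD -EFinM lee_fin.
    by move/le_trans; apply; apply: bnd => //; rewrite lerDl.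
  - have := HLm w y (qpt q) Lw; rewrite -/I -(fineK Ifin) -EFinD -EFinM lee_fin.
    by move/le_trans; apply; apply: bnd => //; rewrite lerDr.
case: b H => [b||] H; last 2 first.
- exact: leey.
- by have [q [rq _ _]] := near 1 ltr01; have := H q rq.
rewrite lee_fin; apply/ler_addgt0Pl => e e0.
have [q [rq h1 h2]] := near (e / 2) (divr_gt0 e0 (ltr0n R 2)).
have := H q rq; rewrite lee_fin => h3.
by rewrite [e]splitr addrAC; exact: dist_via h1 h3 h2.
Qed.

Lemma osc_le (tau : R) : 0 < tau -> exists2 Lam : R, 0 <= Lam &
  forall w u, slice_data w u -> forall n k m y, (n < k)%N -> (k <= m)%N -> room n y ->
  (`|f k w y - f m w y|%:E <=
    tau%:E + Lam%:E * \sum_i \int[leb]_z (`|u i z| `^ p)%:E)%E.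
Proof.
move=> /osc_rat[Lam L0 HL]; exists Lam => // w u A n k m y nk km ry.
apply: (rational_closure _ ry); first by case: A.
move=> q rq; apply: HL => //; exact: room_le rq.
Qed.

(** In late generations the energies are replaced by their tails. The starting index
    depends on N but not on the slice, which will give a common rate of convergence. *)
Lemma osc_tail_le (tau : R) : 0 < tau -> exists2 Lam : R, 0 <= Lam &
  forall N : R, 0 <= N -> exists n0,
  forall w u, slice_data w u -> forall n k m y, (n0 <= k)%N -> (n < k)%N ->
  (k <= m)%N -> room n y ->
  (`|f k w y - f m w y|%:E <= tau%:E + Lam%:E * tail u N)%E.
Proof.
move=> /osc_tail_rat[Lam L0 HL]; exists Lam => // N /HL[n0 Hn0]; exists n0.
move=> w u A n k m y n0k nk km ry.
apply: (rational_closure _ ry); first by case: A.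
move=> q rq; apply: Hn0 => //; exact: room_le rq.
Qed.

(** A Cauchy sequence: choose tau small, then N with a small tail. *)
Lemma smoothed_cvg w u n y : slice_data w u -> room n y ->
  cvgn (fun k => f k w y).
Proof.
move=> A ry; apply/cauchy_cvgP; apply: cauchy_exP => e e0.
have e3 : 0 < e / 3 by rewrite divr_gt0.
have [Lam L0 HL] := osc_tail_le e3.
have Lp1 : 0 < e / 3 / (Lam + 1) by rewrite divr_gt0// ltr_wpDl.
have [N hN] := tail_small p1 (let: And3 _ Lu _ := A in Lu) Lp1.
have [n0 Hn0] := HL N%:R (ler0n _ _).
have key k m : (maxn n0 n.+1 <= k)%N -> (k <= m)%N -> `|f k w y - f m w y| < e.
  rewrite geq_max => /andP[n0k nk] km.
  have := Hn0 w u A n k m y n0k nk km ry.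
  move=> H; rewrite -lte_fin; apply: (le_lt_trans H).
  apply: (@le_lt_trans _ _ ((e / 3)%:E + Lam%:E * (e / 3 / (Lam + 1))%:E)%E).
    by rewrite leeD2l// lee_wpmul2l.
  rewrite -EFinM -EFinD lte_fin.
  have : Lam * (e / 3 / (Lam + 1)) <= e / 3.
    rewrite (_ : Lam * _ = e / 3 * (Lam / (Lam + 1))); last by ring.
    by rewrite ler_piMr ?(ltW e3)// ler_pdivrMr ?ltr_wpDl// mul1r lerDl.
  lra.
exists (f (maxn n0 n.+1) w y); exists (maxn n0 n.+1) => // m /= hm.
exact: key.
Unshelve. all: by end_near. Qed.

Lemma smoothed_lim_le w u n y k (b : \bar R) : slice_data w u -> room n y ->
  (forall m, (k <= m)%N -> (`|f k w y - f m w y|%:E <= b)%E) ->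
  (`|f k w y - limn (fun k => f k w y)|%:E <= b)%E.
Proof.
move=> A ry H; have cf := smoothed_cvg A ry.
case: b H => [b||] H; last 2 first.
- exact: leey.
- by have := H k (leqnn k).
rewrite lee_fin.
have : `|f k w y - f m w y| @[m --> \oo] --> `|f k w y - limn (fun k => f k w y)|.
  by apply: cvg_norm; apply: cvgB => //; exact: cvg_cst.
move/cvgr_to_le; apply.
by exists k => // m /= km; have := H m km; rewrite lee_fin.
Qed.

End oscillation.

(** * The limit of the mollifications *)

Section limit_identification.
Local Open Scope classical_set_scope.
Context {R : realType} {d : nat}.
Local Notation leb := (@lebesgue_rV R d).
Variables (p : R) (l : nat).
Hypotheses (p1 : 1 <= p) (l0 : (0 < l)%N).
Local Notation f := (smoothed l).
Local Notation bx := (box (@rV_coord R d)).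

Lemma prim_cvg (a b t : R) : a < b ->
  (prim l k (b - t) - prim l k (a - t)) @[k --> \oo] --> (\1_(`[a, b[%classic) t : R).
Proof.
move=> ab; apply: (@steps_diff_cvg _ (fun k => prim l k)) => // [s s0|k s s0].
  have [n Hn] := exp2_small (divr_gt0 s0 (ltr0n R 3)).
  exists n => // k /= nk; rewrite primE prim0_gt2//.
  have : 2 ^- k <= s / 3.
    by apply: le_trans Hn; rewrite lef_pV2 ?posrE ?exprn_gt0// ler_weXn2l// ler1n.
  rewrite ler_pdivlMr// -ler_pdivlMl ?invr_gt0 ?exprn_gt0// invrK; lra.
rewrite primE prim0_lt1//; apply: le_lt_trans ltr01.
by rewrite mulr_ge0_le0 ?exprn_ge0.
Qed.

(** The integral of [kap k y z] over y in the box, expressed through the primitives. *)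
Definition box_mass (a b : 'I_d -> R) k z : R :=
  \prod_j (prim l k (b j - rV_coord j z) - prim l k (a j - rV_coord j z)).

Lemma box_mass_cvg a b z : (forall j, a j < b j) ->
  box_mass a b k z @[k --> \oo] --> (\1_(bx a b) z : R).
Proof.
move=> ab; apply: (@box_indic_cvg _ _ _ _ _
  (fun k j t => prim l k (b j - t) - prim l k (a j - t))) => j t.
exact: prim_cvg.
Qed.

Lemma box_mass_bound : exists2 C : R, 0 <= C & forall a b k z, `|box_mass a b k z| <= C.
Proof.
have [C C0 HC] := @prim_bounded R l.
exists ((C + C) ^+ d); first by rewrite exprn_ge0 ?addr_ge0.
move=> a b k z; apply: prod_le_expn => j.
by rewrite (le_trans (ler_normB _ _))// lerD.
Qed.

Lemma measurable_box_mass a b k : measurable_fun setT (box_mass a b k).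
Proof.
have cp : continuous (prim l k : R -> R) := derives_continuous (derives_prim l0 k).
have mp : measurable_fun setT (prim l k : R -> R) by exact: continuous_measurable_fun.
apply: measurable_prod => j _; apply: measurable_funB.
  by apply: (measurableT_comp mp); apply: measurable_funB => //; exact: rV_coord_meas.
by apply: (measurableT_comp mp); apply: measurable_funB => //; exact: rV_coord_meas.
Qed.

Lemma kbox_sub (a b : 'I_d -> R) k y : bx a b y ->
  kbox k y `<=` bx (fun j => a j - 2) b.
Proof.
move=> yb z zk j; have := zk j; have /andP[h1 h2] := yb j.
have k1 : 1 <= (2 : R) ^+ k by rewrite exprn_ege1// ler1n.
have k0 : 0 < (2 ^+ k : R)^-1 by rewrite invr_gt0 exprn_gt0.
have k2 : (2 ^+ k : R)^-1 <= 1 by rewrite invf_le1// exprn_gt0.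
by rewrite /= in_itv/= => /andP[h3 h4]; apply/andP; split; lra.
Qed.

Let mbx a b : measurable (bx a b).
Proof. by apply: measurable_box; exact: rV_coord_meas. Qed.

(** Fubini and [integral_kap_box]. The kernels at y only see points below y, at distance
    at most 2 in each coordinate, hence the enlargement of the box on its lower side. *)
Lemma smoothed_box w a b k : in_Lp leb p w -> (forall j, a j < b j) ->
  [/\ measurable_fun (bx a b) (f k w),
      leb.-integrable (bx a b) (EFin \o f k w) &
      (\int[leb]_(y in bx a b) (f k w y)%:E =
        \int[leb]_(z in bx (fun j => a j - 2)%R b) (w z * box_mass a b k z)%:E)%E].
Proof.
move=> Lw ab; pose a' := fun j => a j - 2.
have mw := Lw.1.
have iw : leb.-integrable (bx a' b) (EFin \o w).
  exact: (Lp_integrable p1 Lw (mbx a' b) (lebesgue_box_lty a' b)).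
have iw' : leb.-integrable setT (EFin \o (fun z => \1_(bx a' b) z * w z)).
  move: iw => /(integrable_mkcond _ (mbx a' b)) H.
  apply: (eq_integrable measurableT _ _ _ H) => z _; rewrite patchE /= indicE.
  by case: ifP => _; rewrite ?mul1r ?mul0r.
have i1 : leb.-integrable setT (EFin \o (\1_(bx a b) : _ -> R)).
  apply/integrableP; split; first by apply/measurable_EFinP; exact: measurable_indic.
  under eq_integral do rewrite /= ger0_norm//.
  by rewrite integral_indic// setIT; exact: lebesgue_box_lty.
have [iT _] := integral_tensor2 i1 iw'.
have [C C0 HC] := @kap_bound R l d l0.
pose G (z : 'rV[R]_d * 'rV[R]_d) : \bar R :=
  ((\1_(bx a b) z.1 * (\1_(bx a' b) z.2 * w z.2)) * kap l k z.1 z.2)%:E.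
have iG : (leb \x leb)%E.-integrable setT G.
  apply: (@le_integrable _ _ _ _ _ measurableT _
    (fun z => ((C * (2 ^+ k) ^+ d)%:E * (\1_(bx a b) z.1 * (\1_(bx a' b) z.2 * w z.2))%:E)%E)).
  - apply/measurable_EFinP; apply: measurable_funM; last exact: measurable_kap.
    by apply/measurable_EFinP; exact: measurable_int iT.
  - move=> z _; rewrite /G /= lee_fin normrM [leRHS]normrM mulrC ler_wpM2r//.
    apply: (le_trans (HC k z.1 z.2)); rewrite (ger0_norm (mulr_ge0 C0 _)) ?exprn_ge0//.
    by rewrite ler_piMr ?mulr_ge0 ?exprn_ge0// indicE; case: (_ \in _).
  - exact: integrableZl.
have FE : fubini_F leb G = (fun y => (\int[leb]_z (w z * kap l k y z)%:E)%E) \_ (bx a b).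
  apply/funext => y; rewrite /fubini_F patchE /G /= [\1_(bx a b) y]indicE.
  case: ifPn => [/set_mem yb|_]; last first.
    by under eq_integral do rewrite !mul0r; rewrite integral0.
  apply: eq_integral => z _; rewrite mul1r indicE.
  have [zb|zb] := boolP (z \in bx a' b); first by rewrite mul1r.
  rewrite mul0r mul0r kap_supp ?mulr0// => zk.
  by move/negP: zb; apply; apply/mem_set; exact: (kbox_sub yb zk).
have GE : fubini_G leb G = (fun z => (w z * box_mass a b k z)%:E) \_ (bx a' b).
  apply/funext => z; rewrite /fubini_G patchE /G /= [\1_(bx a' b) z]indicE.
  case: ifPn => _; last first.
    by under eq_integral do rewrite mul0r mulr0 mul0r; rewrite integral0.
  rewrite EFinM -integral_kap_box//; last by move=> j; exact: ltW.
  rewrite [in RHS]integral_mkcond.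
  have ik : leb.-integrable setT ((fun y => (kap l k y z)%:E) \_ (bx a b)).
    have : leb.-integrable (bx a b) (fun y => (kap l k y z)%:E).
      apply: (@le_integrable _ _ _ _ _ (mbx a b) _ (cst (C * (2 ^+ k) ^+ d)%:E)).
      - apply/measurable_EFinP/measurable_funTS.
        exact: (measurableT_comp (measurable_kap l k) (measurable_pair2 z)).
      - move=> y _; rewrite /= lee_fin (ger0_norm (mulr_ge0 C0 _)) ?exprn_ge0//.
        apply: (le_trans (HC k y z)).
        by rewrite ler_piMr ?mulr_ge0 ?exprn_ge0// indicE; case: (_ \in _).
      - apply/integrableP; split; first exact: measurable_cst.
        rewrite /= integral_cst//; apply: lte_mul_pinfty => //.
        exact: lebesgue_box_lty.
    by move=> /integrable_mkcond; apply.
  rewrite -integralZl//; apply: eq_integral => y _; rewrite patchE indicE mul1r.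
  by case: ifP => _; rewrite ?mul1r ?mul0r ?mule0// EFinM.
have iF := integrable_fubini_F iG; rewrite FE in iF.
have ffin y : (\int[leb]_z (w z * kap l k y z)%:E)%E = (f k w y)%:E.
  rewrite /smoothed /Rintegral fineK//; apply: integrable_fin_num => //.
  exact: (Lp_integrable_ker p1 Lw (measurable_kbox k y) (kbox_lty k y)
    (measurable_kap2 l k y) (HC k y)).
have fE : (fun y => (\int[leb]_z (w z * kap l k y z)%:E)%E) = EFin \o f k w.
  by apply/funext => y; exact: ffin.
rewrite fE in iF FE.
have iF' : leb.-integrable (bx a b) (EFin \o f k w) by apply/integrable_mkcond.
split => //; first by apply/measurable_EFinP; exact: measurable_int iF'.
have := integral12_prod_meas1 iG; rewrite -(integral21_prod_meas1 iG) FE GE.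
by rewrite -!integral_mkcond.
Qed.

(** Both sides of [smoothed_box] pass to the limit by dominated convergence, so F and w
    have the same integral over every box with a margin. *)
Lemma smoothed_limit_ae (Omega : set 'rV[R]_d) w (F : 'rV[R]_d -> R) :
  open Omega -> in_Lp leb p w ->
  (forall y, Omega y -> f k w y @[k --> \oo] --> F y) ->
  (forall n, exists C : R, forall k y, (n < k)%N -> room Omega n y -> `|f k w y| <= C) ->
  {ae leb, forall y, Omega y -> F y = w y}.
Proof.
move=> oO Lw fF fb.
have mw := Lw.1.
suff : {ae leb, forall y, Omega y -> F y - w y = 0}.
  by apply: filterS => y H /H/eqP; rewrite subr_eq0 => /eqP.
apply: (box_null_ae (@rV_coord_meas R d) (@rV_coord_gen R d) (rV_coord_open oO)).
move=> a b e e0 ab fab.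
have [n Hn] := exp2_small (divr_gt0 e0 (ltr0n R 2)).
have rn y : bx a b y -> room Omega n y.
  move=> yb z zy; apply: fab => j; have := zy j; have /andP[h1 h2] := yb j.
  rewrite ler_norml => /andP[h3 h4]; apply/andP; split; lra.
have bO y : bx a b y -> Omega y.
  move=> yb; apply: fab => j; have /andP[h1 h2] := yb j; apply/andP; split; lra.
have [C HC] := fb n.
have boo := lebesgue_box_lty a b.
have iC : leb.-integrable (bx a b) (cst C%:E).
  apply/integrableP; split; first exact: measurable_cst.
  by rewrite /= integral_cst//; apply: lte_mul_pinfty.
have mf k : measurable_fun (bx a b) (f k w) by case: (smoothed_box k Lw ab).
have mF : measurable_fun (bx a b) F.
  apply: (@measurable_fun_cvg _ _ _ _ (fun k => f k w)) => //.
  by move=> y yb; exact/fF/bO.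
pose a' := fun j => a j - 2.
have iw : leb.-integrable (bx a' b) (EFin \o w).
  exact: (Lp_integrable p1 Lw (mbx a' b) (lebesgue_box_lty a' b)).
have iwB : leb.-integrable (bx a b) (EFin \o w).
  exact: (Lp_integrable p1 Lw (mbx a b) (lebesgue_box_lty a b)).
have [iF cF] : leb.-integrable (bx a b) (EFin \o F) /\
    (\int[leb]_(y in bx a b) (f (k + n.+1) w y)%:E)%E @[k --> \oo] -->
    (\int[leb]_(y in bx a b) (F y)%:E)%E.
  have := @dominated_convergence _ _ _ leb (bx a b) (mbx a b)
    (fun k y => (f (k + n.+1) w y)%:E) (EFin \o F) (cst C%:E).
  case => //.
  - by move=> k; apply/measurable_EFinP; exact: mf.
  - exact/measurable_EFinP.
  - apply: aeW => y yb; apply/fine_cvgP; split; first exact: nearW.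
    by rewrite (cvg_shiftn n.+1 (fun k => f k w y)); exact/fF/bO.
  - apply: aeW => y k yb; rewrite /= lee_fin; apply: HC; last exact: rn.
    by rewrite addnS ltnS leq_addl.
have [D D0 HD] := box_mass_bound.
have cW : (\int[leb]_(z in bx a' b) (w z * box_mass a b (k + n.+1) z)%:E)%E @[k --> \oo] -->
    (\int[leb]_(z in bx a' b) (w z * \1_(bx a b) z)%:E)%E.
  have := @dominated_convergence _ _ _ leb (bx a' b) (mbx a' b)
    (fun k z => (w z * box_mass a b (k + n.+1) z)%:E)
    (fun z => (w z * \1_(bx a b) z)%:E) (fun z => (D%:E * `|(EFin \o w) z|)%E).
  case => //.
  - move=> k; apply/measurable_EFinP/measurable_funTS.
    by apply: measurable_funM => //; exact: measurable_box_mass.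
  - apply/measurable_EFinP/measurable_funTS.
    by apply: measurable_funM => //; exact: measurable_indic.
  - apply: aeW => z zb; apply/fine_cvgP; split; first exact: nearW.
    apply: cvgM; first exact: cvg_cst.
    by rewrite (cvg_shiftn n.+1 (fun k => box_mass a b k z)); exact: box_mass_cvg.
  - exact/integrableZl/integrable_abse.
  - by apply: aeW => z k zb; rewrite /= -EFinM lee_fin normrM mulrC ler_wpM2r.
have E : (fun k => \int[leb]_(y in bx a b) (f (k + n.+1) w y)%:E)%E =
         (fun k => \int[leb]_(z in bx a' b) (w z * box_mass a b (k + n.+1) z)%:E)%E.
  by apply/funext => k; case: (smoothed_box (k + n.+1) Lw ab).
rewrite -E in cW.
have FW := cvg_unique (@ereal_hausdorff R) cF cW.
have subB : bx a b `<=` bx a' b.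
  move=> z zb j; have /andP[h1 h2] := zb j; rewrite h2 andbT /a'.
  by rewrite (le_trans _ h1)// gerBl.
have WE : (\int[leb]_(z in bx a' b) (w z * \1_(bx a b) z)%:E =
           \int[leb]_(z in bx a b) (w z)%:E)%E.
  rewrite -(setIidr subB) [RHS]integral_mkcondr; apply: eq_integral => z zb.
  by rewrite patchE indicE in_setI zb /=; case: ifP => h; rewrite ?mulr1 ?mulr0.
have iD := integrableB (mbx a b) iF iwB.
split.
  by apply: (eq_integrable (mbx a b) _ _ _ iD) => y _.
under eq_integral do rewrite EFinB.
rewrite (integralB (mbx a b) iF iwB) /=.
rewrite -[X in (_ - X)%E]WE -FW subee//.
exact: integrable_fin_num iF.
Qed.

End limit_identification.

(** * Slices of a function with weak derivatives *)

Section fubini_extra.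
Local Open Scope classical_set_scope.
Context {R : realType} dx dy (TX : measurableType dx) (TY : measurableType dy).
Variable m1 : {sigma_finite_measure set TX -> \bar R}.
Variable m2 : {sigma_finite_measure set TY -> \bar R}.

Lemma measurable_Rintegral_section (f : TX * TY -> R) : measurable_fun setT f ->
  measurable_fun setT (fun x => \int[m2]_u f (x, u)).
Proof.
move=> mf; apply: (measurableT_comp (fine_measurable measurableT)) => //.
have mf' : measurable_fun setT (EFin \o f) by exact/measurable_EFinP.
rewrite (_ : (fun x => _) = fun x =>
    (fubini_F m2 (EFin \o f)^\+ x - fubini_F m2 (EFin \o f)^\- x)%E).
  by apply: emeasurable_funB; apply: measurable_fun_fubini_tonelli_F => //;
    [exact: measurable_funepos|exact: measurable_funeneg].
apply/funext => x; rewrite integralE /fubini_F; congr (_ - _)%E.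
  by apply: eq_integral => y _; rewrite !funeposE.
by apply: eq_integral => y _; rewrite !funenegE.
Qed.

Lemma measurable_ge0_section (f : TX * TY -> R) : measurable_fun setT f ->
  (forall z, 0 <= f z) ->
  measurable_fun setT (fun x => (\int[m2]_u (f (x, u))%:E)%E).
Proof.
move=> mf f0; apply: (measurable_fun_fubini_tonelli_F (EFin \o f)).
  exact/measurable_EFinP.
by move=> z; rewrite lee_fin.
Qed.

Lemma measurable_section (f : TX * TY -> R) x : measurable_fun setT f ->
  measurable_fun setT (fun u => f (x, u)).
Proof. by move=> mf; exact: (measurableT_comp mf (measurable_pair1 x)). Qed.

Lemma product_null (A : set (TX * TY)) : measurable A ->
  {ae m1, forall x, m2 (xsection A x) = 0%E} -> (m1 \x m2)%E A = 0%E.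
Proof.
move=> mA H; rewrite /product_measure1.
rewrite (@ae_eq_integral _ _ _ _ _ (cst 0%E))//.
- exact: integral0.
- exact: measurable_fun_xsection.
- by apply: filterS H => x Hx _.
Qed.

Lemma Lp_section_ae (p : R) (w : TX * TY -> R) : in_Lp (m1 \x m2)%E p w ->
  {ae m1, forall x, in_Lp m2 p (fun u => w (x, u))}.
Proof.
move=> [mw wp]; have mwp := measurable_normpow p mw.
have i1 : m1.-integrable setT (fun x => (\int[m2]_u (`|w (x, u)| `^ p)%:E)%E).
  apply/integrableP; split.
    by apply: (@measurable_ge0_section (fun z => `|w z| `^ p)) => // z; exact: powR_ge0.
  under eq_integral do rewrite gee0_abs ?integral_ge0//.
  move: wp; rewrite fubini_tonelli1//.
  exact/measurable_EFinP.
have := integrable_ae measurableT i1; apply: filterS => x /(_ Logic.I) H.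
split; first exact: measurable_section.
by rewrite -ge0_fin_numE//; apply: integral_ge0 => u _; rewrite lee_fin powR_ge0.
Qed.

End fubini_extra.

Section sections_of_data.
Local Open Scope classical_set_scope.
Context {R : realType} {d1 d2 : nat}.
Local Notation E := ('rV[R]_d1 * 'rV[R]_d2)%type.
Local Notation leb1 := (@lebesgue_rV R d1).
Local Notation leb2 := (@lebesgue_rV R d2).
Local Notation mu := (leb1 \x leb2)%E.
Variables (Omega1 : set 'rV[R]_d1) (Omega2 : set 'rV[R]_d2) (p : R) (l : nat).
Hypotheses (open1 : open Omega1) (open2 : open Omega2) (p1 : 1 <= p) (l0 : (0 < l)%N).
Hypothesis pl : (d2%:R < p * l%:R) \/ (p = 1 /\ l = d2).
Implicit Types (v : 'I_d2 -> E -> R).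

(** What the proof retains of a Sobolev function: the function and its pure derivatives
    of order l in the coordinates of y, as measurable functions on the whole space. *)
Definition weak_data (w : E -> R) v := [/\ in_Lp mu p w, forall i, in_Lp mu p (v i) &
  forall i, tensor_weak Omega1 Omega2 l w (v i) i].

Definition good_section (w : E -> R) v x :=
  slice_data Omega2 p l (fun u => w (x, u)) (fun i u => v i (x, u)).

(** There is one condition for each generation and each rational point. *)
Lemma good_section_ae w v : weak_data w v ->
  {ae leb1, forall x, Omega1 x -> good_section w v x}.
Proof.
move=> [Lw Lv wv].
have a1 := Lp_section_ae Lw.
have a2 : {ae leb1, forall x, forall i, in_Lp leb2 p (fun u => v i (x, u))}.
  have : {ae leb1, forall x, forall j : nat, forall i : 'I_d2, j = i ->
      in_Lp leb2 p (fun u => v i (x, u))}.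
    apply: ae_foralln => j; case: (ltnP j d2) => jd; last first.
      by apply: aeW => x i ji; move: jd; rewrite ji leqNgt ltn_ord.
    have := Lp_section_ae (Lv (Ordinal jd)); apply: filterS => x H i ji.
    by rewrite (_ : i = Ordinal jd)//; exact/val_inj.
  by apply: filterS => x H i; exact: (H i i erefl).
have a3 : {ae leb1, forall x, forall j : nat, Omega1 x -> forall k q,
    @unpickle (nat * 'rV[rat]_d2)%type j = Some (k, q) -> room Omega2 k (qpt q) ->
    \int[leb2]_u rem_kernel l w v k (qpt q) (x, u) = 0}.
  (* The index j codes a generation k and a rational point q. *)
  apply: ae_foralln => j; case: unpickle => [[k q]|]; last exact: aeW.
  have [rq|nrq] := pselect (room Omega2 k (qpt q)); last first.
    by apply: aeW => x _ k' q' [<- <-].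
  have := rem_ae open1 p1 l0 Lw Lv wv rq; apply: filterS => x H Ox k' q' [<- <-] _.
  exact: H.
apply: filterS3 a1 a2 a3 => x H1 H2 H3 Ox.
split => // k q rq; apply: (H3 (pickle (k, q)) Ox k q) => //.
exact: pickleK.
Qed.

Definition smoothed2 (w : E -> R) k (z : E) : R :=
  smoothed l k (fun u => w (z.1, u)) z.2.

(** The representative that is continuous in y on every good slice. *)
Definition limit_repr w z := limn (fun k => smoothed2 w k z).

Lemma measurable_smoothed2 w k : measurable_fun setT w -> measurable_fun setT (smoothed2 w k).
Proof.
move=> mw; pose f (q : E * 'rV[R]_d2) := w (q.1.1, q.2) * kap l k q.1.2 q.2.
have q1 : measurable_fun [set: E * 'rV[R]_d2] (fun q => (q.1.1, q.2)).
  apply/measurable_fun_pairP; split => /=; last exact: measurable_snd.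
  exact: (measurableT_comp measurable_fst measurable_fst).
have q2 : measurable_fun [set: E * 'rV[R]_d2] (fun q => (q.1.2, q.2)).
  apply/measurable_fun_pairP; split => /=; last exact: measurable_snd.
  exact: (measurableT_comp measurable_snd measurable_fst).
apply: (@measurable_Rintegral_section _ _ _ _ _ leb2 f).
apply: measurable_funM; first exact: (measurableT_comp mw q1).
exact: (measurableT_comp (measurable_kap l k) q2).
Qed.

Lemma good_smoothed_cvg w v x y : good_section w v x -> Omega2 y ->
  smoothed2 w k (x, y) @[k --> \oo] --> limit_repr w (x, y).
Proof.
move=> gx /(open_room open2)[n rn].
exact: (smoothed_cvg p1 l0 pl gx rn).
Qed.

Lemma good_limit_ae w v x : good_section w v x ->
  {ae leb2, forall y, Omega2 y -> limit_repr w (x, y) = w (x, y)}.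
Proof.
move=> gx; have [Lw Lv _] := gx.
apply: (smoothed_limit_ae p1 l0 open2 Lw).
  by move=> y Oy; exact: (good_smoothed_cvg gx Oy).
move=> n.
have [La La0 HLa] := osc_le Omega2 p1 l0 pl ltr01.
have [Lb Lb0 HLb] := @smoothed_le R d2 p l p1 l0 n.+1 1 ltr01.
have Iw : (\int[leb2]_z (`|w (x, z)| `^ p)%:E)%E \is a fin_num.
  by rewrite ge0_fin_numE ?integral_ge0//; case: Lw.
have Iv : (\sum_i \int[leb2]_z (`|v i (x, z)| `^ p)%:E)%E \is a fin_num.
  apply/sum_fin_numP => i _ _.
  by rewrite ge0_fin_numE ?integral_ge0//; case: (Lv i).
set I := (\int[leb2]_z _)%E in Iw *; set J := (\sum_i _)%E in Iv.
exists (1 + La * fine J + (1 + Lb * fine I)) => k y nk ry.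
rewrite -[smoothed _ _ _ _](subrK (smoothed l n.+1 (fun u => w (x, u)) y)).
rewrite (le_trans (ler_normD _ _))// lerD//.
  rewrite -lee_fin EFinD EFinM fineK// distrC.
  exact: (HLa _ _ gx n n.+1 k y (ltnSn n) nk ry).
have := HLb _ y Lw.
by rewrite -/I -(fineK Iw) -EFinM -EFinD lee_fin.
Qed.

(** The identity is known on almost every slice. To reach the product measure, the
    exceptional set is enclosed in a measurable one: the set where the measurable
    functions [smoothed2 w k] do not converge to w. *)
Lemma limit_repr_ae w v : weak_data w v ->
  {ae mu, forall z, (Omega1 `*` Omega2) z -> limit_repr w z = w z}.
Proof.
move=> wd; have mw : measurable_fun setT w by case: wd => -[].
pose C : set E := \bigcap_j \bigcup_n \bigcap_k
  [set z | `|smoothed2 w (n + k) z - w z| < 2 ^- j].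
have mC : measurable C.
  apply: bigcapT_measurable => j; apply: bigcupT_measurable => n.
  apply: bigcapT_measurable => k.
  have m : measurable_fun setT (fun z => `|smoothed2 w (n + k) z - w z|).
    apply: measurableT_comp => //; apply: measurable_funB => //.
    exact: measurable_smoothed2.
  rewrite (_ : [set z | _] = (fun z => `|smoothed2 w (n + k) z - w z|) @^-1` `]-oo, 2 ^- j[).
    by rewrite -[X in measurable X]setTI; exact: m.
  by apply/seteqP; split => z /=; rewrite in_itv.
have CP z : C z <-> smoothed2 w k z @[k --> \oo] --> w z.
  split=> [Cz|cz].
    apply/cvgrPdist_lt => e e0.
    have [j je] := exp2_small e0.
    have [n _ Hn] := Cz j Logic.I.
    exists n => // k /= nk; rewrite distrC (lt_le_trans _ je)//.
    by have := Hn (k - n)%N Logic.I; rewrite /= subnKC.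
  move=> j _; have p2 : 0 < (2 : R) ^- j by rewrite invr_gt0 exprn_gt0.
  have /cvgrPdist_lt/(_ _ p2) [n _ Hn] := cz; exists n => // k _ /=.
  by rewrite distrC; apply: Hn; rewrite /= leq_addr.
have mO : measurable (Omega1 `*` Omega2).
  by apply: measurableX; exact: open_measurable_rV.
exists ((Omega1 `*` Omega2) `\` C); split.
- exact: measurableD.
- apply: product_null; first exact: measurableD.
  have := good_section_ae wd; apply: filterS => x gx.
  have [Ox|nOx] := pselect (Omega1 x); last first.
    rewrite (_ : xsection _ _ = set0) ?measure0//.
    by apply/seteqP; split => // y /xsectionP[[]].
  have [N [mN N0 HN]] := good_limit_ae (gx Ox).
  apply/eqP; rewrite -measure_le0 -N0; apply: le_measure => //.
  + by rewrite inE; apply: measurable_xsection; exact: measurableD.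
  + by rewrite inE.
  move=> y /xsectionP[[_ Oy] nC]; apply: HN => /(_ Oy) E; apply: nC.
  by apply/CP; rewrite -E; exact: (good_smoothed_cvg (gx Ox) Oy).
- move=> z /= Hz; split.
    by apply: contrapT => nO; apply: Hz.
  move=> /CP cz; apply: Hz => _.
  by apply: cvg_lim => //.
Qed.

End sections_of_data.

(** * Majorants given by the energy of slices *)

Section sobolev_slices.
Local Open Scope classical_set_scope.
Context {R : realType} {d1 d2 : nat}.
Local Notation E := ('rV[R]_d1 * 'rV[R]_d2)%type.
Local Notation leb1 := (@lebesgue_rV R d1).
Local Notation leb2 := (@lebesgue_rV R d2).
Local Notation mu := (leb1 \x leb2)%E.
Variables (Omega1 : set 'rV[R]_d1) (Omega2 : set 'rV[R]_d2) (p : R) (l : nat).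
Hypotheses (open1 : open Omega1) (open2 : open Omega2) (p1 : 1 <= p) (l0 : (0 < l)%N).
Hypothesis pl : (d2%:R < p * l%:R) \/ (p = 1 /\ l = d2).
Implicit Types (v : 'I_d2 -> E -> R).
Local Notation weak_data := (weak_data Omega1 Omega2 p l).
Local Notation good_section := (good_section Omega2 p l).
Local Notation repr := (limit_repr l).

(** Integrable in x, it provides the term a(x) of the majorant a(x) + b(y). *)
Definition energy (w : E -> R) v x : \bar R :=
  (\int[leb2]_u (`|w (x, u)| `^ p)%:E + \sum_i \int[leb2]_u (`|v i (x, u)| `^ p)%:E)%E.

Let slice_ge0 (w : E -> R) x : (0 <= \int[leb2]_u (`|w (x, u)| `^ p)%:E)%E.
Proof. by apply: integral_ge0 => u _; rewrite lee_fin powR_ge0. Qed.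

Lemma energy_ge0 w v x : (0 <= energy w v x)%E.
Proof. by rewrite adde_ge0// sume_ge0. Qed.

Lemma measurable_slice (w : E -> R) : measurable_fun setT w ->
  measurable_fun setT (fun x => (\int[leb2]_u (`|w (x, u)| `^ p)%:E)%E).
Proof.
move=> mw; apply: (@measurable_ge0_section _ _ _ _ _ leb2 (fun z => `|w z| `^ p)).
  exact: measurable_normpow.
by move=> z; exact: powR_ge0.
Qed.

Lemma integral_slice (w : E -> R) : measurable_fun setT w ->
  (\int[leb1]_x \int[leb2]_u (`|w (x, u)| `^ p)%:E = \int[mu]_z (`|w z| `^ p)%:E)%E.
Proof.
move=> mw; rewrite [RHS]fubini_tonelli1//.
by apply/measurable_EFinP; exact: measurable_normpow.
Qed.

Lemma measurable_energy w v : measurable_fun setT w ->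
  (forall i, measurable_fun setT (v i)) -> measurable_fun setT (energy w v).
Proof.
move=> mw mv; apply: emeasurable_funD; first exact: measurable_slice.
by apply: emeasurable_sum => i; exact: measurable_slice.
Qed.

Lemma integral_energy w v : measurable_fun setT w ->
  (forall i, measurable_fun setT (v i)) ->
  (\int[leb1]_x energy w v x =
    \int[mu]_z (`|w z| `^ p)%:E + \sum_i \int[mu]_z (`|v i z| `^ p)%:E)%E.
Proof.
move=> mw mv; rewrite ge0_integralD//; first last.
- by apply: emeasurable_sum => i; exact: measurable_slice.
- by move=> x _; apply: sume_ge0.
- exact: measurable_slice.
rewrite integral_slice// ge0_integral_sum//; last by move=> i; exact: measurable_slice.
by congr (_ + _)%E; apply: eq_bigr => i _; exact: integral_slice.
Qed.

Lemma ae_fst (P : 'rV[R]_d1 -> Prop) : {ae leb1, forall x, P x} ->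
  {ae mu, forall z, P z.1}.
Proof.
move=> [N [mN N0 HN]]; exists (N `*` setT); split.
- exact: measurableX.
- apply: product_null; first exact: measurableX.
  exists N; split => // x /= Hx; apply: contrapT => nN; apply: Hx.
  rewrite (_ : xsection _ _ = set0) ?measure0//.
  by apply/seteqP; split => // y /xsectionP[].
- by move=> z /= Hz; split => //; exact: HN.
Qed.

Lemma room_in n y : room Omega2 n y -> Omega2 y.
Proof. by apply => j; rewrite subrr normr0 divr_ge0 ?exprn_ge0. Qed.

(** Compare w with its mollification at the fixed generation n + 1: the difference is
    controlled by [osc_le], the mollified value by [smoothed_le]. *)
Lemma slice_bound n (tau : R) : 0 < tau -> exists2 Lam : R, 0 <= Lam &
  forall w v, weak_data w v -> {ae mu, forall z, Omega1 z.1 -> room Omega2 n z.2 ->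
    (`|w z|%:E <= tau%:E + Lam%:E * energy w v z.1)%E}.
Proof.
move=> tau0; have tau2 : 0 < tau / 2 by rewrite divr_gt0.
have [La La0 HLa] := osc_le Omega2 p1 l0 pl tau2.
have [Lb Lb0 HLb] := @smoothed_le R d2 p l p1 l0 n.+1 _ tau2.
exists (La + Lb); first by rewrite addr_ge0.
move=> w v wd.
have := limit_repr_ae open1 open2 p1 l0 pl wd.
have := ae_fst (good_section_ae open1 p1 l0 wd).
apply: filterS2 => -[x y] /= gx rz Ox ry.
have {}gx := gx Ox; have Oy := room_in ry.
rewrite -(rz (conj Ox Oy)).
have [Lw _ _] := gx.
have h1 := HLb _ y Lw.
have h2 := smoothed_lim_le p1 l0 pl gx ry (fun m hm => HLa _ _ gx n n.+1 m y (ltnSn n) hm ry).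
set I := (\int[leb2]_z _)%E in h1; set J := (\sum_i _)%E in h2.
have I0 : (0 <= I)%E by exact: slice_ge0.
have J0 : (0 <= J)%E by apply: sume_ge0 => i _; exact: slice_ge0.
set a := smoothed l n.+1 _ y in h1 h2.
apply: (@le_trans _ _ (`|a|%:E + `|a - repr w (x, y)|%:E)%E).
  by rewrite -EFinD lee_fin -{1}[repr w (x, y)](subKr a) ler_normB.
apply: (le_trans (leeD h1 h2)).
rewrite addeACA -EFinD -splitr leeD2l//.
rewrite EFinD /energy -/I -/J ge0_muleDl ?lee_fin//.
rewrite addeC; apply: leeD; apply: lee_wpmul2l; rewrite ?lee_fin//.
  exact: leeDr.
exact: leeDl.
Qed.

Definition slice_tail v N x : \bar R := tail leb2 p (fun i u => v i (x, u)) N.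

Lemma measurable_slice_tail v N : (forall i, measurable_fun setT (v i)) ->
  measurable_fun setT (slice_tail v N).
Proof.
move=> mv; apply: emeasurable_sum => i.
apply: (@measurable_ge0_section _ _ _ _ _ leb2
  (fun z => (`|v i z| * (N < `|v i z|)%R%:R) `^ p)).
  exact: measurable_tail_fun.
by move=> z; exact: powR_ge0.
Qed.

Lemma integral_slice_tail v N : (forall i, measurable_fun setT (v i)) ->
  (\int[leb1]_x slice_tail v N x = tail mu p v N)%E.
Proof.
move=> mv; rewrite ge0_integral_sum//; last 2 first.
- move=> i; apply: (@measurable_ge0_section _ _ _ _ _ leb2
    (fun z => (`|v i z| * (N < `|v i z|)%R%:R) `^ p)).
    exact: measurable_tail_fun.
  by move=> z; exact: powR_ge0.
- by move=> i x _; apply: integral_ge0 => u _; rewrite lee_fin powR_ge0.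
apply: eq_bigr => i _; rewrite fubini_tonelli1//.
by apply/measurable_EFinP; exact: measurable_tail_fun.
Qed.

Lemma chebyshev_le (g : 'rV[R]_d1 -> \bar R) (a b : R) : 0 < a ->
  measurable_fun setT g -> (forall x, 0 <= g x)%E ->
  (\int[leb1]_x g x <= (a * b)%:E)%E ->
  (leb1 [set x | (a%:E < g x)%E] <= b%:E)%E.
Proof.
move=> a0 mg g0 gab; set B := [set x | _].
have mB : measurable B.
  rewrite (_ : B = setT `&` g @^-1` `]a%:E, +oo[%classic).
    by apply: mg => //; exact: emeasurable_itv.
  by apply/seteqP; split => x /=; rewrite /B/= in_itv/= andbT => // -[].
have : (a%:E * leb1 B <= (a * b)%:E)%E.
  apply: le_trans gab; rewrite -integral_cst//.
  apply: (@le_trans _ _ (\int[leb1]_(x in B) g x)%E).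
    apply: ge0_le_integral => //.
    - by move=> x _; rewrite lee_fin ltW.
    - exact: measurable_funTS.
    - by move=> x; exact: ltW.
  exact: ge0_subset_integral.
by rewrite EFinM lee_pmul2l// lte_fin.
Qed.

End sobolev_slices.

(** * Virtual continuity *)

Lemma dist_chain {R : realFieldType} (eps r s t t' s' r' : R) : 0 < eps ->
  `|s - r| <= eps / 4 -> `|s - t| <= eps / 8 -> `|t - t'| < eps / 8 ->
  `|s' - t'| <= eps / 8 -> `|s' - r'| <= eps / 4 -> `|r' - r| < eps.
Proof.
move=> e0; rewrite !ler_norml !ltr_norml.
by move=> /andP[? ?] /andP[? ?] /andP[? ?] /andP[? ?] /andP[? ?]; apply/andP; split; lra.
Qed.

Lemma seq_dist_control_fin {R : realType} d (T : measurableType d) (m : nat -> T -> R) K (e : R) :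
  0 < e -> exists2 r : R, 0 < r & forall x y, seq_dist m x y < r ->
    forall k, (k < K)%N -> `|m k x - m k y| < e.
Proof.
move=> e0; elim: K => [|K [r r0 Hr]]; first by exists 1.
have [r' r'0 Hr'] := seq_dist_control m K e0.
exists (Num.min r r'); first by rewrite lt_min r0.
move=> x y; rewrite lt_min => /andP[xr xr'] k; rewrite ltnS leq_eqVlt => /orP[/eqP ->|kK].
  exact: Hr'.
exact: Hr.
Qed.

Section virtual_continuity_proof.
Local Open Scope classical_set_scope.
Context {R : realType} {d1 d2 : nat}.
Local Notation E := ('rV[R]_d1 * 'rV[R]_d2)%type.
Local Notation leb1 := (@lebesgue_rV R d1).
Local Notation leb2 := (@lebesgue_rV R d2).
Local Notation mu := (leb1 \x leb2)%E.
Variables (Omega1 : set 'rV[R]_d1) (Omega2 : set 'rV[R]_d2) (p : R) (l : nat).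
Hypotheses (open1 : open Omega1) (open2 : open Omega2) (p1 : 1 <= p) (l0 : (0 < l)%N).
Hypothesis pl : (d2%:R < p * l%:R) \/ (p = 1 /\ l = d2).
Implicit Types (v : 'I_d2 -> E -> R).
Local Notation weak_data := (weak_data Omega1 Omega2 p l).
Local Notation good_section := (good_section Omega2 p l).
Local Notation repr := (limit_repr l).

(** For each s, [osc_tail_le] bounds the late oscillation on a slice by 2^-s plus a
    multiple of the tail of that slice, and N can be chosen so that the integral of the
    latter over x is at most 2^-s e / 2^(s + 1). By Chebyshev it is then at most 2^-s off
    a set of measure at most e / 2^(s + 1), and these measures add up to at most e. *)
Lemma uniform_rate w v (e : R) : weak_data w v -> 0 < e ->
  exists2 X' : set 'rV[R]_d1, [/\ measurable X', X' `<=` Omega1 & (leb1 (Omega1 `\` X') <= e%:E)%E] &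
  exists n_ : nat -> nat, forall x, X' x -> good_section w v x /\
    forall s n k y, (n_ s <= k)%N -> (n < k)%N -> room Omega2 n y ->
      `|smoothed2 l w k (x, y) - repr w (x, y)| <= 2 ^- s + 2 ^- s.
Proof.
move=> wd e0; have [Lw Lv _] := wd.
have mv i : measurable_fun setT (v i) by case: (Lv i).
have p2 s : 0 < (2 : R) ^- s by rewrite invr_gt0 exprn_gt0.
have /choice[F HF] : forall s, exists F : R * nat * nat, [/\ 0 < F.1.1,
    (\int[leb1]_x (F.1.1%:E * slice_tail p v F.1.2%:R x) <=
      (2 ^- s * (e / (2 ^ s.+1)%:R))%:E)%E &
    forall w u, slice_data Omega2 p l w u -> forall n k m y, (F.2 <= k)%N -> (n < k)%N ->
      (k <= m)%N -> room Omega2 n y ->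
      (`|smoothed l k w y - smoothed l m w y|%:E <=
        (2 ^- s)%:E + F.1.1%:E * tail leb2 p u F.1.2%:R)%E].
  move=> s; have [Lam L0 HL] := osc_tail_le Omega2 p1 l0 pl (p2 s).
  have L1 : 0 < Lam + 1 by rewrite ltr_wpDl.
  have q0 : 0 < 2 ^- s * (e / (2 ^ s.+1)%:R) / (Lam + 1).
    by rewrite !divr_gt0// mulr_gt0// divr_gt0// ltr0n expn_gt0.
  have [N HN] := tail_small p1 Lv q0.
  have [n0 Hn0] := HL N%:R (ler0n _ _).
  exists (Lam + 1, N, n0); split => //=.
    rewrite ge0_integralZl_EFin//; last 3 first.
    - by move=> x _; exact: tail_ge0.
    - exact: measurable_slice_tail.
    - exact: ltW.
    rewrite integral_slice_tail//.
    apply: (le_trans (lee_wpmul2l _ HN)); first by rewrite lee_fin ltW.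
    by rewrite -EFinM lee_fin mulrC divfK// gt_eqF.
  move=> w' u A n k m y n0k nk km ry; apply: (le_trans (Hn0 w' u A n k m y n0k nk km ry)).
  by apply: leeD2l; apply: lee_wpmul2r; [exact: tail_ge0|rewrite lee_fin lerDl].
pose g s x := ((F s).1.1%:E * slice_tail p v (F s).1.2%:R x)%E.
pose B s := [set x | ((2 ^- s)%:E < g s x)%E].
have mg s : measurable_fun setT (g s).
  apply: emeasurable_funM; first exact: measurable_cst.
  exact: measurable_slice_tail.
have g0 s x : (0 <= g s x)%E.
  have [F0 _ _] := HF s.
  by rewrite mule_ge0 ?lee_fin ?(ltW F0)//; exact: tail_ge0.
have mB s : measurable (B s).
  rewrite (_ : B s = setT `&` g s @^-1` `](2 ^- s)%:E, +oo[%classic).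
    by apply: mg => //; exact: emeasurable_itv.
  by apply/seteqP; split => x /=; rewrite /B/= in_itv/= andbT => // -[].
have Bs s : (leb1 (B s) <= (e / (2 ^ s.+1)%:R)%:E)%E.
  by have [_ H _] := HF s; exact: (chebyshev_le (p2 s) (mg s) (g0 s) H).
have [M [mM M0 HM]] := good_section_ae open1 p1 l0 wd.
have mBU : measurable (\bigcup_s B s) by apply: bigcupT_measurable.
have mO1 := open_measurable_rV open1.
exists (Omega1 `\` (M `|` \bigcup_s B s)).
  have mU : measurable (M `|` \bigcup_s B s) by exact: measurableU.
  split; [exact: measurableD|by move=> x []|].
  rewrite setDD; apply: (@le_trans _ _ (leb1 (M `|` \bigcup_s B s))).
    by apply: le_measure; rewrite ?inE//; exact: measurableI.
  apply: (le_trans (measureU2 _ mM mBU)); rewrite [X in (X + _)%E]M0 add0e.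
  apply: (le_trans (measure_sigma_subadditive leb1 mB mBU (@subset_refl _ _))).
  have H := @epsilon_trick R (fun=> 0%E) e xpredT (fun=> lexx _) (ltW e0).
  have z0 : (\sum_(0 <= i <oo) (0 : \bar R) = 0)%E by rewrite eseries0.
  rewrite z0 add0e in H; apply: le_trans H.
  apply: lee_nneseries => [s _ _|s _]; first exact: measure_ge0.
  by rewrite add0e; exact: Bs.
exists (fun s => (F s).2) => x [Ox /not_orP[nM nB]].
have gx : good_section w v x by apply: contrapT => H; apply: nM; apply: HM => /(_ Ox).
split => // s n k y sk nk ry.
have [_ _ H] := HF s.
have gs : (g s x <= (2 ^- s)%:E)%E.
  by rewrite leNgt; apply/negP => h; apply: nB; exists s.
have := smoothed_lim_le p1 l0 pl gx ry (fun m hm => H _ _ gx n k m y sk nk hm ry).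
move=> h; rewrite -lee_fin EFinD; apply: (le_trans h).
by apply: leeD2l.
Qed.

(** The x-semimetric is generated by the p-th powers of the norms of the slices and by
    the values of all the mollifications at rational points; the y-semimetric by the
    coordinates. For these every mollification is continuous: the Lipschitz bound in y,
    whose constant involves the norm of the slice, allows one to replace y by a nearby
    rational point. On X' they converge to [limit_repr] at a rate independent of x and
    locally independent of y. *)
Lemma weak_data_virtually_continuous w v f Y : weak_data w v ->
  {ae mu, forall z, (Omega1 `*` Omega2) z -> f z = w z} ->
  measurable Y -> Y `<=` Omega2 -> virtually_continuous leb1 leb2 Omega1 Y f.
Proof.
move=> wd fw mY YO.
have [Lw Lv _] := wd; have mw := Lw.1.
have YO' : Omega1 `*` Y `<=` Omega1 `*` Omega2 by move=> z [? ?]; split => //; exact: YO.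
split.
  exists w; first exact: measurable_funTS.
  by apply: filterS fw => z H Hz; apply/H/YO'.
move=> e e0; have [X' [mX' X'O X'e] [n_ Hn]] := uniform_rate wd e0.
exists X', Y; split => //; first by split => //; exact: subset_refl.
  by rewrite setDv measure0 lee_fin ltW.
pose I x := fine (\int[leb2]_u (`|w (x, u)| `^ p)%:E)%E.
(* The values of the k-th mollification at q, and the norm of the slice for all the
   indices that do not code such a pair. *)
pose mX (j : nat) : 'rV[R]_d1 -> R := match @unpickle (option (nat * 'rV[rat]_d2)) j with
  | Some (Some (k, q)) => fun x => smoothed2 l w k (x, qpt q)
  | _ => I end.
have mI : measurable_fun setT I.
  apply: (measurableT_comp (fine_measurable measurableT)) => //.
  exact: measurable_slice.
have mmX j : measurable_fun setT (mX j).
  rewrite /mX; case: unpickle => [[[k q]|]|]//.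
  exact: (measurableT_comp (measurable_smoothed2 l k mw) (measurable_pair2 (qpt q))).
pose mYs (j : nat) : 'rV[R]_d2 -> R := if insub j is Some i then @rV_coord R d2 i else fun=> 0.
have mmY j : measurable_fun setT (mYs j).
  by rewrite /mYs; case: insubP => [i _ _|_]; [exact: rV_coord_meas|exact: measurable_cst].
exists (seq_dist mX), (seq_dist mYs), (repr w); split.
- exact: admissible_seq_dist.
- exact: admissible_seq_dist.
- have := limit_repr_ae open1 open2 p1 l0 pl wd; move: fw; apply: filterS2 => z H1 H2 Hz.
  have Hz' : (Omega1 `*` Omega2) z by case: Hz => ? ?; split; [exact: X'O|exact: YO].
  by rewrite H1// H2.
move=> x y X'x Yy eps eps0.
have [n rn] := open_room open2 (YO y Yy).
have [s hs] := exp2_small (divr_gt0 eps0 (ltr0n R 8)).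
(* Late enough for the rate at precision 2^-s and for points with room at n + 1. *)
pose k := maxn (n_ s) n.+2.
have nsk : (n_ s <= k)%N by rewrite leq_maxl.
have nk : (n.+1 < k)%N by rewrite leq_maxr.
have rate x' y' : X' x' -> room Omega2 n.+1 y' ->
    `|smoothed2 l w k (x', y') - repr w (x', y')| <= eps / 4.
  move=> hx hy; apply: (le_trans ((Hn x' hx).2 s n.+1 k y' nsk nk hy)).
  lra.
have [L L0 HL] := @smoothed_lipschitz R d2 p l p1 l0 k.
have lip x' y1 y2 : X' x' -> `|smoothed2 l w k (x', y1) - smoothed2 l w k (x', y2)| <=
    L * (\sum_j `|rV_coord j y1 - rV_coord j y2|) * (1 + I x').
  move=> hx; have [Lwx _ _] := (Hn x' hx).1.
  have := HL _ y1 y2 Lwx; rewrite -[(\int[leb2]_z _)%E]fineK; last first.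
    by rewrite ge0_fin_numE ?integral_ge0//; case: Lwx.
  by rewrite -EFinD -EFinM lee_fin.
have I0 x' : 0 <= I x' by apply: fine_ge0; apply: integral_ge0 => u _; rewrite lee_fin powR_ge0.
(* An upper bound of 1 + I x' when the slice norms at x and x' differ by at most 1. *)
pose M := 1 + (I x + 1); have M0 : 0 < M by rewrite ltr_wpDr// addr_ge0.
pose A := L * (d2%:R * 2) * M + 1.
have A0 : 0 < A by rewrite ltr_wpDl// !mulr_ge0// ltW.
pose eta := Num.min (eps / 8 / A) (2 / 2 ^+ n.+1).
have eta0 : 0 < eta by rewrite lt_min !divr_gt0// exprn_gt0.
have [q hq] := qpt_dense y eta0.
have lipq x' y' : X' x' -> I x' <= I x + 1 ->
    (forall j, `|rV_coord j y' - rV_coord j (qpt q)| <= eta * 2) ->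
    `|smoothed2 l w k (x', y') - smoothed2 l w k (x', qpt q)| <= eps / 8.
  move=> hx hI hy; apply: (le_trans (lip x' y' (qpt q) hx)).
  apply: (@le_trans _ _ (L * (d2%:R * (eps / 8 / A * 2)) * M)).
    apply: ler_pM; last by rewrite lerD2l.
    - by apply: mulr_ge0 => //; exact: sumr_ge0.
    - exact: addr_ge0.
    rewrite ler_wpM2l//; apply: (le_trans (ler_sum _ (fun j _ => hy j))).
    rewrite sumr_const card_ord -[_ *+ d2]mulr_natl ler_wpM2l// ler_pM2r//.
    by rewrite /eta ge_min lexx.
  rewrite (_ : L * _ * M = eps / 8 * (L * (d2%:R * 2) * M / A)); last by ring.
  by rewrite ler_piMr ?divr_ge0 ?(ltW eps0)// ler_pdivrMr// mul1r lerDl.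
have [r1 r10 H1] := seq_dist_control mX (@pickle (option (nat * 'rV[rat]_d2)) None) ltr01.
have e8 : 0 < eps / 8 by rewrite divr_gt0.
have [r2 r20 H2] := seq_dist_control mX (@pickle (option (nat * 'rV[rat]_d2)) (Some (k, q))) e8.
have [r3 r30 H3] := seq_dist_control_fin mYs d2 eta0.
exists (Num.min r1 (Num.min r2 r3)); first by rewrite !lt_min r10 r20.
move=> x' y' hx' hy' hr.
have dX0 : 0 <= seq_dist mX x x'.
  by have [_ + _ _] := seq_dist_semimetric mX setT; apply.
have dY0 : 0 <= seq_dist mYs y y'.
  by have [_ + _ _] := seq_dist_semimetric mYs setT; apply.
move: hr; rewrite !lt_min => /and3P[hr1 hr2 hr3].
have hI : I x' <= I x + 1.
  have := H1 x x' (le_lt_trans _ hr1); rewrite lerDl => /(_ dY0).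
  rewrite /mX pickleK distrC => /ltW /(le_trans (ler_norm _)).
  by rewrite lerBlDl.
have hmid : `|smoothed2 l w k (x, qpt q) - smoothed2 l w k (x', qpt q)| < eps / 8.
  have := H2 x x' (le_lt_trans _ hr2); rewrite lerDl => /(_ dY0).
  by rewrite /mX pickleK.
have hyy (j : 'I_d2) : `|rV_coord j y - rV_coord j y'| < eta.
  have := H3 y y' (le_lt_trans _ hr3); rewrite lerDr => /(_ dX0 j (ltn_ord j)).
  by rewrite /mYs insubT//= => jlt; rewrite (_ : Sub _ _ = j)//; exact/val_inj.
have ry' : room Omega2 n.+1 y'.
  apply: (room_step rn) => j; rewrite distrC; apply/ltW/(lt_le_trans (hyy j)).
  by rewrite /eta ge_min lexx orbT.
have ry : room Omega2 n.+1 y by exact: room_le rn.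
have q1 : `|smoothed2 l w k (x, y) - smoothed2 l w k (x, qpt q)| <= eps / 8.
  apply: (lipq x y X'x); first by rewrite lerDl.
  by move=> j; rewrite distrC (le_trans (ltW (hq j)))// ler_peMr ?(ltW eta0)// ler1n.
have q2 : `|smoothed2 l w k (x', y') - smoothed2 l w k (x', qpt q)| <= eps / 8.
  apply: (lipq x' y' hx' hI) => j; apply: (le_trans (ler_distD (rV_coord j y) _ _)).
  rewrite mulr_natr mulr2n distrC; apply: lerD; apply: ltW; first exact: hyy.
  by rewrite distrC; exact: hq.
exact: dist_chain eps0 (rate x y X'x ry) q1 hmid q2 (rate x' y' hx' ry').
Qed.

End virtual_continuity_proof.

(** * Weak partial derivatives *)

Section weak_partials.
Local Open Scope classical_set_scope.
Context {R : realType} {d1 d2 : nat}.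
Local Notation E := ('rV[R]_d1 * 'rV[R]_d2)%type.
Local Notation coord := ('I_d1 + 'I_d2)%type.
Local Notation mu := (@lebesgue_rV R d1 \x @lebesgue_rV R d2)%E.
Implicit Types (Omega K : set E) (f g w u psi phi : E -> R) (alpha : coord -> nat).

Lemma continuous_measurable_E psi : continuous psi -> measurable_fun setT psi.
Proof.
move=> cpsi; apply: (measurability _ (RGenOInfty.measurableE R)).
move=> _ [_ [a ->] <-]; rewrite setTI; apply: open_measurable_E.
by apply: open_comp => // z _; exact: cpsi.
Qed.

Lemma compact_measurable_E K : compact K -> measurable K.
Proof.
move=> cK; apply: closed_measurable_E; exact: compact_closed.
Qed.

(** A measurable representative extended by zero: integrals over Omega become integrals
    over the whole space. *)
Definition loc_rep Omega w :=
  [/\ measurable_fun setT w, forall z, ~ Omega z -> w z = 0 &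
      forall K, compact K -> K `<=` Omega -> mu.-integrable K (EFin \o w)].

Lemma loc_repB Omega w u : loc_rep Omega w -> loc_rep Omega u -> loc_rep Omega (w \- u).
Proof.
move=> [mw w0 iw] [mu_ u0 iu]; split => [|z Oz|K cK KO].
- exact: measurable_funB.
- by rewrite /= w0// u0// subrr.
- have := integrableB (compact_measurable_E cK) (iw K cK KO) (iu K cK KO).
  by apply: eq_integrable => //; exact: compact_measurable_E.
Qed.

Lemma locally_summable_rep Omega f : open Omega -> locally_summable Omega f ->
  exists w, loc_rep Omega w /\ {ae mu, forall z, Omega z -> f z = w z}.
Proof.
move=> oO [[g mg fg] fK]; have mO := open_measurable_E oO.
have fw : {ae mu, forall z, Omega z -> f z = (g \_ Omega) z}.
  by apply: filterS fg => z H Oz; rewrite patchE mem_set// H.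
have mw : measurable_fun setT (g \_ Omega) by exact/(measurable_restrictT _ mO).
exists (g \_ Omega); split => //; split => // [z Oz|K cK KO].
  by rewrite patchE memNset.
apply/integrableP; split; first exact/measurable_EFinP/measurable_funTS.
rewrite (_ : (\int[mu]_(z in K) _ = \int[mu]_(z in K) `|f z|%:E)%E); first exact: fK.
by apply: integral_ae_congr; apply: filterS fw => z H Kz /=; rewrite H//; exact: KO.
Qed.

Lemma integral_rep Omega (h k : E -> \bar R) :
  {ae mu, forall z, Omega z -> h z = k z} -> (forall z, ~ Omega z -> k z = 0%E) ->
  (\int[mu]_(z in Omega) h z = \int[mu]_z k z)%E.
Proof.
move=> hk k0; rewrite (integral_ae_congr hk) integral_mkcond; congr (integral _ _ _).
apply/funext => z; rewrite patchE; case: ifPn => //.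
by move=> /negP H; rewrite k0// => Oz; apply: H; exact: mem_set.
Qed.

Lemma Rintegral_rep Omega f w psi :
  {ae mu, forall z, Omega z -> f z = w z} -> (forall z, ~ Omega z -> w z = 0) ->
  \int[mu]_(z in Omega) (f z * psi z) = \int[mu]_z (w z * psi z).
Proof.
move=> fw w0; congr fine; apply: integral_rep => [|z Oz].
  by apply: filterS fw => z H /H ->.
by rewrite w0// mul0r.
Qed.

Lemma continuous_supp_integrable Omega w psi K : loc_rep Omega w -> continuous psi ->
  compact K -> K `<=` Omega -> (forall z, ~ K z -> psi z = 0) ->
  mu.-integrable setT (fun z => (w z * psi z)%:E).
Proof.
move=> [mw _ iw] cpsi cK KO psi0.
have mK := compact_measurable_E cK; have iK := iw K cK KO.
have mpsi := continuous_measurable_E cpsi.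
have [M Mpsi] : exists M, forall z, K z -> `|psi z| <= M.
  have cpK : {within K, continuous psi} by exact: continuous_subspaceT.
  have [M [_ HM]] := compact_bounded (continuous_compact cpK cK).
  exists (M + 1) => z Kz; apply: (HM (M + 1)); first by rewrite ltrDl.
  by exists z.
have M0 : forall z, K z -> 0 <= M by move=> z /Mpsi; exact: le_trans.
have iKM : mu.-integrable setT ((fun z => (M%:E * (EFin \o w) z)%E) \_ K).
  by apply/(integrable_mkcond _ mK); exact: (integrableZl mK).
apply: (le_integrable measurableT _ _ iKM).
  by apply/measurable_EFinP; exact: measurable_funM.
move=> z _; rewrite patchE; case: ifPn => [/set_mem Kz|/negP Kz] /=; last first.
  by rewrite psi0 ?mulr0 ?normr0// => H; apply: Kz; exact: mem_set.
rewrite lee_fin !normrM mulrC ler_wpM2r// (le_trans (Mpsi z Kz))//.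
exact: ler_norm.
Qed.

(** Partial derivatives are local. *)
Lemma partials_supp phi s z : ~ closure [set z | phi z != 0] z -> partials s phi z = 0.
Proof.
move=> Hz.
have oU : open (~` closure [set z | phi z != 0]).
  by rewrite openC; exact: closed_closure.
elim: s z Hz => [|c s IH] z Hz.
  apply/eqP/negPn/negP => h; apply: Hz; exact: subset_closure.
rewrite /= (@near_eq_derive _ _ _ _ (cst 0)) ?derive_cst//.
have : nbhs z (~` closure [set z | phi z != 0]) by exact: open_nbhs_nbhs.
by apply: filterS => z' Hz'; exact: IH.
Qed.

Lemma test_function_integrable Omega w phi alpha : loc_rep Omega w -> test_function Omega phi ->
  mu.-integrable setT (fun z => (w z * multi_partial alpha phi z)%:E) /\
  mu.-integrable setT (fun z => (w z * phi z)%:E).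
Proof.
move=> rw [sphi cphi phiO]; split.
  apply: (continuous_supp_integrable rw _ cphi phiO) => [|z Hz].
    by case: (sphi (flatten [seq nseq (alpha i) i | i : coord])).
  exact: partials_supp.
apply: (continuous_supp_integrable rw _ cphi phiO) => [|z Hz]; first by case: (sphi [::]).
exact: (partials_supp [::]).
Qed.

Lemma locally_summableB Omega f g : open Omega -> locally_summable Omega f ->
  locally_summable Omega g -> locally_summable Omega (f \- g).
Proof.
move=> oO /(locally_summable_rep oO)[wf [rf ff]] /(locally_summable_rep oO)[wg [rg gg]].
have [mB _ iB] := loc_repB rf rg.
have fg : {ae mu, forall z, Omega z -> (f \- g) z = (wf \- wg) z}.
  by move: ff gg; apply: filterS2 => z H1 H2 Oz /=; rewrite H1// H2.
split; first by exists (wf \- wg); [exact: measurable_funTS|].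
move=> K cK KO; have [_] := integrableP _ _ _ (iB K cK KO).
rewrite (_ : (\int[mu]_(z in K) `|(f \- g)%R z|%:E =
    \int[mu]_(z in K) `|(EFin \o (wf \- wg)%R) z|)%E)//.
by apply: integral_ae_congr; apply: filterS fg => z H /KO/H /= ->.
Qed.

(** This makes the chosen weak derivatives of a difference of two Sobolev functions
    genuine weak derivatives. *)
Lemma weak_partialB Omega alpha f g u v : open Omega ->
  locally_summable Omega f -> locally_summable Omega g ->
  is_weak_partial Omega alpha f u -> is_weak_partial Omega alpha g v ->
  is_weak_partial Omega alpha (g \- f) (v \- u).
Proof.
move=> oO lf lg [lu fu] [lv gv].
have [wf [rf ff]] := locally_summable_rep oO lf; have [wg [rg gg]] := locally_summable_rep oO lg.
have [wu [ru uu]] := locally_summable_rep oO lu; have [wv [rv vv]] := locally_summable_rep oO lv.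
have bridge a b wa wb : loc_rep Omega wa -> loc_rep Omega wb ->
    {ae mu, forall z, Omega z -> a z = wa z} -> {ae mu, forall z, Omega z -> b z = wb z} ->
    {ae mu, forall z, Omega z -> (a \- b) z = (wa \- wb) z}.
  by move=> _ _; apply: filterS2 => z H1 H2 Oz /=; rewrite H1// H2.
split; first exact: locally_summableB.
move=> phi tphi.
have [iwf _] := test_function_integrable alpha rf tphi.
have [iwg _] := test_function_integrable alpha rg tphi.
have [_ iwu] := test_function_integrable alpha ru tphi.
have [_ iwv] := test_function_integrable alpha rv tphi.
have [_ f0 _] := rf; have [_ g0 _] := rg; have [_ u0 _] := ru; have [_ v0 _] := rv.
have [_ gf0 _] := loc_repB rg rf; have [_ vu0 _] := loc_repB rv ru.
have := fu phi tphi; have := gv phi tphi.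
rewrite (Rintegral_rep _ ff f0) (Rintegral_rep _ gg g0).
rewrite (Rintegral_rep _ uu u0) (Rintegral_rep _ vv v0).
rewrite (Rintegral_rep _ (bridge _ _ _ _ rg rf gg ff) gf0).
rewrite (Rintegral_rep _ (bridge _ _ _ _ rv ru vv uu) vu0).
under [X in _ -> _ -> X = _]eq_Rintegral do rewrite /= mulrBl.
under [X in _ -> _ -> _ = _ * X]eq_Rintegral do rewrite /= mulrBl.
by rewrite !RintegralB// => -> ->; rewrite mulrBr.
Qed.

(** The du Bois-Reymond lemma for locally summable functions: tensor products of
    cut-offs tend boundedly to the indicator of a box. *)
Lemma tensor_orthogonal_ae0 Omega D : open Omega -> loc_rep Omega D ->
  (forall (g : coord -> R -> R) a b, (forall c, smooth1 (g c)) ->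
    (forall c t, ~~ (a c <= t <= b c) -> g c t = 0) -> cbox a b `<=` Omega ->
    \int[mu]_z (D z * tens g z) = 0) ->
  {ae mu, forall z, Omega z -> D z = 0}.
Proof.
move=> oO rD orth; have [mD D0 iD] := rD.
apply: (box_null_ae (@E_coord_meas R d1 d2) (@E_coord_gen R d1 d2) (E_coord_open oO)).
move=> a b e e0 ab fab.
(* The supports of all the cut-offs below lie in this one compact box. *)
pose lo c := a c - e; pose K := cbox lo b.
have cK : compact K by exact: compact_cbox.
have mK := compact_measurable_E cK.
have KO : K `<=` Omega.
  move=> z Kz; apply: fab => c; have /andP[-> h] := Kz c.
  by rewrite (le_trans h)// lerDl ltW.
have iK := iD K cK KO.
have bK : box (@E_coord R d1 d2) a b `<=` K.
  by move=> z bz c; have /andP[h1 /ltW ->] := bz c; rewrite andbT (le_trans _ h1)// gerBl ltW.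
have mbox : measurable (box (@E_coord R d1 d2) a b).
  by apply: measurable_box; exact: E_coord_meas.
split; first exact: integrableS iK.
have [n Hn] : exists n : nat, 2 <= n%:R * e.
  exists (Num.trunc (2 / e)).+1; rewrite -ler_pdivrMr//.
  by rewrite ltW// truncnS_gt.
have fm m : 2 <= (m + n)%:R * e.
  by rewrite (le_trans Hn)// ler_pM2r// ler_nat leq_addl.
pose g m c := cutoff1 (a c) (b c) (m + n).
have sg m c : smooth1 (g m c) by exact: smooth1_cutoff1.
have g0 m c t : ~~ (lo c <= t <= b c) -> g m c t = 0 by exact: cutoff1_supp.
pose f_ m z := (D z * tens (g m) z)%:E.
have if_ m : mu.-integrable setT (f_ m).
  apply: (continuous_supp_integrable rD _ cK KO); first exact: continuous_tens.
  by move=> z; exact: (tens_supp (g0 m)).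
have mind : measurable_fun setT (\1_(box (@E_coord R d1 d2) a b) : E -> R).
  exact: measurable_indic.
have := @dominated_convergence _ _ _ mu setT measurableT f_
  (fun z => (D z * \1_(box (@E_coord R d1 d2) a b) z)%:E)
  ((fun z => `|(EFin \o D) z|%E) \_ K).
case => //.
- by move=> m; exact: measurable_int (if_ m).
- by apply/measurable_EFinP; exact: measurable_funM.
- apply: aeW => z _; apply/fine_cvgP; split; first exact: nearW.
  apply: cvgM; first exact: cvg_cst.
  rewrite (cvg_shiftn n (fun m => cutoff (@E_coord R d1 d2) a b m z)).
  exact: cutoff_cvg.
- by apply/(integrable_mkcond _ mK); exact: integrable_abse.
- apply: aeW => z m _; rewrite patchE /f_; case: ifPn => [Kz|/negP Kz] /=.
    rewrite lee_fin normrM ler_piMr//.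
    exact: (cutoff_le1 (@E_coord R d1 d2) a b (m + n) z).
  by rewrite (tens_supp (g0 m)) ?mulr0 ?normr0// => H; apply: Kz; exact: mem_set.
move=> _ _; rewrite (_ : (fun m => _) = fun=> 0%E); last first.
  apply/funext => m; have := congr1 EFin (orth _ _ _ (sg m) (g0 m) KO).
  by rewrite /Rintegral fineK//; exact: integrable_fin_num (if_ m).
move=> /cvg_lim DB; rewrite integral_mkcond.
rewrite (_ : _ \_ _ = fun z => (D z * \1_(box (@E_coord R d1 d2) a b) z)%:E).
  by rewrite -DB// lim_cst.
by apply/funext => z; rewrite patchE indicE; case: ifP => _; rewrite ?mulr1 ?mulr0.
Qed.

(** The derivative of order zero chosen in the Sobolev norm is thus a version of the
    function itself, whose energy is controlled by the norm. *)
Lemma weak_partial0_ae Omega alpha f u : open Omega -> (forall c, alpha c = 0%N) ->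
  locally_summable Omega f -> is_weak_partial Omega alpha f u ->
  {ae mu, forall z, Omega z -> f z = u z}.
Proof.
move=> oO a0 lf [lu fu].
have [wf [rf ff]] := locally_summable_rep oO lf; have [wu [ru uu]] := locally_summable_rep oO lu.
have : {ae mu, forall z, Omega z -> (wf \- wu) z = 0}.
  apply: (tensor_orthogonal_ae0 oO (loc_repB rf ru)) => g a b sg g0 abO.
  have tg := test_function_tens sg g0 abO.
  have [_ iwf] := test_function_integrable alpha rf tg.
  have [_ iwu] := test_function_integrable alpha ru tg.
  have [_ f0 _] := rf; have [_ u0 _] := ru.
  have := fu _ tg; rewrite multi_partial_tens//.
  rewrite (_ : tens _ = tens g); last first.
    by congr tens; apply/funext => c; rewrite a0.
  rewrite /multi_order big1// expr0 mul1r (Rintegral_rep _ ff f0) (Rintegral_rep _ uu u0).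
  under [X in _ -> X = _]eq_Rintegral do rewrite /= mulrBl.
  by rewrite RintegralB// => ->; rewrite subrr.
move=> H; apply: filterS3 H ff uu => z H1 H2 H3 Oz.
by rewrite H2// H3//; apply/subr0_eq/H1.
Qed.

End weak_partials.

(** * Sobolev functions *)

Lemma coord_le_norm {R : realType} n i (x : 'rV[R]_n) : `|rV_coord i x| <= `|x|.
Proof.
rewrite [leRHS]/Num.norm /= mx_normrE; apply/bigmax_geP; right => /=.
by exists (ord0, i).
Qed.

Lemma compact_lebesgue_lty {R : realType} n (K : set 'rV[R]_n) : compact K ->
  (lebesgue_rV n K < +oo)%E.
Proof.
move=> cK; have [M [_ HM]] := compact_bounded cK.
have mK : measurable K by apply: closed_measurable_rV; exact: compact_closed.
pose b (i : 'I_n) := `|M| + 2.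
apply: (@le_lt_trans _ _ (lebesgue_rV n (box (@rV_coord R n) (fun i => - b i) b))); last first.
  exact: lebesgue_box_lty.
apply: le_measure; rewrite ?inE//; first by apply: measurable_box; exact: rV_coord_meas.
move=> x Kx i; have xM : `|x| <= `|M| + 1.
  apply: HM => //; apply: (le_lt_trans (ler_norm M)); by rewrite ltrDl.
have := le_trans (coord_le_norm i x) xM; rewrite /rV_coord /b ler_norml => /andP[h1 h2].
by apply/andP; split; lra.
Qed.

(** Room persists under small moves at the cost of one generation, so that compactness
    applies. *)
Lemma compact_room {R : realType} d (Omega K : set 'rV[R]_d) : open Omega ->
  compact K -> K `<=` Omega -> exists n, forall y, K y -> room Omega n y.
Proof.
move=> oO /compact_near_coveringP cK KO.
have [n _ Hn] : \forall n \near \oo, K `<=` room Omega n.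
  apply: cK => x Kx; have [k rk] := open_room oO (KO x Kx).
  have p2 : 0 < 2 / 2 ^+ k.+1 :> R by rewrite divr_gt0// exprn_gt0.
  exists ([set y | ball x (2 / 2 ^+ k.+1) y], [set n | (k.+1 <= n)%N]).
    by split; [exact: nbhsx_ballx|exists k.+1].
  move=> [y n] /= [xy kn]; apply: (room_le kn); apply: (room_step rk) => j.
  rewrite distrC ltW//; move: xy; rewrite -ball_normE /=; apply: le_lt_trans.
  by have := coord_le_norm j (x - y); rewrite /rV_coord !mxE.
exists n; exact: (Hn n (leqnn n)).
Qed.

Section sobolev_data.
Local Open Scope classical_set_scope.
Context {R : realType} {d1 d2 : nat}.
Local Notation E := ('rV[R]_d1 * 'rV[R]_d2)%type.
Local Notation coord := ('I_d1 + 'I_d2)%type.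
Local Notation leb1 := (@lebesgue_rV R d1).
Local Notation leb2 := (@lebesgue_rV R d2).
Local Notation mu := (leb1 \x leb2)%E.
Variables (Omega1 : set 'rV[R]_d1) (Omega2 : set 'rV[R]_d2) (p : R) (l : nat).
Hypotheses (open1 : open Omega1) (open2 : open Omega2) (p1 : 1 <= p) (l0 : (0 < l)%N).
Hypothesis pl : (d2%:R < p * l%:R) \/ (p = 1 /\ l = d2).
Implicit Types (f g h w : E -> R) (v : 'I_d2 -> E -> R) (alpha : coord -> nat).
Local Notation Omega := (Omega1 `*` Omega2).
Local Notation weak_data := (weak_data Omega1 Omega2 p l).

Let openO : open Omega.
Proof.
rewrite openE => -[x y] [Ox Oy]; exists (Omega1, Omega2) => //.
by split; exact: open_nbhs_nbhs.
Qed.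

Lemma multi_order0 : multi_order (fun _ : coord => 0%N) = 0%N.
Proof. by rewrite /multi_order big1. Qed.

(** The energies of the data are computed from the chosen derivatives G, so that bounds
    on the Sobolev norm apply to them. *)
Lemma weak_data_of h (G : (coord -> nat) -> E -> R) : locally_summable Omega h ->
  (forall alpha, (multi_order alpha <= l)%N -> is_weak_partial Omega alpha h (G alpha) /\
    (\int[mu]_(z in Omega) (`|G alpha z| `^ p)%:E < +oo)%E) ->
  exists w v, [/\ weak_data w v, {ae mu, forall z, Omega z -> h z = w z},
    (\int[mu]_z (`|w z| `^ p)%:E =
      \int[mu]_(z in Omega) (`|G (fun=> 0%N) z| `^ p)%:E)%E &
    forall i, (\int[mu]_z (`|v i z| `^ p)%:E =
      \int[mu]_(z in Omega) (`|G (single (inr i) l) z| `^ p)%:E)%E].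
Proof.
move=> lh HG.
have p0 : p != 0 by rewrite gt_eqF// (lt_le_trans ltr01).
have ord1 (i : 'I_d2) : (multi_order (single (inr i : coord) l) <= l)%N.
  by rewrite multi_order_single.
have [|wk0 fin0] := HG (fun=> 0%N); first by rewrite multi_order0.
have [w [rw Gw]] := locally_summable_rep openO wk0.1.
have /choice[v Hv] : forall i : 'I_d2, exists vi, loc_rep Omega vi /\
    {ae mu, forall z, Omega z -> G (single (inr i) l) z = vi z}.
  by move=> i; apply: (locally_summable_rep openO); have [[]] := HG _ (ord1 i).
have hw : {ae mu, forall z, Omega z -> h z = w z}.
  have := weak_partial0_ae openO (fun=> erefl) lh wk0; move: Gw.
  by apply: filterS2 => z H1 H2 Oz; rewrite H2// H1.
have powE k u : loc_rep Omega u -> {ae mu, forall z, Omega z -> k z = u z} ->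
    (\int[mu]_z (`|u z| `^ p)%:E = \int[mu]_(z in Omega) (`|k z| `^ p)%:E)%E.
  move=> [_ u0 _] ku; apply/esym; apply: integral_rep => [|z Oz].
    by apply: filterS ku => z H /H ->.
  by rewrite u0// normr0 powR0.
have Ew := powE _ _ rw Gw.
have Ev i := powE _ _ (Hv i).1 (Hv i).2.
have [mw w0 _] := rw.
exists w, v; split; [split|exact: hw|exact: Ew|exact: Ev].
- by split; [exact: mw|rewrite Ew; exact: fin0].
- move=> i; have [[mv _ _] _] := Hv i; split; first exact: mv.
  by rewrite Ev; have [_] := HG _ (ord1 i); exact.
- move=> i g a b sg g0 abO; have [[_ v0 _] Gv] := Hv i.
  have [[_ wk] _] := HG _ (ord1 i).
  have := wk _ (test_function_tens sg g0 abO).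
  rewrite multi_partial_tens// multi_order_single.
  by rewrite (Rintegral_rep _ hw w0) (Rintegral_rep _ Gv v0).
Qed.

Lemma sobolev_weak_data f : sobolev p l Omega f ->
  exists w v, weak_data w v /\ {ae mu, forall z, Omega z -> f z = w z}.
Proof.
move=> [lf Hf].
have /choice[G HG] : forall alpha, exists u, (multi_order alpha <= l)%N ->
    is_weak_partial Omega alpha f u /\
    (\int[mu]_(z in Omega) (`|u z| `^ p)%:E < +oo)%E.
  move=> alpha; have [al|] := leqP (multi_order alpha) l; last by exists (cst 0).
  by have [u wu finu] := Hf alpha al; exists u.
by have [w [v [wd fw _ _]]] := weak_data_of lf HG; exists w, v.
Qed.

Lemma sobolev_norm_term h (r : R) alpha : 0 < r -> (sobolev_norm p l Omega h < r%:E)%E ->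
  (multi_order alpha <= l)%N ->
  (\int[mu]_(z in Omega) (`|weak_partial Omega alpha h z| `^ p)%:E <= (r `^ p)%:E)%E.
Proof.
move=> r0 hr al; have p0 : 0 < p by exact: lt_le_trans p1.
(* The multi-index alpha as one of the indices of the sum in the norm. *)
pose a : {ffun coord -> 'I_l.+1} := [ffun c => inord (alpha c)].
have aE : (fun c => a c : nat) = alpha.
  apply/funext => c; rewrite ffunE inordK// ltnS (leq_trans _ al)//.
  by rewrite /multi_order (bigD1 c)//= leq_addr.
have I0 beta : (0 <= \int[mu]_(z in Omega) (`|weak_partial Omega beta h z| `^ p)%:E)%E.
  by apply: integral_ge0 => z _; rewrite lee_fin powR_ge0.
rewrite leNgt; apply/negP => ar.
move: hr; apply/negP; rewrite -leNgt /sobolev_norm.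
have -> : r%:E = ((r `^ p)%:E `^ p^-1)%E.
  by rewrite poweR_EFin -powRrM divff ?gt_eqF// powRr1// ltW.
have aS : ((r `^ p)%:E <= \sum_(a : {ffun coord -> 'I_l.+1} | (multi_order (fun i => a i) <= l)%N)
    \int[mu]_(z in Omega) (`|weak_partial Omega (fun i => a i) h z| `^ p)%:E)%E.
  rewrite (bigD1 a)/=; last by rewrite aE.
  rewrite aE; apply: (le_trans (ltW ar)); rewrite leeDl//.
  by apply: sume_ge0 => b _; exact: I0.
apply: gt0_ler_poweR => //; rewrite ?in_itv/= ?leey ?andbT.
- by rewrite invr_ge0 ltW.
- by rewrite lee_fin powR_ge0.
- by apply: sume_ge0 => b _; exact: I0.
Qed.

(** Take the majorants a = Lam energy and b = tau provided by [slice_bound]. *)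
Lemma VC1_norm_le K (tau : R) : compact K -> K `<=` Omega2 -> 0 < tau ->
  exists2 Lam : R, 0 <= Lam & forall w v h, weak_data w v ->
    {ae mu, forall z, Omega z -> h z = w z} ->
    (VC1_norm leb1 leb2 Omega1 K h <=
      Lam%:E * (\int[mu]_z (`|w z| `^ p)%:E + \sum_i \int[mu]_z (`|v i z| `^ p)%:E) +
      tau%:E * leb2 K)%E.
Proof.
move=> cK KO tau0; have [n rn] := compact_room open2 cK KO.
have mK : measurable K by apply: closed_measurable_rV; exact: compact_closed.
have [Lam L0 HL] := slice_bound open1 open2 p1 l0 pl n tau0.
exists Lam => // w v h wd hw; have [Lw Lv _] := wd.
have mw := Lw.1; have mv i := (Lv i).1.
have men := measurable_energy p mw mv.
have en0 x : (0 <= energy p w v x)%E by exact: energy_ge0.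
have ien : (\int[leb1]_x energy p w v x < +oo)%E.
  rewrite integral_energy// lte_add_pinfty//; first by case: Lw.
  by apply: lte_sum_pinfty => i _; case: (Lv i).
have fen : {ae leb1, forall x, energy p w v x \is a fin_num}.
  have H : leb1.-integrable setT (energy p w v).
    apply/integrableP; split => //.
    by under eq_integral do rewrite gee0_abs//.
  by apply: filterS (integrable_ae measurableT H) => x /(_ Logic.I).
pose a x := Lam * fine (energy p w v x).
have ma : measurable_fun setT a.
  apply: measurable_funM => //.
  exact: (measurableT_comp (fine_measurable measurableT)).
have a0 x : 0 <= a x by rewrite mulr_ge0// fine_ge0.
apply: (@le_trans _ _ (\int[leb1]_(x in Omega1) `|a x|%:E +
                       \int[leb2]_(y in K) `|cst tau y|%:E)%E).
  apply: ereal_inf_lbound; exists a, (cst tau); split => //.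
  - by exists a; [exact: measurable_funTS|exact: aeW].
  - by exists (cst tau); [exact: measurable_cst|exact: aeW].
  - have := HL w v wd; have := ae_fst (d2 := d2) fen; move: hw.
    apply: filterS3 => z H1 H2 H3 [zO zK]; rewrite H1; last by split; [|exact: KO].
    have := H3 zO (rn _ zK); rewrite -(fineK H2) -EFinM -EFinD lee_fin /a /=.
    by rewrite addrC.
apply: leeD.
  rewrite -integral_energy//.
  apply: (@le_trans _ _ (\int[leb1]_x (Lam%:E * energy p w v x))%E); last first.
    by rewrite ge0_integralZl_EFin.
  rewrite integral_mkcond; apply: ge0_le_integral => //.
  - by move=> x _; rewrite patchE; case: ifP.
  - apply/(measurable_restrictT _ (open_measurable_rV open1)).
    by apply/measurable_EFinP/measurable_funTS; exact: measurableT_comp.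
  - by apply: emeasurable_funM.
  - move=> x _; rewrite patchE; case: ifP => _; last by rewrite mule_ge0 ?lee_fin.
    rewrite ger0_norm// EFinM lee_wpmul2l ?lee_fin//.
    by case: (energy p w v x) (en0 x) => //= _; rewrite leey.
under eq_integral do rewrite /= gtr0_norm//.
by rewrite integral_cst.
Qed.

Lemma sobolev_VC1 K f : compact K -> K `<=` Omega2 -> sobolev p l Omega f ->
  VC1 leb1 leb2 Omega1 K f.
Proof.
move=> cK KO sf; have [w [v [wd fw]]] := sobolev_weak_data sf.
have mK : measurable K by apply: closed_measurable_rV; exact: compact_closed.
split; first exact: (weak_data_virtually_continuous open1 open2 p1 l0 pl wd fw mK KO).
have [Lam L0 HL] := VC1_norm_le cK KO ltr01.
apply: (le_lt_trans (HL w v f wd fw)); rewrite mul1e.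
have [Lw Lv _] := wd.
have T0 : (0 <= \int[mu]_z (`|w z| `^ p)%:E + \sum_i \int[mu]_z (`|v i z| `^ p)%:E)%E.
  apply: adde_ge0; first by apply: integral_ge0 => z _; rewrite lee_fin powR_ge0.
  by apply: sume_ge0 => i _; apply: integral_ge0 => z _; rewrite lee_fin powR_ge0.
apply: lte_add_pinfty; last exact: compact_lebesgue_lty.
apply: lte_mul_pinfty => //.
apply: lte_add_pinfty; first by case: Lw.
by apply: lte_sum_pinfty => i _; case: (Lv i).
Qed.

(** First choose tau small compared with the measure of K, which fixes Lam; then choose
    r so small that Lam times the energy of g - f is small as well. *)
Lemma sobolev_VC1_continuous K f (e : R) : compact K -> K `<=` Omega2 ->
  sobolev p l Omega f -> 0 < e -> exists2 r : R, 0 < r & forall g, sobolev p l Omega g ->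
    (sobolev_norm p l Omega (g \- f)%R < r%:E)%E ->
    (VC1_norm leb1 leb2 Omega1 K (g \- f)%R < e%:E)%E.
Proof.
move=> cK KO [lf Hf] e0; have p0 : 0 < p by exact: lt_le_trans p1.
have kfin : leb2 K \is a fin_num by rewrite ge0_fin_numE// compact_lebesgue_lty.
pose k := fine (leb2 K); have k0 : 0 <= k by exact: fine_ge0.
pose tau := e / 2 / (k + 1).
have tau0 : 0 < tau by rewrite !divr_gt0// ltr_wpDl.
have [Lam L0 HL] := VC1_norm_le cK KO tau0.
pose c := e / 2 / (Lam * (1 + d2%:R) + 1).
have LL0 : 0 <= Lam * (1 + d2%:R) by rewrite mulr_ge0// addr_ge0.
have c0 : 0 < c by rewrite !divr_gt0// ltr_wpDl.
exists (c `^ p^-1); first exact: powR_gt0.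
move=> g [lg Hg] nr.
have rp : (c `^ p^-1) `^ p = c by rewrite -powRrM mulVf ?gt_eqF// powRr1// ltW.
pose G alpha := weak_partial Omega alpha (g \- f).
have term alpha : (multi_order alpha <= l)%N ->
    (\int[mu]_(z in Omega) (`|G alpha z| `^ p)%:E <= c%:E)%E.
  by move=> al; rewrite -rp; apply: sobolev_norm_term => //; exact: powR_gt0.
have HG alpha : (multi_order alpha <= l)%N -> is_weak_partial Omega alpha (g \- f) (G alpha) /\
    (\int[mu]_(z in Omega) (`|G alpha z| `^ p)%:E < +oo)%E.
  move=> al; split; last exact: le_lt_trans (term alpha al) (ltry _).
  have [u wu _] := Hf alpha al; have [u' wu' _] := Hg alpha al.
  apply: (xgetPex (cst 0)); exists (u' \- u).
  exact: (weak_partialB openO lf lg wu wu').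
have lgf : locally_summable Omega (g \- f) by exact: locally_summableB.
have [w [v [wd fw Ew Ev]]] := weak_data_of lgf HG.
apply: (le_lt_trans (HL w v _ wd fw)).
have T : (\int[mu]_z (`|w z| `^ p)%:E + \sum_i \int[mu]_z (`|v i z| `^ p)%:E <=
    ((1 + d2%:R) * c)%:E)%E.
  rewrite mulrDl mul1r EFinD leeD//; first by rewrite Ew term// multi_order0.
  apply: (@le_trans _ _ (\sum_(i < d2) c%:E)%E).
    by apply: lee_sum => i _; rewrite Ev term// multi_order_single.
  by rewrite sumEFin lee_fin sumr_const card_ord mulr_natl.
apply: (@le_lt_trans _ _ (Lam%:E * ((1 + d2%:R) * c)%:E + tau%:E * k%:E)%E).
  rewrite /k fineK// leeD2r// lee_wpmul2l// lee_fin//.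
rewrite -!EFinM -EFinD lte_fin mulrA.
have h1 : Lam * (1 + d2%:R) * c < e / 2.
  rewrite /c mulrCA -[ltRHS]mulr1 ltr_pM2l ?divr_gt0//.
  by rewrite ltr_pdivrMr ?mul1r ?ltrDl// ltr_wpDl.
have h2 : tau * k < e / 2.
  rewrite /tau mulrAC ltr_pdivrMr ?ltr_wpDl// ltr_pM2l ?divr_gt0//.
  by rewrite ltrDl.
lra.
Qed.

End sobolev_data.

Theorem theorem10 (R : realType) (d1 d2 : nat)
    (Omega1 : set 'rV[R]_d1) (Omega2 : set 'rV[R]_d2) (p : R) (l : nat)
    (domain1 : is_domain Omega1) (domain2 : is_domain Omega2)
    (p_ge1 : 1 <= p) (l_ge1 : (1 <= l)%N)
    (pl_gt : d2%:R < p * l%:R \/ (p = 1 /\ l = d2)) :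
  (forall f : 'rV[R]_d1 * 'rV[R]_d2 -> R,
    sobolev p l (Omega1 `*` Omega2) f ->
    virtually_continuous (lebesgue_rV d1) (lebesgue_rV d2) Omega1 Omega2 f) /\
  (forall K : set 'rV[R]_d2, compact K -> K `<=` Omega2 ->
    (forall f : 'rV[R]_d1 * 'rV[R]_d2 -> R,
      sobolev p l (Omega1 `*` Omega2) f ->
      VC1 (lebesgue_rV d1) (lebesgue_rV d2) Omega1 K f) /\
    (forall f : 'rV[R]_d1 * 'rV[R]_d2 -> R,
      sobolev p l (Omega1 `*` Omega2) f ->
      forall e : R, 0 < e -> exists2 r : R, 0 < r &
        forall g : 'rV[R]_d1 * 'rV[R]_d2 -> R,
          sobolev p l (Omega1 `*` Omega2) g ->
          (sobolev_norm p l (Omega1 `*` Omega2) (g \- f)%R < r%:E)%E ->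
          (VC1_norm (lebesgue_rV d1) (lebesgue_rV d2) Omega1 K (g \- f)%R
             < e%:E)%E)).
Proof.
have [_ open1 _] := domain1; have [_ open2 _] := domain2.
split=> [f sf|K cK KO].
  have [w [v [wd fw]]] := sobolev_weak_data open1 open2 p_ge1 sf.
  apply: (weak_data_virtually_continuous open1 open2 p_ge1 l_ge1 pl_gt wd fw) => //.
  exact: open_measurable_rV.
split=> f sf.
  exact: (sobolev_VC1 open1 open2 p_ge1 l_ge1 pl_gt cK KO sf).
by move=> e; exact: (sobolev_VC1_continuous open1 open2 p_ge1 l_ge1 pl_gt cK KO sf).
Qed.
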